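(* Let $f$ be in the Schwartz class of $\mathbb{H}^n$, let $\mu$ be a compactly supported, positive, finite Radon measure on $\mathbb{H}^n$, and let $d\varrho(\lambda)=\frac{|\lambda|^n}{(2\pi)^{n+1}}\,d\lambda$ on $\mathbb{R}^*=\mathbb{R}\setminus\{0\}$. Then $$\int_{\mathbb{H}^n} f(p)\,d\mu(p)=\int_{\mathbb{R}^*}\mathrm{tr}\big(\widehat{\mu}(\lambda)^*\,\widehat{f}(\lambda)\big)\,d\varrho(\lambda).$$
   Context: The Heisenberg group $\mathbb{H}^n$ is $\mathbb{R}^{2n}\times\mathbb{R}$ with group law $(z,t)(z',t')=(z+z',\,t+t'-\tfrac12\omega(z,z'))$, where for $z=(x,y)$, $z'=(x',y')$ with $x,y,x',y'\in\mathbb{R}^n$, $\omega(z,z')=x\cdot y'-y\cdot x'$. Its Haar measure $dp$ is Lebesgue measure on $\mathbb{R}^{2n+1}$, and its Schwartz class is $\mathscr{S}(\mathbb{H}^n)=\mathscr{S}(\mathbb{R}^{2n+1})$. For $\lambda\in\mathbb{R}^*$, the (Schrödinger) unitary representation $\rho_\lambda$ of $\mathbb{H}^n$ on $L^2(\mathbb{R}^n)$ is $\rho_\lambda(x,y,t)\varphi(\xi)=e^{i\lambda(t+x\cdot\xi+\frac{x\cdot y}{2})}\varphi(\xi+y)$. The group Fourier transform of $f\in L^1(\mathbb{H}^n)$ is the operator-valued function $\widehat f(\lambda)\varphi=\int_{\mathbb{H}^n}f(p)\rho_\lambda(p)\varphi\,dp$ and that of a finite compactly supported Radon measure $\mu$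 is $\widehat\mu(\lambda)\varphi=\int_{\mathbb{H}^n}\rho_\lambda(p)\varphi\,d\mu(p)$ ($\lambda\in\mathbb{R}^*$, $\varphi\in L^2(\mathbb{R}^n)$); these are bounded operators on $L^2(\mathbb{R}^n)$, with integrals understood weakly. $\mathrm{tr}$ denotes the operator trace and $T^*$ the adjoint of $T$. *)

(* Defs.v *)
From HB Require Import structures.
From mathcomp Require Import all_boot all_order all_algebra.
From mathcomp Require Import all_classical all_reals all_analysis.
From mathcomp Require Import measurable_realfun complex ring.

Set Implicit Arguments.
Unset Strict Implicit.
Unset Printing Implicit Defensive.

Import Order.TTheory GRing.Theory Num.Theory.
Import numFieldNormedType.Exports.

Local Open Scope classical_set_scope.
Local Open Scope ring_scope.

Section borel_rV.
Variables (R : realType) (n : nat).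

Definition borel_rV : set (set 'rV[R]_n) := <<s [set U : set 'rV[R]_n | open U] >>.

Let borel_rV0 : borel_rV set0.
Proof. exact: sigma_algebra0. Qed.

Let borel_rVC A : borel_rV A -> borel_rV (~` A).
Proof. by move=> mA; rewrite -setTD; exact: sigma_algebraCD. Qed.

Let borel_rV_bigcup (F : (set 'rV[R]_n)^nat) :
  (forall i, borel_rV (F i)) -> borel_rV (\bigcup_i F i).
Proof. exact: sigma_algebra_bigcup. Qed.

Fact borel_rV_display : measure_display.
Proof. exact: default_measure_display. Qed.

HB.instance Definition _ := @isMeasurable.Build borel_rV_display
  'rV[R]_n borel_rV borel_rV0 borel_rVC borel_rV_bigcup.

End borel_rV.

Section borel_rV_theory.
Variable R : realType.

Lemma open_rV_measurable n (U : set 'rV[R]_n) : open U -> measurable U.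
Proof. by move=> oU; apply: sub_sigma_algebra. Qed.

Let rat_box n (q : 'rV[rat]_n) (k : nat) : set 'rV[R]_n :=
  [set x : 'rV[R]_n | forall i, `|ratr (q 0 i) - x 0 i| < k.+1%:R^-1].

Lemma open_rV_bigcup n (U : set 'rV[R]_n) : open U ->
  exists I : set ('rV[rat]_n * nat),
    U = \bigcup_(qk in I) rat_box qk.1 qk.2.
Proof.
move=> oU; exists [set qk | rat_box qk.1 qk.2 `<=` U].
apply/seteqP; split; last by move=> x [qk /= +]; exact.
move=> x Ux; have := oU; rewrite openE => /(_ x Ux); rewrite /interior.
move=> /nbhs_ballP[e /= e0 xeU].
have [k _ ke] := near_infty_natSinv_lt (PosNum (divr_gt0 e0 (ltr0n _ 2))).
have {}ke : k.+1%:R^-1 < e / 2%:R by have /= := ke k; rewrite leqnn => ->.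
have d0 : 0 < (k.+1%:R : R)^-1 by rewrite invr_gt0.
have qP i : exists q : rat, `|ratr q - x 0 i| < k.+1%:R^-1.
  have [|q] := @rat_in_itvoo R (x 0 i - k.+1%:R^-1) (x 0 i + k.+1%:R^-1).
    by rewrite ltrD2l gtrN.
  by rewrite in_itv /= => qx; exists q; rewrite ltr_distl.
pose q : 'rV[rat]_n := \row_i projT1 (cid (qP i)).
exists (q, k) => /=; last by move=> i; rewrite mxE; case: cid.
move=> y /= qy; apply: xeU; rewrite /ball/=; split => // i j.
rewrite (ord1 i) /ball /= -(subrKA (ratr (q 0 j))).
rewrite (le_lt_trans (ler_normD _ _))// (splitr e) ltrD//.
  by rewrite distrC mxE; case: cid => /= r; move=> /lt_trans; exact.
by rewrite (lt_trans (qy j)).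
Qed.

Lemma measurable_fun_rV d (T : measurableType d) n (f : T -> 'rV[R]_n) :
  (forall i, measurable_fun setT (fun t => f t 0 i : measurableTypeR R)) ->
  measurable_fun setT f.
Proof.
move=> mf; apply: (@measurability _ _ _ _ _ _ [set U : set 'rV[R]_n | open U]) => //.
move=> _ [U /= oU <-]; rewrite setTI.
have [I ->] := open_rV_bigcup oU.
rewrite preimage_bigcup bigcup_mkcond.
apply: countable_bigcupT_measurable; first exact: countableP.
case=> q k; case: ifPn => // _ /=.
rewrite (_ : _ @^-1` _ = \bigcap_(i in [set: 'I_n])
   ((fun t => f t 0 i) @^-1` (ball (ratr (q 0 i) : R) k.+1%:R^-1))); last first.
  by apply/seteqP; split => t /= h i; [move=> _|]; exact: h.
apply: fin_bigcap_measurable; first exact: finite_finset.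
move=> i _; rewrite -[X in measurable X]setTI; apply: mf => //.
by rewrite ball_itv; exact: measurable_itv.
Qed.

End borel_rV_theory.

Section lebesgue_rV.
Variable R : realType.

Definition rV_cons n (p : measurableTypeR R * 'rV[R]_n) : 'rV[R]_n.+1 :=
  row_mx (const_mx p.1 : 'rV[R]_1) p.2.

Lemma coord_rV_measurable n (i : 'I_n) :
  measurable_fun setT (fun v : 'rV[R]_n => v 0 i : measurableTypeR R).
Proof.
apply: (@measurability _ _ _ _ _ _ (@RGenOpens.G R)).
  exact: RGenOpens.measurableE.
move=> _ [_ [a [b ->]] <-]; rewrite setTI; apply: open_rV_measurable.
apply: open_comp; last exact: interval_open.
by move=> x _; exact: coord_continuous.
Qed.

Lemma rV_cons_measurable n : measurable_fun setT (@rV_cons n).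
Proof.
apply: measurable_fun_rV => i.
case: (@split_ordP 1 n i) => j ->.
  rewrite (_ : (fun _ => _) = fst)//.
  by apply/funext => p; rewrite [LHS](@row_mxEl _ 1 1 n) mxE.
rewrite (_ : (fun _ => _) = (fun v : 'rV[R]_n => v 0 j) \o snd).
  exact: measurableT_comp (coord_rV_measurable j) _.
by apply/funext => p /=; rewrite [LHS](@row_mxEr _ 1 1 n).
Qed.

Section step.
Variables (n : nat) (m : {sigma_finite_measure set 'rV[R]_n -> \bar R}).

Definition lebesgue_rV_step : set 'rV[R]_n.+1 -> \bar R :=
  pushforward (@lebesgue_measure R \x m)%E (@rV_cons n).

Let step0 : lebesgue_rV_step set0 = 0%E.
Proof. by rewrite /lebesgue_rV_step /pushforward preimage_set0 measure0. Qed.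

Let step_ge0 A : (0 <= lebesgue_rV_step A)%E.
Proof. by rewrite /lebesgue_rV_step /pushforward measure_ge0. Qed.

Let step_sigma_additive : semi_sigma_additive lebesgue_rV_step.
Proof.
have mcons A : measurable A -> measurable (@rV_cons n @^-1` A).
  by move=> mA; rewrite -[X in measurable X]setTI; exact: rV_cons_measurable.
move=> F mF tF mUF; rewrite /lebesgue_rV_step /pushforward preimage_bigcup.
apply: measure_semi_sigma_additive.
- by move=> k; exact: mcons.
- apply/trivIsetP => /= i j _ _ ij; rewrite -preimage_setI.
  by move/trivIsetP : tF => /(_ _ _ _ _ ij) ->//; rewrite preimage_set0.
- by rewrite -preimage_bigcup; exact: mcons.
Qed.

HB.instance Definition _ := isMeasure.Build _ _ _ lebesgue_rV_step
  step0 step_ge0 step_sigma_additive.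

Let step_sigma_finite : sigma_finite setT lebesgue_rV_step.
Proof.
pose uncons (v : 'rV[R]_n.+1) : measurableTypeR R * 'rV[R]_n :=
  (v 0 0, rsubmx (v : 'rV[R]_(1 + n))).
have munc : measurable_fun setT uncons.
  apply: measurable_fun_pair; first exact: coord_rV_measurable.
  apply: measurable_fun_rV => i.
  rewrite (_ : (fun _ => _) =
    (fun v : 'rV[R]_n.+1 => v 0 (rshift 1 i) : measurableTypeR R)).
    exact: coord_rV_measurable.
  by apply/funext => v; rewrite mxE.
have consK : cancel (@rV_cons n) uncons.
  move=> [a v]; rewrite /uncons /rV_cons row_mxKr; congr pair.
  have := @row_mxEl R 1 1 n (const_mx a) v 0 0; rewrite [RHS]mxE => aE.
  by rewrite -[RHS]aE; congr (row_mx (const_mx a) v 0 _); exact/val_inj.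
have [F FT mF] : sigma_finite setT (@lebesgue_measure R \x m)%E.
  have /sigma_finiteP[F [TF ndF Foo]] := sigma_finiteT (@lebesgue_measure R).
  have /sigma_finiteP[G [TG ndG Goo]] := sigma_finiteT m.
  exists (fun k => F k `*` G k).
    rewrite -setXTT TF TG predeqE => -[x y]; split; last first.
      by move=> [k _ []/= ? ?]; split; exists k.
    move=> [/= [j _ Fjx] [k _ Gky]]; exists (maxn j k) => //; split.
    - by move: x Fjx; exact/subsetPset/ndF/leq_maxl.
    - by move: y Gky; exact/subsetPset/ndG/leq_maxr.
  move=> k; have [? ?] := Foo k; have [? ?] := Goo k.
  split; first exact: measurableX.
  by rewrite product_measure1E// lte_mul_pinfty// ge0_fin_numE.
exists (fun k => uncons @^-1` F k).
  by rewrite -preimage_bigcup -FT preimage_setT.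
move=> k; have [mFk Fkoo] := mF k; split.
  by rewrite -[X in measurable X]setTI; exact: munc.
rewrite /lebesgue_rV_step /pushforward.
by rewrite -comp_preimage (_ : uncons \o _ = id)//; apply/funext.
Qed.

HB.instance Definition _ := Measure_isSigmaFinite.Build _ _ _ lebesgue_rV_step
  step_sigma_finite.

End step.

Fixpoint lebesgue_rV n : {sigma_finite_measure set 'rV[R]_n -> \bar R} :=
  match n with
  | 0 => (dirac (0 : 'rV[R]_0) : {sigma_finite_measure set _ -> \bar R})
  | k.+1 => (lebesgue_rV_step (lebesgue_rV k)
      : {sigma_finite_measure set _ -> \bar R})
  end.

End lebesgue_rV.

Section complex_integral.
Local Open Scope complex_scope.
Context d (T : measurableType d) (R : realType).
Variable mu : {measure set T -> \bar R}.

Definition cmeasurable (g : T -> R[i]) :=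
  measurable_fun setT (fun x => complex.Re (g x)) /\
  measurable_fun setT (fun x => complex.Im (g x)).

Definition cintegrable (D : set T) (g : T -> R[i]) :=
  mu.-integrable D (fun x => (complex.Re (g x))%:E) /\
  mu.-integrable D (fun x => (complex.Im (g x))%:E).

Definition cintegral (D : set T) (g : T -> R[i]) : R[i] :=
  (\int[mu]_(x in D) complex.Re (g x)) +i* (\int[mu]_(x in D) complex.Im (g x)).

End complex_integral.

(* The space L^2(R^n; C) is represented by square-integrable functions, without
   quotienting by a.e. equality; inner is linear in its first argument. *)
Section L2.
Variables (R : realType) (n : nat).
Implicit Types (phi psi : 'rV[R]_n -> R[i]).

Definition L2_norm phi : \bar R :=
  Lnorm (lebesgue_rV R n) 2%:E
    (fun xi => (ComplexField.Normc.normc (phi xi))%:E).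

Definition L2 phi := cmeasurable phi /\ (L2_norm phi < +oo)%E.

Definition inner phi psi : R[i] :=
  cintegral (lebesgue_rV R n) setT (fun xi => phi xi * conjc (psi xi)).

(* D is not always setT, as L^2(R^0) is one-dimensional *)
Definition orthonormal_basis (D : set nat) (e : nat -> 'rV[R]_n -> R[i]) :=
  [/\ forall j, D j -> L2 (e j),
      forall j k, D j -> D k -> inner (e j) (e k) = (j == k)%:R &
      forall phi, L2 phi ->
        (fun N => L2_norm (fun xi => phi xi
           - \sum_(0 <= j < N | j \in D) inner phi (e j) * e j xi))
        @ \oo --> 0%E].

End L2.

Section operators.
Variables (R : realType) (n : nat).
Notation vect := ('rV[R]_n -> R[i]).
Implicit Types (phi psi chi : vect) (S : vect -> vect).

(* chi is the Pettis integral of F *)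
Definition is_weak_integral d (T : measurableType d)
    (nu : {measure set T -> \bar R}) (F : T -> vect) chi :=
  L2 chi /\ forall psi, L2 psi ->
    cintegrable nu setT (fun p => inner (F p) psi) /\
    inner chi psi = cintegral nu setT (fun p => inner (F p) psi).

Definition weak_integral d (T : measurableType d)
    (nu : {measure set T -> \bar R}) (F : T -> vect) : vect :=
  xget (fun=> 0) [set chi | is_weak_integral nu F chi].

Definition adjoint S : vect -> vect := fun phi =>
  xget (fun=> 0)
    [set chi | L2 chi /\ forall psi, L2 psi -> inner (S psi) phi = inner psi chi].

Definition abs_summable_to (a : nat -> R[i]) (c : R[i]) :=
  [/\ cvgn (series (fun j => ComplexField.Normc.normc (a j))),
      series (fun j => complex.Re (a j)) @ \oo --> complex.Re c &
      series (fun j => complex.Im (a j)) @ \oo --> complex.Im c].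

(* c is the sum of <S e_j, e_j> over every orthonormal basis (e_j). For a
   bounded operator S on L^2(R^n; C), such a c exists iff S is trace class. *)
Definition has_trace S (c : R[i]) :=
  forall (D : set nat) (e : nat -> vect), orthonormal_basis D e ->
    abs_summable_to
      (fun j => if j \in D then inner (S (e j)) (e j) else 0) c.

Definition trace S : R[i] := xget 0 [set c | has_trace S c].

End operators.

Section schwartz.
Variables (R : realType) (N : nat).

Fixpoint iter_partial (s : seq 'I_N) (u : 'rV[R]_N -> R) : 'rV[R]_N -> R :=
  if s is i :: s' then fun x => 'D_('e_i) (iter_partial s' u) x else u.

Definition smooth (u : 'rV[R]_N -> R) :=
  forall s, continuous (iter_partial s u) /\
    forall i x, derivable (iter_partial s u) x 'e_i.

Definition real_schwartz (u : 'rV[R]_N -> R) :=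
  smooth u /\
  forall (alpha : 'I_N -> nat) (s : seq 'I_N), exists C : R,
    forall x : 'rV[R]_N, `|(\prod_i x 0 i ^+ alpha i) * iter_partial s u x| <= C.

(* derivatives of complex-valued functions are taken componentwise *)
Definition schwartz (f : 'rV[R]_N -> R[i]) :=
  real_schwartz (fun x => complex.Re (f x)) /\ real_schwartz (fun x => complex.Im (f x)).

End schwartz.

Section radon.
Variables (R : realType) (N : nat).
Variable mu : {measure set 'rV[R]_N -> \bar R}.

Definition radon_measure :=
  (forall K, compact K -> (mu K < +oo)%E) /\
  (forall A, measurable A ->
     mu A = ereal_sup [set mu K | K in [set K | compact K /\ K `<=` A]]).

Definition compactly_supported := exists2 K, compact K & mu (~` K) = 0%E.

End radon.

(* The point (x, y, t) of the Heisenberg group is the row vector of its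
   coordinates, and the Haar measure is lebesgue_rV R (n + n + 1). *)
Notation heisenberg R n := 'rV[R]_(n + n + 1).

Section heisenberg.
Local Open Scope complex_scope.
Variables (R : realType) (n : nat).
Implicit Types (p q : heisenberg R n).

Definition dot (u v : 'rV[R]_n) : R := \sum_i u 0 i * v 0 i.

Definition hx p : 'rV[R]_n := lsubmx (lsubmx p).
Definition hy p : 'rV[R]_n := rsubmx (lsubmx p).
Definition ht p : R := rsubmx p 0 0.

Definition omega p q : R := dot (hx p) (hy q) - dot (hy p) (hx q).

Definition hmul p q : heisenberg R n :=
  row_mx (lsubmx p + lsubmx q)
         (const_mx (ht p + ht q - 2^-1 * omega p q)).

Definition expi (theta : R) : R[i] := cos theta +i* sin theta.

Definition rho (lambda : R) p (phi : 'rV[R]_n -> R[i]) : 'rV[R]_n -> R[i] :=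
  fun xi => expi (lambda * (ht p + dot (hx p) xi + dot (hx p) (hy p) / 2))
            * phi (xi + hy p).

Definition fourier (f : heisenberg R n -> R[i]) (lambda : R)
    (phi : 'rV[R]_n -> R[i]) : 'rV[R]_n -> R[i] :=
  weak_integral (lebesgue_rV R (n + n + 1))
    (fun p xi => f p * rho lambda p phi xi).

Definition fourier_measure (mu : {measure set (heisenberg R n) -> \bar R})
    (lambda : R) (phi : 'rV[R]_n -> R[i]) : 'rV[R]_n -> R[i] :=
  weak_integral mu (fun p => rho lambda p phi).

Lemma expiD a b : expi (a + b) = expi a * expi b.
Proof.
rewrite /expi cosD sinD; apply/eqP; rewrite eq_complex /= eqxx.
by rewrite [X in _ == X]addrC mulrC eqxx.
Qed.

Let dotC u v : dot u v = dot v u.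
Proof. by apply: eq_bigr => i _; rewrite mulrC. Qed.

Let dotDl u v w : dot (u + v) w = dot u w + dot v w.
Proof. by rewrite -big_split; apply: eq_bigr => i _; rewrite mxE mulrDl. Qed.

Let dotDr u v w : dot u (v + w) = dot u v + dot u w.
Proof. by rewrite dotC dotDl !(dotC u). Qed.

Lemma rho_hmul lambda p q phi :
  rho lambda (hmul p q) phi = rho lambda p (rho lambda q phi).
Proof.
have hxM : hx (hmul p q) = hx p + hx q by rewrite /hx row_mxKl linearD.
have hyM : hy (hmul p q) = hy p + hy q by rewrite /hy row_mxKl linearD.
have htM : ht (hmul p q) = ht p + ht q - 2^-1 * omega p q.
  by rewrite /ht row_mxKr mxE.
apply/funext => xi; rewrite /rho hyM mulrA -expiD addrA.
congr (expi _ * _); rewrite -mulrDr; congr (_ * _).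
rewrite htM hxM /omega !dotDl !dotDr (dotC (hy p)) (dotC (hx q) (hy p)).
by field.
Qed.

End heisenberg.

Section plancherel.
Variables (R : realType) (n : nat).

Definition plancherel_density (lambda : R) : R :=
  `|lambda| ^+ n / (2 * pi) ^+ n.+1.

Definition plancherel (A : set (measurableTypeR R)) : \bar R :=
  (\int[@lebesgue_measure R]_(lambda in A) (plancherel_density lambda)%:E)%E.

Let plancherel_density_ge0 lambda : 0 <= plancherel_density lambda.
Proof.
by rewrite /plancherel_density divr_ge0 ?exprn_ge0// mulr_ge0// pi_ge0.
Qed.

Let measurable_plancherel_density :
  measurable_fun setT (plancherel_density : measurableTypeR R -> R).
Proof.
apply: measurable_funM; last exact: measurable_cst.
by apply: measurable_funX; exact: normr_measurable.
Qed.

Let plancherel0 : plancherel set0 = 0%E.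
Proof. by rewrite /plancherel integral_set0. Qed.

Let plancherel_ge0 A : (0 <= plancherel A)%E.
Proof. by apply: integral_ge0 => x _; rewrite lee_fin. Qed.

Let plancherel_sigma_additive : semi_sigma_additive plancherel.
Proof.
apply: semi_sigma_additive_nng_induced.
- by apply/measurable_EFinP.
- by move=> x; rewrite lee_fin.
Qed.

HB.instance Definition _ := isMeasure.Build _ _ _ plancherel
  plancherel0 plancherel_ge0 plancherel_sigma_additive.

End plancherel.

(* Main.v *)
Require Import Defs.
From mathcomp Require Import all_boot all_order all_algebra.
From mathcomp Require Import all_classical all_reals all_analysis.
From mathcomp Require Import measurable_realfun complex ring lra.

(** The operator [fourier f lambda] is an integral operator. Its kernel
    [K lambda f xi eta] is the Euclidean Fourier transform [Phi] of [f] in the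
    variables [(t, x)], taken at the frequency [(lambda, lambda (xi + eta) / 2)]
    and at [y = eta - xi]. The trace of [rho_lambda(p)^* \o fourier f lambda] is
    therefore the integral over [xi] of [K lambda f (xi - y) xi], times a phase;
    the substitution [zeta = lambda (xi - y / 2)] turns it into [|lambda|^-n]
    times the integral over [zeta] of
    [Phi f (lambda, zeta) y * e^(- i (lambda t + x . zeta))]. The Plancherel
    density cancels [|lambda|^-n], the integral over [lambda] completes [zeta] to a
    frequency of [R^(n+1)], and Euclidean Fourier inversion at [(t, x)] leaves
    [(2 pi)^(n+1) f(p)]. Integrating over [mu] gives the formula.

    The substance is that the trace exists and may be computed on the diagonal.
    Since [f] is a Schwartz function, its kernel factors as
    [K lambda f xi eta = int_s green (xi - s) * K lambda h s eta] with [h] again of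
    Schwartz type ([K_green]): the Green function of [prod_k (1 + d_k)] absorbs one
    derivative in each direction. Hence [fourier_measure mu lambda]^* composed with
    [fourier f lambda] is a superposition, over [(p, s)], of rank-one operators
    whose two factors are square integrable in all variables together. Such a
    superposition has the expected trace over every orthonormal basis
    ([has_trace_superposition]): Bessel's inequality dominates the diagonal,
    Parseval's identity sums it. As [trace] chooses a number among those which
    are the trace over all bases, a basis must also be constructed
    ([exists_orthonormal_basis]) before the value is known.

    Decay of kernels, their factorisation and Fourier inversion all come from one
    identity, [exp_resolvent], which recovers a bounded function [u] from
    [u - u'] by an exponential average. Integrals of complex functions are
    handled through domination: the products
    [cauchy_weight v = prod_i (1 + v_i^2)^-1] serve as the integrable majorants
    throughout. *)

Set Implicit Arguments.
Unset Strict Implicit.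
Unset Printing Implicit Defensive.

Import Order.TTheory GRing.Theory Num.Theory.
Import numFieldNormedType.Exports.

Local Open Scope classical_set_scope.
Local Open Scope ring_scope.

#[local] Arguments ComplexField.Normc.normc : simpl never.
#[local] Arguments cintegral : simpl never.
#[local] Arguments inner : simpl never.
#[local] Arguments expi : simpl never.

(** * Integration of complex-valued functions *)

Notation cRe := complex.Re.
Notation cIm := complex.Im.
Notation normc := ComplexField.Normc.normc.

Section complex_numbers.
Variable R : realType.
Implicit Types (z w : R[i]) (a : R).

Lemma cReD z w : cRe (z + w) = cRe z + cRe w. Proof. by case: z w => [? ?] []. Qed.
Lemma cImD z w : cIm (z + w) = cIm z + cIm w. Proof. by case: z w => [? ?] []. Qed.
Lemma cReN z : cRe (- z) = - cRe z. Proof. by case: z. Qed.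
Lemma cImN z : cIm (- z) = - cIm z. Proof. by case: z. Qed.
Lemma cReB z w : cRe (z - w) = cRe z - cRe w. Proof. by rewrite cReD cReN. Qed.
Lemma cImB z w : cIm (z - w) = cIm z - cIm w. Proof. by rewrite cImD cImN. Qed.
Lemma cReM z w : cRe (z * w) = cRe z * cRe w - cIm z * cIm w.
Proof. by case: z w => [? ?] []. Qed.
Lemma cImM z w : cIm (z * w) = cRe z * cIm w + cIm z * cRe w.
Proof. by case: z w => [? ?] []. Qed.
Lemma cRe_conj z : cRe (conjc z) = cRe z. Proof. by case: z. Qed.
Lemma cIm_conj z : cIm (conjc z) = - cIm z. Proof. by case: z. Qed.
Lemma cRe_real a : cRe (real_complex R a) = a. Proof. by []. Qed.
Lemma cIm_real a : cIm (real_complex R a) = 0. Proof. by []. Qed.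
Definition imag a : R[i] := Complex 0 a.
Lemma cRe_imag a : cRe (imag a) = 0. Proof. by []. Qed.
Lemma cIm_imag a : cIm (imag a) = a. Proof. by []. Qed.
Lemma cRe_expi a : cRe (expi a) = cos a. Proof. by []. Qed.
Lemma cIm_expi a : cIm (expi a) = sin a. Proof. by []. Qed.
Definition cE := (cReD, cImD, cReN, cImN, cReM, cImM, cRe_conj, cIm_conj,
  cRe_real, cIm_real, cRe_imag, cIm_imag, cRe_expi, cIm_expi).

Lemma complexP z w : cRe z = cRe w -> cIm z = cIm w -> z = w.
Proof. by case: z w => [a b] [c d] /= -> ->. Qed.

Lemma cRe_sum I (r : seq I) (P : pred I) (F : I -> R[i]) :
  cRe (\sum_(i <- r | P i) F i) = \sum_(i <- r | P i) cRe (F i).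
Proof. by apply: (big_morph _ cReD). Qed.
Lemma cIm_sum I (r : seq I) (P : pred I) (F : I -> R[i]) :
  cIm (\sum_(i <- r | P i) F i) = \sum_(i <- r | P i) cIm (F i).
Proof. by apply: (big_morph _ cImD). Qed.

Lemma normcE2 z : normc z = Num.sqrt (cRe z ^+ 2 + cIm z ^+ 2).
Proof. by case: z. Qed.
Lemma normc_ge0 z : 0 <= normc z. Proof. by rewrite normcE2 sqrtr_ge0. Qed.
Lemma normc_sqr z : normc z ^+ 2 = cRe z ^+ 2 + cIm z ^+ 2.
Proof. by rewrite normcE2 sqr_sqrtr// addr_ge0// sqr_ge0. Qed.
Lemma Re_le_normc z : `|cRe z| <= normc z.
Proof. by rewrite normcE2 -sqrtr_sqr ler_wsqrtr// lerDl sqr_ge0. Qed.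
Lemma Im_le_normc z : `|cIm z| <= normc z.
Proof. by rewrite normcE2 -sqrtr_sqr ler_wsqrtr// lerDr sqr_ge0. Qed.
Lemma normc_conj z : normc (conjc z) = normc z.
Proof. by rewrite !normcE2 cRe_conj cIm_conj sqrrN. Qed.
Lemma normc_real a : normc (real_complex R a) = `|a|.
Proof. by rewrite normcE2 /= expr0n addr0 sqrtr_sqr. Qed.
Lemma normcM' z w : normc (z * w) = normc z * normc w.
Proof. exact: ComplexField.Normc.normcM. Qed.
Lemma normcD_le z w : normc (z + w) <= normc z + normc w.
Proof. exact: le_normcD. Qed.
Lemma normc0' : normc (0 : R[i]) = 0. Proof. exact: ComplexField.Normc.normc0. Qed.
Lemma normc_le_ReIm z : normc z <= `|cRe z| + `|cIm z|.
Proof.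
rewrite normcE2 -(ger0_norm (addr_ge0 (normr_ge0 (cRe z)) (normr_ge0 (cIm z)))).
rewrite -sqrtr_sqr ler_wsqrtr// sqrrD !real_normK ?num_real//.
by rewrite lerD2r lerDl mulrn_wge0// mulr_ge0.
Qed.
Lemma normc_expi a : normc (expi a) = 1.
Proof. by rewrite normcE2 /= cos2Dsin2 sqrtr1. Qed.
Lemma normc_imag a : normc (imag a) = `|a|.
Proof. by rewrite normcE2 !cE expr0n add0r sqrtr_sqr. Qed.
Lemma conj_expi a : conjc (expi a) = expi (- a).
Proof. by rewrite /expi cosN sinN. Qed.
Lemma expi0 : expi 0 = 1 :> R[i].
Proof. by rewrite /expi cos0 sin0. Qed.
Lemma real_complexM a b : real_complex R (a * b) = real_complex R a * real_complex R b.
Proof. by rewrite rmorphM. Qed.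
Lemma conjcM z w : conjc (z * w) = conjc z * conjc w. Proof. exact: rmorphM. Qed.
Lemma mulc_conj z : z * conjc z = real_complex R (normc z ^+ 2).
Proof. by apply: complexP; rewrite !cE ?normc_sqr; ring. Qed.
Lemma normc_prod I (r : seq I) (P : pred I) (F : I -> R[i]) :
  normc (\prod_(i <- r | P i) F i) = \prod_(i <- r | P i) normc (F i).
Proof.
by apply: (big_morph _ normcM'); exact: ComplexField.Normc.normc1.
Qed.
End complex_numbers.

Section complex_measurability.
Context d (T : measurableType d) (R : realType).
Implicit Types (g h : T -> R[i]).

Lemma cmeasurable_cst z : cmeasurable (fun _ : T => z : R[i]).
Proof. by split; exact: measurable_cst. Qed.

Lemma cmeasurableD g h : cmeasurable g -> cmeasurable h ->
  cmeasurable (fun x => g x + h x).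
Proof.
move=> [g1 g2] [h1 h2]; split; under eq_fun do rewrite cE.
  exact: measurable_funD.
exact: measurable_funD.
Qed.

Lemma cmeasurableM g h : cmeasurable g -> cmeasurable h ->
  cmeasurable (fun x => g x * h x).
Proof.
move=> [g1 g2] [h1 h2]; split; under eq_fun do rewrite cE.
  by apply: measurable_funB; exact: measurable_funM.
by apply: measurable_funD; exact: measurable_funM.
Qed.

Lemma cmeasurableN g : cmeasurable g -> cmeasurable (fun x => - g x).
Proof.
by move=> [g1 g2]; split; under eq_fun do rewrite cE;
  apply: measurableT_comp.
Qed.

Lemma cmeasurableB g h : cmeasurable g -> cmeasurable h ->
  cmeasurable (fun x => g x - h x).
Proof. by move=> mg mh; apply: cmeasurableD => //; exact: cmeasurableN. Qed.

Lemma cmeasurable_conj g : cmeasurable g -> cmeasurable (fun x => conjc (g x)).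
Proof.
move=> [g1 g2]; split; first by under eq_fun do rewrite cE.
by under eq_fun do rewrite cE; exact: measurableT_comp.
Qed.

Lemma cmeasurable_real (u : T -> R) : measurable_fun setT u ->
  cmeasurable (fun x => real_complex R (u x)).
Proof. by move=> mu; split => //=; exact: measurable_cst. Qed.

Lemma cmeasurable_expi (u : T -> R) : measurable_fun setT u ->
  cmeasurable (fun x => expi (u x)).
Proof.
move=> mu; split => /=; apply: measurableT_comp => //;
  apply: continuous_measurable_fun; [exact: continuous_cos|exact: continuous_sin].
Qed.

Lemma cmeasurable_sum I (r : seq I) (F : I -> T -> R[i]) :
  (forall i, cmeasurable (F i)) -> cmeasurable (fun x => \sum_(i <- r) F i x).
Proof.
move=> mF; elim: r => [|i r ih].
  by under eq_fun do rewrite big_nil; exact: cmeasurable_cst.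
by under eq_fun do rewrite big_cons; exact: cmeasurableD.
Qed.

Lemma cmeasurable_prod I (r : seq I) (F : I -> T -> R[i]) :
  (forall i, cmeasurable (F i)) -> cmeasurable (fun x => \prod_(i <- r) F i x).
Proof.
move=> mF; elim: r => [|i r ih].
  by under eq_fun do rewrite big_nil; exact: cmeasurable_cst.
by under eq_fun do rewrite big_cons; exact: cmeasurableM.
Qed.

Lemma measurable_normc g : cmeasurable g -> measurable_fun setT (fun x => normc (g x)).
Proof.
move=> [g1 g2]; under eq_fun do rewrite normcE2.
apply: measurableT_comp; last by apply: measurable_funD; exact: measurable_funX.
by apply: continuous_measurable_fun; exact: sqrt_continuous.
Qed.

End complex_measurability.

Lemma cmeasurable_comp d d' (T : measurableType d) (T' : measurableType d')
    (R : realType) (g : T' -> R[i]) (k : T -> T') :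
  cmeasurable g -> measurable_fun setT k -> cmeasurable (fun x => g (k x)).
Proof. by move=> [g1 g2] mk; split; [exact: measurableT_comp g1 mk|exact: measurableT_comp g2 mk]. Qed.

Section complex_integral.
Context d (T : measurableType d) (R : realType) (mu : {measure set T -> \bar R}).
Implicit Types (g h : T -> R[i]) (u : T -> R).

(** A nonnegative real function dominates exactly when its integral is finite;
    all integrability statements below are reduced to this form. *)
Lemma integrable_ge0 u : measurable_fun setT u -> (forall x, 0 <= u x) ->
  (\int[mu]_x (u x)%:E < +oo)%E -> mu.-integrable setT (EFin \o u).
Proof.
move=> mu' u0 ul; apply/integrableP; split; first exact/measurable_EFinP.
by under eq_integral => x _ do rewrite /= ger0_norm//.
Qed.

Lemma ge0_integral_scale_lty (C : R) u : measurable_fun setT u -> (forall x, 0 <= u x) ->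
  0 <= C -> (\int[mu]_x (u x)%:E < +oo)%E -> (\int[mu]_x (C * u x)%:E < +oo)%E.
Proof.
move=> mu' u0 C0 ul; under eq_integral do rewrite EFinM.
rewrite ge0_integralZl ?lee_fin//.
- by apply: lte_mul_pinfty.
- by apply/measurable_EFinP.
- by move=> x _; rewrite lee_fin.
Qed.

Lemma cintegrable_le g u : cmeasurable g -> measurable_fun setT u ->
  (forall x, normc (g x) <= u x) -> (\int[mu]_x (u x)%:E < +oo)%E ->
  cintegrable mu setT g.
Proof.
move=> [g1 g2] mu' gu ul.
have u0 x : 0 <= u x by rewrite (le_trans _ (gu x))// normc_ge0.
have iu := integrable_ge0 mu' u0 ul.
split; apply: (le_integrable measurableT _ _ iu).
- exact/measurable_EFinP.
- by move=> x _ /=; rewrite lee_fin (le_trans (Re_le_normc _))// (le_trans (gu x))// ler_norm.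
- exact/measurable_EFinP.
- by move=> x _ /=; rewrite lee_fin (le_trans (Im_le_normc _))// (le_trans (gu x))// ler_norm.
Qed.

Lemma cintegrable_lty g : cmeasurable g ->
  (\int[mu]_x (normc (g x))%:E < +oo)%E -> cintegrable mu setT g.
Proof.
by move=> mg; apply: cintegrable_le => //; exact: measurable_normc.
Qed.

Lemma cintegrable_measurable g : cintegrable mu setT g -> cmeasurable g.
Proof.
by move=> [/integrableP[/measurable_EFinP ? _] /integrableP[/measurable_EFinP ? _]].
Qed.

Lemma cintegrable_normc g : cintegrable mu setT g ->
  mu.-integrable setT (fun x => (normc (g x))%:E).
Proof.
move=> ig; have mg := cintegrable_measurable ig; case: ig => i1 i2.
have /integrableP[_ i12] := integrableD measurableT (integrable_abse i1) (integrable_abse i2).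
apply/integrableP; split; first exact/measurable_EFinP/measurable_normc.
apply: le_lt_trans i12; apply: ge0_le_integral => //.
- by apply/measurable_EFinP/measurableT_comp => //; exact: measurable_normc.
- by apply: measurableT_comp => //; apply: emeasurable_funD;
    apply: measurableT_comp => //; apply/measurable_EFinP; case: mg.
- by move=> x _ /=; rewrite ger0_norm ?normc_ge0// lee_fin ger0_norm ?addr_ge0// normc_le_ReIm.
Qed.


Lemma cintegrable_normc_lty g : cintegrable mu setT g ->
  (\int[mu]_x (normc (g x))%:E < +oo)%E.
Proof.
move=> /cintegrable_normc/integrableP[_].
by under eq_integral => x _ do rewrite /= ger0_norm ?normc_ge0//.
Qed.

Lemma cRe_int D g : cRe (cintegral mu D g) = \int[mu]_(x in D) cRe (g x).
Proof. by []. Qed.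
Lemma cIm_int D g : cIm (cintegral mu D g) = \int[mu]_(x in D) cIm (g x).
Proof. by []. Qed.

Lemma eq_cintegral D g h : {in D, g =1 h} -> cintegral mu D g = cintegral mu D h.
Proof.
by move=> gh; congr Complex; apply: eq_Rintegral => x xD; rewrite gh.
Qed.

Lemma cintegrableD g h : cintegrable mu setT g -> cintegrable mu setT h ->
  cintegrable mu setT (fun x => g x + h x).
Proof.
move=> [g1 g2] [h1 h2]; split.
  by apply: eq_integrable (integrableD measurableT g1 h1) => // x _; rewrite cE.
by apply: eq_integrable (integrableD measurableT g2 h2) => // x _; rewrite cE.
Qed.

Lemma cintegralD g h : cintegrable mu setT g -> cintegrable mu setT h ->
  cintegral mu setT (fun x => g x + h x) = cintegral mu setT g + cintegral mu setT h.
Proof.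
move=> [g1 g2] [h1 h2]; apply: complexP; rewrite cE /= -RintegralD//;
  by apply: eq_Rintegral => x _; rewrite cE.
Qed.

Lemma cintegral_conj g : cintegrable mu setT g ->
  cintegral mu setT (fun x => conjc (g x)) = conjc (cintegral mu setT g).
Proof.
move=> [g1 g2]; apply: complexP; rewrite cE /=.
  by apply: eq_Rintegral => x _; rewrite cE.
rewrite -mulN1r -RintegralZl//.
by apply: eq_Rintegral => x _; rewrite cE mulN1r.
Qed.

Lemma cintegrableZ z g : cintegrable mu setT g ->
  cintegrable mu setT (fun x => z * g x).
Proof.
move=> [g1 g2]; split.
  apply: eq_integrable (integrableB measurableT (integrableZl measurableT (cRe z) g1)
    (integrableZl measurableT (cIm z) g2)) => // x _.
  by rewrite cE EFinB !EFinM.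
apply: eq_integrable (integrableD measurableT (integrableZl measurableT (cRe z) g2)
    (integrableZl measurableT (cIm z) g1)) => // x _.
by rewrite cE EFinD !EFinM.
Qed.

Lemma cintegralZ z g : cintegrable mu setT g ->
  cintegral mu setT (fun x => z * g x) = z * cintegral mu setT g.
Proof.
move=> [g1 g2]; have iZ (c : R) u : mu.-integrable setT (EFin \o u) ->
    mu.-integrable setT (EFin \o (fun x => c * u x)).
  by move=> iu; apply: eq_integrable (integrableZl measurableT c iu).
apply: complexP; rewrite ?cReM ?cImM !cRe_int !cIm_int -!RintegralZl//.
  rewrite -RintegralB//; [|exact: iZ|exact: iZ].
  by apply: eq_Rintegral => x _; rewrite cE.
rewrite -RintegralD//; [|exact: iZ|exact: iZ].
by apply: eq_Rintegral => x _; rewrite cE.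
Qed.

Lemma cintegrable0 : cintegrable mu setT (fun _ => 0).
Proof.
by split; apply: eq_integrable (integrable0 mu setT) => // x _.
Qed.

Lemma cintegral0 : cintegral mu setT (fun _ => 0) = 0.
Proof. by rewrite /cintegral /= !Rintegral_cst// !mul0r. Qed.

Lemma cintegrable_sum I (r : seq I) (F : I -> T -> R[i]) :
  (forall i, cintegrable mu setT (F i)) ->
  cintegrable mu setT (fun x => \sum_(i <- r) F i x).
Proof.
move=> iF; elim: r => [|i r ih].
  by under eq_fun do rewrite big_nil; exact: cintegrable0.
by under eq_fun do rewrite big_cons; exact: cintegrableD.
Qed.

Lemma cintegral_sum I (r : seq I) (F : I -> T -> R[i]) :
  (forall i, cintegrable mu setT (F i)) ->
  cintegral mu setT (fun x => \sum_(i <- r) F i x) =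
  \sum_(i <- r) cintegral mu setT (F i).
Proof.
move=> iF; elim: r => [|i r ih].
  by under eq_fun do rewrite big_nil; rewrite big_nil cintegral0.
under eq_fun do rewrite big_cons.
by rewrite cintegralD// ?ih ?big_cons//; exact: cintegrable_sum.
Qed.

(** The factor 2 comes from estimating the real and imaginary parts separately;
    constants are irrelevant to all later uses. *)
Lemma normc_cintegral_le g u : cmeasurable g -> measurable_fun setT u ->
  (forall x, normc (g x) <= u x) -> (\int[mu]_x (u x)%:E < +oo)%E ->
  normc (cintegral mu setT g) <= 2 * fine (\int[mu]_x (u x)%:E).
Proof.
move=> mg mu' gu ul; have [g1 g2] := cintegrable_le mg mu' gu ul.
have u0 x : 0 <= u x by rewrite (le_trans _ (gu x))// normc_ge0.
have iu := integrable_ge0 mu' u0 ul.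
apply: le_trans (normc_le_ReIm _) _; rewrite mulr_natl mulr2n.
by apply: lerD; apply: (le_trans (le_normr_Rintegral _ _)) => //;
  apply: le_Rintegral => //; try (by apply: integrable_norm); move=> x _;
  [rewrite (le_trans (Re_le_normc _))|rewrite (le_trans (Im_le_normc _))].
Qed.

Lemma Rdominated_convergence (v_ : nat -> T -> R) (v u : T -> R) :
  (forall k, measurable_fun setT (v_ k)) -> measurable_fun setT v ->
  (forall x, v_ ^~ x @ \oo --> v x) ->
  measurable_fun setT u -> (forall k x, `|v_ k x| <= u x) ->
  (\int[mu]_x (u x)%:E < +oo)%E ->
  (fun k => \int[mu]_x v_ k x) @ \oo --> \int[mu]_x v x.
Proof.
move=> mv_ mv cv mu' vu ul.
have u0 x : 0 <= u x by rewrite (le_trans _ (vu 0 x)).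
have iu := integrable_ge0 mu' u0 ul.
have [||||iv _] := @dominated_convergence _ _ _ mu setT measurableT
   (fun k x => (v_ k x)%:E) (EFin \o v) (EFin \o u) _ _ _ iu.
- by move=> k; exact/measurable_EFinP.
- exact/measurable_EFinP.
- by apply/aeW => x _; apply: cvg_EFin; [exact: nearW|exact: cv].
- by apply/aeW => x k _; rewrite /= lee_fin.
move=> h; apply/fine_cvg; apply: cvg_trans h _.
rewrite fineK //; exact: integrable_fin_num.
Qed.

(** Sequences of complex numbers are compared componentwise, as in
    [abs_summable_to]. *)
Definition ccvg (a : nat -> R[i]) (c : R[i]) :=
  (fun k => cRe (a k)) @ \oo --> cRe c /\ (fun k => cIm (a k)) @ \oo --> cIm c.

Lemma cdominated_convergence (g_ : nat -> T -> R[i]) g u :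
  (forall k, cmeasurable (g_ k)) -> cmeasurable g ->
  (forall x, ccvg (g_ ^~ x) (g x)) ->
  measurable_fun setT u -> (forall k x, normc (g_ k x) <= u x) ->
  (\int[mu]_x (u x)%:E < +oo)%E ->
  ccvg (fun k => cintegral mu setT (g_ k)) (cintegral mu setT g).
Proof.
move=> mg_ [g1 g2] cg mu' gu ul; split.
  apply: (Rdominated_convergence _ g1 _ mu' _ ul) => [k|x|k x].
  - by case: (mg_ k).
  - by case: (cg x).
  - exact: le_trans (Re_le_normc _) (gu k x).
apply: (Rdominated_convergence _ g2 _ mu' _ ul) => [k|x|k x].
- by case: (mg_ k).
- by case: (cg x).
- exact: le_trans (Im_le_normc _) (gu k x).
Qed.

End complex_integral.

Section weighted_image_measure.
Context d d' (T : measurableType d) (T' : measurableType d') (R : realType).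
Variables (mu : {measure set T -> \bar R}) (nu : {measure set T' -> \bar R}).
Variables (k : T -> T') (w : T -> R).
Hypothesis mk : measurable_fun setT k.
Hypotheses (mw : measurable_fun setT w) (w0 : forall x, 0 <= w x).
Hypothesis nuE : forall A, measurable A ->
  nu A = (\int[mu]_(x in k @^-1` A) (w x)%:E)%E.

Import HBNNSimple.

(** The measure [nu] is the image under [k] of the measure of density [w];
    the case [w = 1] covers pushforwards, the case [k = id] densities. *)
Lemma ge0_integral_weighted_image (u : T' -> \bar R) : measurable_fun setT u ->
  (forall y, 0 <= u y)%E -> (\int[nu]_y u y = \int[mu]_x (u (k x) * (w x)%:E))%E.
Proof.
move=> mu' u0; pose f_ := nnsfun_approx measurableT mu'.
have mf_ n : measurable_fun setT (fun x => (f_ n (k x))%:E).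
  apply/measurable_EFinP; exact: measurableT_comp mk.
have mwE : measurable_fun setT (EFin \o w) by exact/measurable_EFinP.
transitivity (limn (fun n => \int[nu]_x (f_ n x)%:E)%E).
  rewrite -monotone_convergence//.
  - apply: eq_integral => y _; apply/esym/cvg_lim => //.
    exact: cvg_nnsfun_approx.
  - by move=> n; exact/measurable_EFinP.
  - by move=> n x _; rewrite lee_fin.
  - by move=> x _ m n mn; rewrite lee_fin; exact/lefP/nd_nnsfun_approx.
transitivity (limn (fun n => \int[mu]_x ((f_ n (k x))%:E * (w x)%:E))%E); last first.
  rewrite -monotone_convergence//.
  - apply: eq_integral => x _; apply/cvg_lim => //.
    by apply: cvgeZr => //; exact: cvg_nnsfun_approx.
  - by move=> n; exact: emeasurable_funM.
  - by move=> n x _; rewrite mule_ge0// lee_fin.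
  - move=> x _ m n mn; rewrite lee_wpmul2r ?lee_fin//.
    by exact/lefP/nd_nnsfun_approx.
congr (limn _); apply/funext => n.
under eq_integral do rewrite fimfunE -fsumEFin//.
under [in RHS]eq_integral.
  move=> x _; rewrite fimfunE -fsumEFin// ge0_mule_fsuml; last first.
    by move=> r; exact: nnfun_muleindic_ge0.
  over.
rewrite ge0_integral_fsum//; last 2 first.
- by move=> r; apply/measurable_EFinP/measurable_funM.
- by move=> r y _; exact: nnfun_muleindic_ge0.
rewrite ge0_integral_fsum//; last 2 first.
- move=> r; apply: emeasurable_funM => //; apply/measurable_EFinP/measurable_funM => //.
  by apply: (measurableT_comp _ mk).
- by move=> r x _; rewrite mule_ge0 ?lee_fin//; exact: nnfun_muleindic_ge0.
apply: eq_fsbigr => r; rewrite inE => -[y _ ryE].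
have r0 : 0 <= r by rewrite -ryE.
have mr : measurable (f_ n @^-1` [set r]) by [].
under eq_integral do rewrite EFinM.
rewrite ge0_integralZl//; last exact/measurable_EFinP.
under [in RHS]eq_integral do rewrite EFinM -muleA.
rewrite ge0_integralZl//; last 2 first.
- apply: emeasurable_funM => //; apply/measurable_EFinP.
  by apply: (measurableT_comp _ mk).
- by move=> x _; rewrite mule_ge0 ?lee_fin.
congr (_ * _)%E; rewrite integral_indic// setIT nuE// [LHS]integral_mkcond.
apply: eq_integral => x _; rewrite patchE indicE.
rewrite (_ : (x \in _) = (k x \in f_ n @^-1` [set r])).
  by case: ifPn => _; rewrite ?mul1e ?mul0e.
by apply/idP/idP; rewrite !inE.
Qed.

Lemma cintegral_weighted_image (g : T' -> R[i]) : cmeasurable g ->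
  cintegral nu setT g = cintegral mu setT (fun x => g (k x) * real_complex R (w x)).
Proof.
have h (u : T' -> R) : measurable_fun setT u ->
    \int[nu]_y u y = \int[mu]_x (u (k x) * w x).
  move=> mu'; have mu1 : measurable_fun setT (EFin \o u) by exact/measurable_EFinP.
  rewrite /Rintegral integralE [in RHS]integralE.
  rewrite (ge0_integral_weighted_image (measurable_funepos mu1)); last first.
    by move=> y; exact: funepos_ge0.
  rewrite (ge0_integral_weighted_image (measurable_funeneg mu1)); last first.
    by move=> y; exact: funeneg_ge0.
  congr (fine (_ - _))%E; apply: eq_integral => x _; rewrite ?funeposE ?funenegE /=.
    by rewrite maxe_pMl ?lee_fin// mul0e.
  by rewrite maxe_pMl ?lee_fin// mul0e -mulNr.
move=> [g1 g2]; apply: complexP; rewrite ?cRe_int ?cIm_int h//;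
  by apply: eq_Rintegral => x _; rewrite !cE; ring.
Qed.

Lemma cintegrable_weighted_image (g : T' -> R[i]) : cmeasurable g ->
  cintegrable mu setT (fun x => g (k x) * real_complex R (w x)) ->
  cintegrable nu setT g.
Proof.
move=> mg ig; apply: cintegrable_lty => //.
rewrite ge0_integral_weighted_image.
- move/cintegrable_normc_lty : ig; congr (_ < _)%E; apply: eq_integral => x _.
  by rewrite normcM' normc_real ger0_norm.
- exact/measurable_EFinP/measurable_normc.
- by move=> x; rewrite lee_fin normc_ge0.
Qed.

End weighted_image_measure.

Section image_measure.
Context d d' (T : measurableType d) (T' : measurableType d') (R : realType).
Variables (mu : {measure set T -> \bar R}) (nu : {measure set T' -> \bar R}).
Variable k : T -> T'.
Hypothesis mk : measurable_fun setT k.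
Hypothesis nuE : forall A, measurable A -> nu A = mu (k @^-1` A).

Let nuE1 A : measurable A -> nu A = (\int[mu]_(x in k @^-1` A) (1:R)%:E)%E.
Proof.
move=> mA; rewrite integral_cst ?mul1e ?nuE//.
by rewrite -[X in measurable X]setTI; exact: mk.
Qed.

Lemma ge0_integral_image (u : T' -> \bar R) : measurable_fun setT u ->
  (forall y, 0 <= u y)%E -> (\int[nu]_y u y = \int[mu]_x u (k x))%E.
Proof.
move=> mu' u0; rewrite (ge0_integral_weighted_image mk _ _ nuE1)//.
  by under eq_integral do rewrite mule1.
Qed.

Lemma cintegral_image (g : T' -> R[i]) : cmeasurable g ->
  cintegral nu setT g = cintegral mu setT (fun x => g (k x)).
Proof.
move=> mg; rewrite (cintegral_weighted_image mk _ _ nuE1)//.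
by apply: eq_cintegral => x _; rewrite mulr1.
Qed.

Lemma cintegrable_image (g : T' -> R[i]) : cmeasurable g ->
  cintegrable mu setT (fun x => g (k x)) -> cintegrable nu setT g.
Proof.
move=> mg ig; apply: (cintegrable_weighted_image mk _ _ nuE1) => //.
by under eq_fun do rewrite mulr1.
Qed.

End image_measure.

Section complex_fubini.
Context d1 d2 (T1 : measurableType d1) (T2 : measurableType d2) (R : realType).
Variables (m1 : {sigma_finite_measure set T1 -> \bar R})
          (m2 : {sigma_finite_measure set T2 -> \bar R}).
Implicit Types g : T1 * T2 -> R[i].

Lemma cmeasurable_cintegral g : cmeasurable g ->
  cmeasurable (fun x => cintegral m2 setT (fun y => g (x, y))).
Proof.
have h (u : T1 * T2 -> R) : measurable_fun setT u ->
    measurable_fun setT (fun x => \int[m2]_y u (x, y)).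
  move=> mu; have mu' : measurable_fun setT (EFin \o u) by exact/measurable_EFinP.
  apply: measurableT_comp; first exact: fine_measurable.
  under eq_fun do rewrite integralE.
  apply: emeasurable_funB.
    rewrite (_ : (fun x => _) = fubini_F m2 ((EFin \o u)^\+)%E).
      by apply: measurable_fun_fubini_tonelli_F;
        [exact: measurable_funepos|exact: funepos_ge0].
    by apply/funext => x; apply: eq_integral => y _; rewrite !funeposE.
  rewrite (_ : (fun x => _) = fubini_F m2 ((EFin \o u)^\-)%E).
    by apply: measurable_fun_fubini_tonelli_F;
      [exact: measurable_funeneg|exact: funeneg_ge0].
  by apply/funext => x; apply: eq_integral => y _; rewrite !funenegE.
move=> [g1 g2].
by split; [exact: (h (fun z => cRe (g z)))|exact: (h (fun z => cIm (g z)))].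
Qed.

Let fubini_real (u : T1 * T2 -> R) : (m1 \x m2)%E.-integrable setT (EFin \o u) ->
  m1.-integrable setT (EFin \o (fun x => \int[m2]_y u (x, y))) /\
  \int[m1]_x \int[m2]_y u (x, y) = \int[(m1 \x m2)%E]_z u z.
Proof.
move=> iu.
have iF := integrable_fubini_F iu.
have ae1 := ae_integrable1 iu.
have mu' : measurable_fun setT u.
  by apply/measurable_EFinP; exact: measurable_int iu.
have mF : measurable_fun setT (fun x => \int[m2]_y u (x, y)).
  by apply: measurableT_comp; [exact: fine_measurable|exact: measurable_int iF].
have aeE : ae_eq m1 setT (fubini_F m2 (EFin \o u))
     (EFin \o (fun x => \int[m2]_y u (x, y))).
  apply: filterS ae1 => x ix _ /=; rewrite /Rintegral fineK//.
  exact: integrable_fin_num.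
split.
  apply/integrableP; split; first exact/measurable_EFinP.
  have /integrableP[_] := iF; congr (_ < _)%E; apply: ae_eq_integral => //.
  - by apply: measurableT_comp => //; exact: measurable_int iF.
  - by apply: measurableT_comp => //; exact/measurable_EFinP.
  - by apply: filterS aeE => x /[apply] /= ->.
rewrite /Rintegral -(integral12_prod_meas1 iu); congr fine.
apply: ae_eq_integral => //; first exact/measurable_EFinP.
  exact: measurable_int iF.
exact: ae_eq_sym.
Qed.

(** The inner integral may diverge on a null set of [x], where it takes a default
    value. *)
Lemma cfubini g : cintegrable (m1 \x m2)%E setT g ->
  cintegrable m1 setT (fun x => cintegral m2 setT (fun y => g (x, y))) /\
  cintegral m1 setT (fun x => cintegral m2 setT (fun y => g (x, y))) =
  cintegral (m1 \x m2)%E setT g.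
Proof.
move=> [/fubini_real[g1 e1] /fubini_real[g2 e2]].
by split; [split|apply: complexP].
Qed.

End complex_fubini.

Section complex_fubini_swap.
Context d1 d2 (T1 : measurableType d1) (T2 : measurableType d2) (R : realType).
Variables (m1 : {sigma_finite_measure set T1 -> \bar R})
          (m2 : {sigma_finite_measure set T2 -> \bar R}).
Implicit Types g : T1 * T2 -> R[i].

Let swap_measure (u : T1 * T2 -> \bar R) : measurable_fun setT u ->
  (forall z, 0 <= u z)%E ->
  (\int[(m2 \x m1)%E]_z u (z.2, z.1) = \int[(m1 \x m2)%E]_z u z)%E.
Proof.
move=> mu u0; have mu' : measurable_fun setT (fun z : T2 * T1 => u (z.2, z.1)).
  by apply: (measurableT_comp mu); exact: measurable_fun_pair.
by rewrite fubini_tonelli1// fubini_tonelli2.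
Qed.

Lemma cintegrable_swap g : cintegrable (m1 \x m2)%E setT g ->
  cintegrable (m2 \x m1)%E setT (fun z => g (z.2, z.1)).
Proof.
move=> ig; have mg := cintegrable_measurable ig.
apply: cintegrable_lty.
  by apply: (cmeasurable_comp mg); exact: measurable_fun_pair.
rewrite (swap_measure (u := fun z => (normc (g z))%:E)).
- exact: cintegrable_normc_lty.
- exact/measurable_EFinP/measurable_normc.
- by move=> z; rewrite lee_fin normc_ge0.
Qed.

Lemma cfubini_swap g : cintegrable (m1 \x m2)%E setT g ->
  cintegral m1 setT (fun x => cintegral m2 setT (fun y => g (x, y))) =
  cintegral m2 setT (fun y => cintegral m1 setT (fun x => g (x, y))).
Proof.
have h (u : T1 * T2 -> R) : (m1 \x m2)%E.-integrable setT (EFin \o u) ->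
    \int[(m2 \x m1)%E]_z u (z.2, z.1) = \int[(m1 \x m2)%E]_z u z.
  move=> iu; rewrite /Rintegral integralE [in RHS]integralE; congr fine.
  have mu : measurable_fun setT (EFin \o u) by exact: measurable_int iu.
  rewrite -(swap_measure (measurable_funepos mu)); last exact: funepos_ge0.
  rewrite -(swap_measure (measurable_funeneg mu)); last exact: funeneg_ge0.
  by congr (_ - _)%E; apply: eq_integral => z _; rewrite ?funeposE ?funenegE.
move=> ig; have ig' := cintegrable_swap ig.
rewrite (cfubini ig).2 (cfubini ig').2; case: ig => i1 i2.
by apply: complexP; rewrite ?cRe_int ?cIm_int;
  [exact: (esym (h (fun z => cRe (g z)) i1))|exact: (esym (h (fun z => cIm (g z)) i2))].
Qed.

End complex_fubini_swap.

Section fibered_integrability.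
Context d1 d2 (T1 : measurableType d1) (T2 : measurableType d2) (R : realType).
Variables (m1 : {sigma_finite_measure set T1 -> \bar R})
          (m2 : {sigma_finite_measure set T2 -> \bar R}).

(** Tonelli with a majorant whose integrals over the fibres are bounded
    uniformly. *)
Lemma cintegrable_fibered (g : T1 * T2 -> R[i]) (a : T1 -> R) (u : T1 * T2 -> R) (C : R) :
  cmeasurable g -> measurable_fun setT a -> measurable_fun setT u ->
  (forall x, 0 <= a x) -> (forall z, 0 <= u z) ->
  (forall x y, normc (g (x, y)) <= a x * u (x, y)) ->
  (forall x, (\int[m2]_y (u (x, y))%:E <= C%:E)%E) ->
  (\int[m1]_x (a x)%:E < +oo)%E ->
  cintegrable (m1 \x m2)%E setT g.
Proof.
move=> mg ma mu a0 u0 gu uC al.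
have mau : measurable_fun setT (fun z : T1 * T2 => a z.1 * u z).
  by apply: measurable_funM => //; exact: measurableT_comp ma _.
apply: (@cintegrable_le _ _ R (m1 \x m2)%E g (fun z => a z.1 * u z) mg mau).
  by move=> [x y]; exact: gu.
have mE : measurable_fun setT (fun z : T1 * T2 => (a z.1 * u z)%:E) by exact/measurable_EFinP.
have au0 z : (0 <= (a z.1 * u z)%:E)%E by rewrite lee_fin mulr_ge0.
rewrite fubini_tonelli1//.
apply: (@le_lt_trans _ _ (\int[m1]_x ((a x)%:E * `|C|%:E))%E).
  apply: ge0_le_integral => //.
  - by move=> x _; apply: integral_ge0 => y _.
  - exact: (measurable_fun_fubini_tonelli_F (m2 := m2) (fun z => (a z.1 * u z)%:E)).
  - by apply: emeasurable_funM => //; exact/measurable_EFinP.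
  - move=> x _; rewrite /fubini_F /=; under eq_integral do rewrite EFinM.
    rewrite ge0_integralZl ?lee_fin//; last 2 first.
    + by apply/measurable_EFinP; exact: (measurableT_comp mu (pair1_measurable x)).
    + by move=> y _; rewrite lee_fin.
    by rewrite lee_wpmul2l ?lee_fin// (le_trans (uC x))// lee_fin ler_norm.
have aI0 : (0 <= \int[m1]_x (a x)%:E)%E by apply: integral_ge0 => x _; rewrite lee_fin.
rewrite ge0_integralZr ?lee_fin//.
- by rewrite lte_mul_pinfty ?ge0_fin_numE ?ltry.
- exact/measurable_EFinP.
- by move=> x _; rewrite lee_fin.
Qed.

End fibered_integrability.

(** * Lebesgue measure on row vectors *)

Section rV_coordinates.
Variables (R : realType) (n : nat).

Lemma rV_cons0 (p : R * 'rV[R]_n) : rV_cons p 0 ord0 = p.1.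
Proof.
have := @row_mxEl R 1 1 n (const_mx p.1) p.2 0 0; rewrite [RHS]mxE => <-.
by congr (row_mx _ _ _ _); exact/val_inj.
Qed.

Lemma rV_consS (p : R * 'rV[R]_n) j : rV_cons p 0 (lift ord0 j) = p.2 0 j.
Proof.
rewrite -[RHS](@row_mxEr R 1 1 n (const_mx p.1)).
by congr (row_mx _ _ _ _); exact/val_inj.
Qed.

Definition rV_head (v : 'rV[R]_n.+1) : R := v 0 ord0.
Definition rV_tail (v : 'rV[R]_n.+1) : 'rV[R]_n := \row_j v 0 (lift ord0 j).

Lemma rV_eqP m (u v : 'rV[R]_m) : (forall j, u 0 j = v 0 j) -> u = v.
Proof. by move=> h; apply/rowP. Qed.

Lemma rV_head_cons p : rV_head (rV_cons p) = p.1. Proof. exact: rV_cons0. Qed.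
Lemma rV_tail_cons p : rV_tail (rV_cons p) = p.2.
Proof. by apply: rV_eqP => j; rewrite mxE rV_consS. Qed.

Lemma rV_affine_cons (a : 'rV[R]_n.+1) (c : R) p :
  a + c *: rV_cons p = rV_cons (rV_head a + c * p.1, rV_tail a + c *: p.2).
Proof.
apply: rV_eqP => j; case: (unliftP ord0 j) => [i|] ->.
  by rewrite rV_consS /= 2!mxE rV_consS 2![in RHS]mxE [in RHS]mxE.
by rewrite rV_cons0 /= 2!mxE rV_cons0.
Qed.

End rV_coordinates.

Section rV_measurability.
Context d (T : measurableType d) (R : realType).

Lemma measurable_fun_coord n (f : T -> 'rV[R]_n) i : measurable_fun setT f ->
  measurable_fun setT (fun x => f x 0 i).
Proof. by move=> mf; apply: (measurableT_comp (coord_rV_measurable i)). Qed.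

Lemma measurable_fun_rVD n (f g : T -> 'rV[R]_n) : measurable_fun setT f ->
  measurable_fun setT g -> measurable_fun setT (fun x => f x + g x).
Proof.
move=> mf mg; apply: measurable_fun_rV => i; under eq_fun do rewrite mxE.
by apply: measurable_funD; exact: measurable_fun_coord.
Qed.

Lemma measurable_fun_rVZ n (c : T -> R) (f : T -> 'rV[R]_n) :
  measurable_fun setT c -> measurable_fun setT f ->
  measurable_fun setT (fun x => c x *: f x).
Proof.
move=> mc mf; apply: measurable_fun_rV => i; under eq_fun do rewrite mxE.
by apply: measurable_funM => //; exact: measurable_fun_coord.
Qed.

Lemma measurable_fun_rVN n (f : T -> 'rV[R]_n) :
  measurable_fun setT f -> measurable_fun setT (fun x => - f x).
Proof.
move=> mf; under eq_fun do rewrite -scaleN1r.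
by apply: measurable_fun_rVZ => //; exact: measurable_cst.
Qed.

Lemma measurable_fun_rVB n (f g : T -> 'rV[R]_n) : measurable_fun setT f ->
  measurable_fun setT g -> measurable_fun setT (fun x => f x - g x).
Proof.
by move=> mf mg; apply: measurable_fun_rVD => //; exact: measurable_fun_rVN.
Qed.

Lemma measurable_fun_rV_cons n (t : T -> R) (f : T -> 'rV[R]_n) :
  measurable_fun setT t -> measurable_fun setT f ->
  measurable_fun setT (fun x => rV_cons (t x, f x)).
Proof.
move=> mt mf; apply: (measurableT_comp (@rV_cons_measurable R n)).
exact: measurable_fun_pair.
Qed.

Lemma measurable_fun_rV_tail n (f : T -> 'rV[R]_n.+1) :
  measurable_fun setT f -> measurable_fun setT (fun x => rV_tail (f x)).
Proof.
move=> mf; apply: measurable_fun_rV => i; under eq_fun do rewrite mxE.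
exact: measurable_fun_coord.
Qed.

Lemma measurable_fun_row_mx m n (f : T -> 'rV[R]_m) (g : T -> 'rV[R]_n) :
  measurable_fun setT f -> measurable_fun setT g ->
  measurable_fun setT (fun x => row_mx (f x) (g x)).
Proof.
move=> mf mg; apply: measurable_fun_rV => i; case: (split_ordP i) => j ->.
  by under eq_fun do rewrite row_mxEl; exact: measurable_fun_coord.
by under eq_fun do rewrite row_mxEr; exact: measurable_fun_coord.
Qed.

Lemma measurable_fun_lsubmx m n (f : T -> 'rV[R]_(m + n)) :
  measurable_fun setT f -> measurable_fun setT (fun x => lsubmx (f x)).
Proof.
move=> mf; apply: measurable_fun_rV => i; under eq_fun do rewrite mxE.
exact: measurable_fun_coord.
Qed.

Lemma measurable_fun_rsubmx m n (f : T -> 'rV[R]_(m + n)) :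
  measurable_fun setT f -> measurable_fun setT (fun x => rsubmx (f x)).
Proof.
move=> mf; apply: measurable_fun_rV => i; under eq_fun do rewrite mxE.
exact: measurable_fun_coord.
Qed.

Lemma measurable_fun_dot n (f g : T -> 'rV[R]_n) : measurable_fun setT f ->
  measurable_fun setT g -> measurable_fun setT (fun x => dot (f x) (g x)).
Proof.
move=> mf mg; apply: measurable_sum => i.
by apply: measurable_funM; exact: measurable_fun_coord.
Qed.

End rV_measurability.

Section lebesgue_affine.
Variable R : realType.
Local Notation leb := (@lebesgue_measure R).

Lemma measurable_affine (a c : R) :
  measurable_fun setT (fun x : measurableTypeR R => a + c * x : measurableTypeR R).
Proof. by apply: measurable_funD => //; exact: measurable_funM. Qed.

Lemma ge0_integral_affine (a c : R) (u : measurableTypeR R -> \bar R) : c != 0 ->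
  measurable_fun setT u -> (forall x, 0 <= u x)%E ->
  (\int[leb]_x u x = `|c|%:E * \int[leb]_x u (a + c * x)%R)%E.
Proof.
move=> c0 mu u0.
have mk := measurable_affine a c.
have pE := ge0_integral_pushforward mk leb measurableT mu (fun x _ => u0 x).
rewrite preimage_setT in pE; rewrite -pE -ge0_integral_mscale//=.
apply: eq_measure_integral => A mA _.
apply: lebesgue_measure_unique => // _ [[b e]] _ <-.
rewrite lebesgue_measure_itv /= lte_fin.
rewrite -[mscale _ _ _]/(`|c|%:E * leb ((fun x => a + c * x)%R @^-1` `]b, e]%classic))%E.
have [c_gt0|c_le0] := ltP 0 c.
  rewrite (_ : _ @^-1` _ = `](b - a) / c, (e - a) / c]%classic); last first.
    apply/seteqP; split => x /=; rewrite !in_itv/= ltr_pdivrMr// ler_pdivlMr//;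
      by rewrite ltrBlDl lerBrDl (mulrC x).
  rewrite lebesgue_measure_itv /= lte_fin ltr_pM2r ?invr_gt0// ltrD2r.
  case: ifP => _; rewrite ?mule0// -!EFinD -EFinM gtr0_norm//.
  by congr EFin; field.
have c_lt0 : c < 0 by rewrite lt_neqAle c0.
rewrite (_ : _ @^-1` _ = `[(e - a) / c, (b - a) / c[%classic); last first.
  apply/seteqP; split => x /=; rewrite !in_itv/= ltr_ndivlMr// ler_ndivrMr//;
    rewrite ltrBlDl lerBrDl (mulrC x) => /andP[-> ->] //.
rewrite lebesgue_measure_itv /= lte_fin ltr_nM2r ?invr_lt0// ltrD2r.
case: ifP => _; rewrite ?mule0// -!EFinD -EFinM ltr0_norm//.
by congr EFin; field.
Qed.

Lemma ge0_integral_rV_cons n (v : 'rV[R]_n.+1 -> \bar R) : measurable_fun setT v ->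
    (forall x, 0 <= v x)%E ->
  (\int[lebesgue_rV R n.+1]_x v x =
   \int[leb]_x \int[lebesgue_rV R n]_y v (rV_cons (x, y)))%E.
Proof.
move=> mv v0; have mcons := @rV_cons_measurable R n.
rewrite (@ge0_integral_image _ _ _ _ _ (leb \x lebesgue_rV R n)%E _ (@rV_cons R n))//.
by rewrite fubini_tonelli1//; exact: measurableT_comp.
Qed.

(** Induction on the dimension, one coordinate being rescaled at a time: no
    Jacobian is involved. *)
Lemma ge0_integral_affine_rV n (a : 'rV[R]_n) (c : R) (u : 'rV[R]_n -> \bar R) :
  c != 0 -> measurable_fun setT u -> (forall x, 0 <= u x)%E ->
  (\int[lebesgue_rV R n]_x u x =
   (`|c| ^+ n)%:E * \int[lebesgue_rV R n]_x u (a + c *: x)%R)%E.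
Proof.
move=> c0; elim: n a u => [|n ih] a u mu u0.
  rewrite expr0 mul1e; apply: eq_integral => x _; congr u.
  by apply: rV_eqP => -[].
have maff : measurable_fun setT (fun x : 'rV[R]_n.+1 => a + c *: x).
  by apply: measurable_fun_rVD => //; apply: measurable_fun_rVZ.
rewrite ge0_integral_rV_cons//.
under eq_integral => x _.
  rewrite (ih (rV_tail a)); [|by apply: (measurableT_comp mu);
    exact: measurable_fun_rV_cons|by []].
  over.
have mF : measurable_fun setT
    (fun x => \int[lebesgue_rV R n]_y u (rV_cons (x, rV_tail a + c *: y)%R))%E.
  apply: (measurable_fun_fubini_tonelli_F (m2 := lebesgue_rV R n)
    (fun p => u (rV_cons (p.1, rV_tail a + c *: p.2)))) => //.
  apply: (measurableT_comp mu); apply: measurable_fun_rV_cons => //.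
  by apply: measurable_fun_rVD => //; apply: measurable_fun_rVZ.
rewrite ge0_integralZl//; last first.
  by move=> x _; exact: integral_ge0.
rewrite (ge0_integral_affine (rV_head a) c0)//; last first.
  by move=> x; exact: integral_ge0.
rewrite muleA -EFinM -exprSr ge0_integral_rV_cons//; last exact: measurableT_comp maff.
by under [in RHS]eq_integral do under eq_integral do rewrite rV_affine_cons.
Qed.


Lemma ge0_integral_rV1 (u : 'rV[R]_1 -> \bar R) : measurable_fun setT u ->
  (forall x, 0 <= u x)%E ->
  (\int[lebesgue_rV R 1]_x u x = \int[leb]_x u (const_mx x))%E.
Proof.
move=> mu u0; rewrite ge0_integral_rV_cons//; apply: eq_integral => x _.
rewrite integral_dirac//; last first.
  by apply: (measurableT_comp mu); exact: measurable_fun_rV_cons.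
rewrite diracT mul1e; congr u; apply: rV_eqP => j.
by rewrite (_ : j = ord0) ?rV_cons0 ?mxE//; case: j => -[] // ?; exact/val_inj.
Qed.

(** Splitting coordinates is associative: [lebesgue_rV] peels them off one at a
    time from the left, so the induction is on the left block. *)
Lemma ge0_integral_row_mx m n (u : 'rV[R]_(m + n) -> \bar R) : measurable_fun setT u ->
  (forall x, 0 <= u x)%E ->
  (\int[lebesgue_rV R (m + n)]_x u x =
   \int[lebesgue_rV R m]_x \int[lebesgue_rV R n]_y u (row_mx x y))%E.
Proof.
elim: m u => [|m ih] u mu u0.
  rewrite [RHS]integral_dirac//.
    rewrite diracT mul1e; apply: eq_integral => x _; congr u.
    by apply: rV_eqP => j; rewrite -[LHS](@row_mxEr _ 1 0 n 0 x); congr (row_mx _ _ _ _); exact/val_inj.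
  apply: (measurable_fun_fubini_tonelli_F (m2 := lebesgue_rV R n)
    (fun p => u (row_mx p.1 p.2))) => //.
  by apply: (measurableT_comp mu); exact: measurable_fun_row_mx.
rewrite [LHS](@ge0_integral_rV_cons (m + n))// ge0_integral_rV_cons; last 2 first.
- apply: (measurable_fun_fubini_tonelli_F (m2 := lebesgue_rV R n)
    (fun p => u (row_mx p.1 p.2))) => //.
  by apply: (measurableT_comp mu); exact: measurable_fun_row_mx.
- by move=> x; exact: integral_ge0.
apply: eq_integral => x _; rewrite ih//; last first.
  by apply: (measurableT_comp mu); exact: measurable_fun_rV_cons.
apply: eq_integral => y _; apply: eq_integral => z _; congr u.
apply: rV_eqP => j; case: (@split_ordP m.+1 n j) => i ->.
  rewrite row_mxEl; case: (unliftP ord0 i) => [k|] ->.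
    rewrite rV_consS /= -[RHS](@row_mxEl _ 1 m n y z) -(rV_consS (x, row_mx y z)).
    by congr (rV_cons _ _ _); exact/val_inj.
  rewrite rV_cons0 /= -[RHS](@rV_cons0 _ _ (x, row_mx y z)).
  by congr (rV_cons _ _ _); exact/val_inj.
rewrite row_mxEr -[RHS](@row_mxEr _ 1 m n y z).
rewrite -(rV_consS (x, row_mx y z)).
by congr (rV_cons _ _ _); exact/val_inj.
Qed.

End lebesgue_affine.

Section complex_rV.
Variable R : realType.
Local Notation leb := (@lebesgue_measure R).

(** Transfers a change of variables from nonnegative to complex functions. *)
Lemma cintegral_scaled_image d d' (T : measurableType d) (T' : measurableType d')
    (mu : {measure set T -> \bar R}) (nu : {measure set T' -> \bar R})
    (k : T -> T') (c : R) : measurable_fun setT k -> 0 <= c ->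
  (forall u, measurable_fun setT u -> (forall y, 0 <= u y)%E ->
     (\int[nu]_y u y = c%:E * \int[mu]_x u (k x))%E) ->
  forall g : T' -> R[i], cmeasurable g ->
  cintegral nu setT g = cintegral mu setT (fun x => g (k x) * real_complex R c).
Proof.
move=> mk c0 nuE g mg.
apply: (cintegral_weighted_image mk (measurable_cst c) (fun=> c0) _ mg) => A mA.
have mkA : measurable (k @^-1` A) by rewrite -[X in measurable X]setTI; exact: mk.
rewrite (eq_integral (cst c%:E))// integral_cst//.
have := nuE (fun y => (\1_A y)%:E).
rewrite integral_indic// setIT => ->//.
  rewrite -(setIT (k @^-1` A)) -integral_indic//.
exact/measurable_EFinP.
Qed.

Lemma cintegral_rV_affine n (a : 'rV[R]_n) (c : R) (g : 'rV[R]_n -> R[i]) :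
  c != 0 -> cmeasurable g ->
  cintegral (lebesgue_rV R n) setT g =
  cintegral (lebesgue_rV R n) setT
    (fun x => g (a + c *: x) * real_complex R (`|c| ^+ n)).
Proof.
move=> c0 mg; apply: cintegral_scaled_image => //.
- by apply: measurable_fun_rVD => //; exact: measurable_fun_rVZ.
- by move=> u mu u0; exact: ge0_integral_affine_rV.
Qed.

Lemma cintegral_rV_shift n (a : 'rV[R]_n) (g : 'rV[R]_n -> R[i]) : cmeasurable g ->
  cintegral (lebesgue_rV R n) setT g =
  cintegral (lebesgue_rV R n) setT (fun x => g (x + a)).
Proof.
move=> mg; rewrite (cintegral_rV_affine a (oner_neq0 R))//.
by apply: eq_cintegral => x _; rewrite normr1 expr1n mulr1 scale1r addrC.
Qed.

Lemma cintegral_rV_reflect n (a : 'rV[R]_n) (g : 'rV[R]_n -> R[i]) : cmeasurable g ->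
  cintegral (lebesgue_rV R n) setT g =
  cintegral (lebesgue_rV R n) setT (fun x => g (a - x)).
Proof.
move=> mg; rewrite (@cintegral_rV_affine _ a (-1))//.
by apply: eq_cintegral => x _; rewrite normrN normr1 expr1n mulr1 scaleN1r.
Qed.

Lemma ge0_integral_rV_shift n (a : 'rV[R]_n) (u : 'rV[R]_n -> \bar R) :
  measurable_fun setT u -> (forall x, 0 <= u x)%E ->
  (\int[lebesgue_rV R n]_x u x = \int[lebesgue_rV R n]_x u (x + a)%R)%E.
Proof.
move=> mu u0; rewrite (ge0_integral_affine_rV a (oner_neq0 R))//.
by rewrite normr1 expr1n mul1e; apply: eq_integral => x _; rewrite scale1r addrC.
Qed.

(** The Fourier variable dual to the centre and to [x] is kept in one vector
    [v = (t, x)], so that a point of the group is recovered from [v] and [y]. *)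
Definition heis_point n (v : 'rV[R]_n.+1) (y : 'rV[R]_n) : heisenberg R n :=
  row_mx (row_mx (rV_tail v) y) (const_mx (rV_head v)).

Lemma measurable_heis_point d (T : measurableType d) n (v : T -> 'rV[R]_n.+1)
    (y : T -> 'rV[R]_n) : measurable_fun setT v -> measurable_fun setT y ->
  measurable_fun setT (fun x => heis_point (v x) (y x)).
Proof.
move=> mv my; apply: measurable_fun_row_mx.
  by apply: measurable_fun_row_mx => //; exact: measurable_fun_rV_tail.
apply: measurable_fun_rV => i; under eq_fun do rewrite mxE.
exact: measurable_fun_coord.
Qed.

Lemma ge0_integral_heisenberg n (u : heisenberg R n -> \bar R) : measurable_fun setT u ->
  (forall x, 0 <= u x)%E ->
  (\int[lebesgue_rV R (n + n + 1)]_p u p =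
   \int[lebesgue_rV R n]_y \int[lebesgue_rV R n.+1]_v u (heis_point v y))%E.
Proof.
move=> mu u0; rewrite ge0_integral_row_mx// ge0_integral_row_mx; last 2 first.
- apply: (measurable_fun_fubini_tonelli_F (m2 := lebesgue_rV R 1)
    (fun p => u (row_mx p.1 p.2))) => //.
  by apply: (measurableT_comp mu); exact: measurable_fun_row_mx.
- by move=> x; exact: integral_ge0.
rewrite (fubini_tonelli (fun p => \int[lebesgue_rV R 1]_z u (row_mx (row_mx p.1 p.2) z)))%E; last 2 first.
- apply: (measurable_fun_fubini_tonelli_F (m2 := lebesgue_rV R 1)
    (fun p => u (row_mx (row_mx p.1.1 p.1.2) p.2))) => //.
  apply: (measurableT_comp mu); apply: measurable_fun_row_mx => //.
  by apply: measurable_fun_row_mx; apply: measurableT_comp => //.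
- by move=> x; exact: integral_ge0.
apply: eq_integral => y _; rewrite /=.
rewrite (fubini_tonelli (fun p => u (row_mx (row_mx p.1 y) p.2))); last 2 first.
- apply: (measurableT_comp mu); apply: measurable_fun_row_mx => //.
  by apply: measurable_fun_row_mx.
- by [].
rewrite ge0_integral_rV1; last 2 first.
- apply: (measurable_fun_fubini_tonelli_G (m1 := lebesgue_rV R n)
    (fun p => u (row_mx (row_mx p.1 y) p.2))) => //.
  apply: (measurableT_comp mu); apply: measurable_fun_row_mx => //.
  by apply: measurable_fun_row_mx.
- by move=> x; exact: integral_ge0.
rewrite ge0_integral_rV_cons//; last first.
  by apply: (measurableT_comp mu); exact: measurable_heis_point.
apply: eq_integral => t _; apply: eq_integral => x _.
by rewrite /heis_point rV_tail_cons rV_head_cons.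
Qed.

Lemma lebesgue_rV_consE n A : measurable A ->
  lebesgue_rV R n.+1 A = (leb \x lebesgue_rV R n)%E (@rV_cons R n @^-1` A).
Proof. by []. Qed.

End complex_rV.

(** * Product integrals and the exponential resolvent *)

Section products.
Variable R : realType.
Local Notation leb := (@lebesgue_measure R).

Lemma big_ord_rV_cons n (F : 'I_n.+1 -> R -> R) (p : R * 'rV[R]_n) :
  \prod_i F i (rV_cons p 0 i) =
  F ord0 p.1 * \prod_i F (lift ord0 i) (p.2 0 i).
Proof.
rewrite big_ord_recl rV_cons0; congr (_ * _).
by apply: eq_bigr => i _; rewrite rV_consS.
Qed.

Lemma measurable_prod_coord n (F : 'I_n -> R -> R) :
  (forall i, measurable_fun setT (F i)) ->
  measurable_fun setT (fun v : 'rV[R]_n => \prod_i F i (v 0 i)).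
Proof.
move=> mF; apply: measurable_prod => i _.
by apply: (measurableT_comp (mF i)); exact: coord_rV_measurable.
Qed.

Lemma ge0_integral_prod_rV n (F : 'I_n -> R -> R) (c : 'I_n -> R) :
  (forall i, measurable_fun setT (F i)) -> (forall i x, 0 <= F i x) ->
  (forall i, \int[leb]_x (F i x)%:E = (c i)%:E)%E ->
  (\int[lebesgue_rV R n]_v (\prod_i F i (v 0 i))%:E = (\prod_i c i)%:E)%E.
Proof.
elim: n F c => [|n ih] F c mF F0 Fc.
  rewrite integral_dirac//; last first.
    by apply/measurable_EFinP; exact: (measurable_prod_coord mF).
  by rewrite diracT mul1e !big_ord0.
rewrite ge0_integral_rV_cons; last 2 first.
- by apply/measurable_EFinP; exact: (measurable_prod_coord mF).
- by move=> v; rewrite lee_fin prodr_ge0.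
under eq_integral => x _.
  under eq_integral do rewrite big_ord_rV_cons /= EFinM.
  rewrite ge0_integralZl ?lee_fin//; last 2 first.
  - apply/measurable_EFinP.
    exact: (measurable_prod_coord (fun i => mF (lift ord0 i))).
  - by move=> y _; rewrite lee_fin prodr_ge0.
  rewrite (ih (fun i => F (lift ord0 i)) (fun i => c (lift ord0 i)))//.
  over.
rewrite ge0_integralZr//
.
- by rewrite Fc -EFinM big_ord_recl.
- by apply/measurable_EFinP; exact: mF.
- by move=> x _; rewrite lee_fin.
- rewrite lee_fin prodr_ge0// => i _; rewrite -lee_fin -Fc.
  by apply: integral_ge0 => x _; rewrite lee_fin.
Qed.

Lemma cintegral_prod_rV n (F : 'I_n -> R -> R[i]) :
  (forall i, cintegrable leb setT (F i)) ->
  cintegrable (lebesgue_rV R n) setT (fun v => \prod_i F i (v 0 i)) /\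
  cintegral (lebesgue_rV R n) setT (fun v => \prod_i F i (v 0 i)) =
  \prod_i cintegral leb setT (F i).
Proof.
have cprod m (G : 'I_m -> R -> R[i]) : (forall i, cintegrable leb setT (G i)) ->
    cintegrable (lebesgue_rV R m) setT (fun v => \prod_i G i (v 0 i)).
  move=> iG; apply: cintegrable_lty.
    apply: cmeasurable_prod => i; have mG := cintegrable_measurable (iG i).
    exact: (cmeasurable_comp mG (coord_rV_measurable i)).
  under eq_integral do rewrite normc_prod.
  rewrite (ge0_integral_prod_rV (F := fun i x => normc (G i x))
     (c := fun i => fine (\int[leb]_x (normc (G i x))%:E))) ?ltry//.
  - by move=> i; apply/measurable_normc; exact: cintegrable_measurable (iG i).
  - by move=> i x; exact: normc_ge0.
  - move=> i; rewrite fineK// ge0_fin_numE ?cintegrable_normc_lty//.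
    by apply: integral_ge0 => x _; rewrite lee_fin normc_ge0.
move=> iF; split; first exact: cprod.
elim: n F iF => [|n ih] F iF.
  rewrite big_ord0; under eq_cintegral do rewrite big_ord0.
  have T1 : fine (lebesgue_rV R 0 [set: 'rV[R]_0]) = 1 by rewrite [lebesgue_rV _ _ _]diracT.
  by apply: complexP; rewrite ?cRe_int ?cIm_int Rintegral_cst// T1 mulr1.
have mG := cintegrable_measurable (cprod _ _ iF).
rewrite (cintegral_image (@rV_cons_measurable R n) (@lebesgue_rV_consE R n))//.
have split_prod (p : R * 'rV[R]_n) : \prod_i F i (rV_cons p 0 i) =
    F ord0 p.1 * \prod_i F (lift ord0 i) (p.2 0 i).
  rewrite big_ord_recl rV_cons0; congr (_ * _).
  by apply: eq_bigr => i _; rewrite rV_consS.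
have ip : cintegrable (leb \x lebesgue_rV R n)%E setT
    (fun p => \prod_i F i (rV_cons p 0 i)).
  have := cintegrable_normc_lty (cprod _ _ iF).
  rewrite (ge0_integral_image (@rV_cons_measurable R n) (@lebesgue_rV_consE R n)).
  - apply: cintegrable_lty.
    exact: (cmeasurable_comp mG (@rV_cons_measurable R n)).
  - exact/measurable_EFinP/measurable_normc.
  - by move=> v; rewrite lee_fin normc_ge0.
rewrite -(cfubini ip).2 big_ord_recl.
under eq_cintegral => x _.
  under eq_cintegral do rewrite split_prod /=.
  rewrite cintegralZ; last exact: (cprod _ (fun i => F (lift ord0 i))).
  rewrite (ih (fun i => F (lift ord0 i)))// mulrC; over.
by rewrite cintegralZ// mulrC.
Qed.

End products.

Section one_dimensional_integrals.
Variable R : realType.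
Local Notation leb := (@lebesgue_measure R).

Lemma integral_cauchy : (\int[leb]_x ((1 + x ^+ 2)^-1)%:E = (@pi R)%:E)%E.
Proof.
rewrite ge0_symfun_integralT//=.
- rewrite (_ : [set x | _] = `[0, +oo[%classic); last first.
    by apply/seteqP; split => x/=; rewrite in_itv/= andbT.
  have := @integral0y_oneDsqr R; rewrite /oneDsqr => ->.
  by rewrite -EFinM mulrCA divff// mulr1.
- by move=> x; rewrite invr_ge0 addr_ge0// sqr_ge0.
- exact: continuous_oneDsqrV.
- by move=> x /=; rewrite sqrrN.
Qed.

(** The Green function of [1 + d/dr], supported on the half-line. *)
Definition gexp : R -> R := exponential_pdf (1 : R).

Lemma gexp_ge0 r : 0 <= gexp r. Proof. exact: exponential_pdf_ge0. Qed.
Lemma measurable_gexp : measurable_fun setT gexp.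
Proof. exact: measurable_exponential_pdf. Qed.
Lemma integral_gexp : (\int[leb]_r (gexp r)%:E = 1%:E)%E.
Proof. exact: integral_exponential_pdf. Qed.
Lemma gexpE r : 0 <= r -> gexp r = expR (- r).
Proof. by move=> r0; rewrite /gexp exponential_pdfE// mul1r mulN1r. Qed.
Lemma gexp_lt0 r : r < 0 -> gexp r = 0.
Proof. exact: lt0_exponential_pdf. Qed.

(** The derivative of [- e^-r u(r)] is [e^-r (u - u')(r)], so [u] is recovered
    from [u - u'] by averaging forward along the half-line. This is the
    resolvent of translation, and the one analytic identity from which decay,
    factorisation of kernels and Fourier inversion are all derived below. *)
Lemma exp_resolvent (u u' : R -> R) (C : R) :
  (forall r : R, is_derive r 1 u (u' r)) -> continuous u' ->
  (forall r, `|u r| <= C) -> (forall r, `|u' r| <= C) ->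
  \int[leb]_r (gexp r * (u r - u' r)) = u 0.
Proof.
move=> du cu' uC u'C.
have cu : continuous u.
  by move=> r; apply/differentiable_continuous/derivable1_diffP; case: (du r).
pose h r := expR (- r) * (u r - u' r).
pose F r := - (expR (- r) * u r).
have ch : continuous h.
  move=> r; apply: cvgM.
    by apply: continuous_comp; [exact: opp_continuous|exact: continuous_expR].
  by apply: cvgB; [exact: cu|exact: cu'].
have dF (r : R) : is_derive r 1 F (h r).
  have dr := du r.
  apply: is_derive_eq; rewrite /h /GRing.scale /=; ring.
have FE N : \int[leb]_(r in `[0, N.+1%:R]) h r = u 0 - expR (- N.+1%:R) * u N.+1%:R.
  rewrite /Rintegral (@continuous_FTC2 _ h F)//.
  - by rewrite -EFinN -EFinD /= /F oppr0 expR0 mul1r opprK addrC.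
  - exact: continuous_subspaceT.
  - have cF : continuous F.
      by move=> r; apply/differentiable_continuous/derivable1_diffP; case: (dF r).
    split.
    + by move=> r _; case: (dF r).
    + by apply: cvg_at_right_filter; exact: cF.
    + by apply: cvg_at_left_filter; exact: cF.
  - by move=> r _; rewrite derive1E; apply: derive_val.
have C0 : 0 <= C by rewrite (le_trans _ (uC 0)).
have lim1 : (fun N => \int[leb]_(r in `[0, N.+1%:R]) h r) @ \oo --> u 0.
  under eq_fun do rewrite FE.
  suff l0 : (fun N => expR (- N.+1%:R) * u N.+1%:R) @ \oo --> (0 : R).
    have := cvgB (cvg_cst (u 0 : R^o)) l0; rewrite subr0; exact.
  apply: norm_cvg0; apply: (@squeeze_cvgr _ _ _ _ (fun=> 0) (fun N => C * harmonic N)).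
  - apply: nearW => N; rewrite normr_ge0 /= normrM mulrC (ger0_norm (expR_ge0 _)).
    apply: ler_pM; rewrite ?expR_ge0 ?uC ?normr_ge0// expRN lef_pV2 ?posrE ?expR_gt0//.
    by apply: le_trans (expR_ge1Dx _); rewrite lerDr.
  - exact: cvg_cst.
  - by have := cvgM (cvg_cst (C : R^o)) cvg_harmonic; rewrite mulr0; exact.
have mh : measurable_fun setT h by exact: continuous_measurable_fun.
have mf : measurable_fun setT (fun r => gexp r * (u r - u' r)).
  apply: measurable_funM; first exact: measurable_gexp.
  by apply: measurable_funB; exact: continuous_measurable_fun.
have bnd r : `|u r - u' r| <= C + C.
  by rewrite (le_trans (ler_normB _ _))// lerD.
have lim2 : (fun N => \int[leb]_(r in `[0, N.+1%:R]) h r) @ \oo -->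
    \int[leb]_r (gexp r * (u r - u' r)).
  under eq_fun do rewrite Rintegral_mkcond.
  have := @Rdominated_convergence _ _ R leb (fun N => h \_ `[0, N.+1%:R]) (fun r => gexp r * (u r - u' r)) (fun r => gexp r * (C + C)).
  apply => //.
  - by move=> N; apply/measurable_restrict => //; exact: measurable_funTS.
  - move=> r; apply: cvg_near_cst.
    have [r0|r0] := ltP r 0.
      apply: nearW => N; rewrite patchE ifF ?gexp_lt0 ?mul0r//.
      by apply/negP; rewrite inE /= in_itv /= leNgt r0.
    have [M rM] : exists M : nat, r <= M%:R.
      by exists (Num.bound r); rewrite ltW// archi_boundP.
    near=> N; rewrite patchE ifT; first by rewrite gexpE.
    rewrite inE /= in_itv /= r0 /= (le_trans rM)// ler_nat.
    by apply: leqW; near: N; exact: nbhs_infty_ge.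
  - by apply: measurable_funM => //; exact: measurable_gexp.
  - move=> N r; rewrite patchE; case: ifPn => [|_].
      rewrite inE /= in_itv /= => /andP[r0 _].
      by rewrite gexpE// normrM ger0_norm ?expR_ge0// ler_wpM2l ?expR_ge0.
    by rewrite normr0 mulr_ge0 ?gexp_ge0// addr_ge0.
  - under eq_integral do rewrite EFinM.
    rewrite ge0_integralZr//.
    + by rewrite integral_gexp mul1e ltry.
    + by apply/measurable_EFinP; exact: measurable_gexp.
    + by move=> r _; rewrite lee_fin gexp_ge0.
    + by rewrite lee_fin addr_ge0.
exact: cvg_unique lim2 lim1.
Unshelve. all: by end_near. Qed.


Definition cderiv (u u' : R -> R[i]) := forall r : R,
  is_derive r 1 (fun s => cRe (u s)) (cRe (u' r)) /\
  is_derive r 1 (fun s => cIm (u s)) (cIm (u' r)).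

Definition ccontinuous (T : topologicalType) (g : T -> R[i]) :=
  continuous (fun x => cRe (g x)) /\ continuous (fun x => cIm (g x)).

Lemma cexp_resolvent (u u' : R -> R[i]) (C : R) : cderiv u u' -> ccontinuous u' ->
  (forall r, normc (u r) <= C) -> (forall r, normc (u' r) <= C) ->
  cintegral leb setT (fun r => real_complex R (gexp r) * (u r - u' r)) = u 0.
Proof.
move=> du [c1 c2] uC u'C; apply: complexP; rewrite ?cRe_int ?cIm_int.
  rewrite -(exp_resolvent (fun r => (du r).1) c1
    (fun r => le_trans (Re_le_normc _) (uC r))
    (fun r => le_trans (Re_le_normc _) (u'C r))).
  by apply: eq_Rintegral => r _; rewrite !cE mul0r subr0.
rewrite -(exp_resolvent (fun r => (du r).2) c2
  (fun r => le_trans (Im_le_normc _) (uC r))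
  (fun r => le_trans (Im_le_normc _) (u'C r))).
by apply: eq_Rintegral => r _; rewrite !cE mul0r addr0.
Qed.

Lemma cderiv_expi (a b : R) :
  cderiv (fun r => expi (a * r + b)) (fun r => imag a * expi (a * r + b)).
Proof.
move=> r; have da : is_derive r 1 (fun r : R => a * r + b) a.
  by apply: is_derive_eq; rewrite /GRing.scale /=; ring.
split; rewrite !cE.
  have h := @is_derive1_comp _ cos (fun r => a * r + b) r _ _ (is_derive_cos _) da.
  by apply: (is_derive_eq h); ring.
have h := @is_derive1_comp _ sin (fun r => a * r + b) r _ _ (is_derive_sin _) da.
by apply: (is_derive_eq h); ring.
Qed.

Lemma cderivM (u u' v v' : R -> R[i]) : cderiv u u' -> cderiv v v' ->
  cderiv (fun r => u r * v r) (fun r => u' r * v r + u r * v' r).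
Proof.
move=> du dv r; have [u1 u2] := du r; have [v1 v2] := dv r; split.
  under [X in is_derive _ _ X _]eq_fun do rewrite cE.
  by apply: is_derive_eq; rewrite !cE /GRing.scale /=; ring.
under [X in is_derive _ _ X _]eq_fun do rewrite cE.
by apply: is_derive_eq; rewrite !cE /GRing.scale /=; ring.
Qed.

Lemma ccontinuousD (T : topologicalType) (g h : T -> R[i]) : ccontinuous g ->
  ccontinuous h -> ccontinuous (fun x => g x + h x).
Proof.
move=> [g1 g2] [h1 h2]; split; under eq_fun do rewrite cE;
  move=> x; apply: cvgD; [exact: g1|exact: h1|exact: g2|exact: h2].
Qed.

Lemma ccontinuousM (T : topologicalType) (g h : T -> R[i]) : ccontinuous g ->
  ccontinuous h -> ccontinuous (fun x => g x * h x).
Proof.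
move=> [g1 g2] [h1 h2]; split; under eq_fun do rewrite cE; move=> x.
  apply: cvgB; apply: cvgM; [exact: g1|exact: h1|exact: g2|exact: h2].
by apply: cvgD; apply: cvgM; [exact: g1|exact: h2|exact: g2|exact: h1].
Qed.

Lemma ccontinuous_cst (T : topologicalType) (z : R[i]) : ccontinuous (fun _ : T => z).
Proof. by split => x; exact: cvg_cst. Qed.

Lemma ccontinuous_expi (T : topologicalType) (h : T -> R) : continuous h ->
  ccontinuous (fun x => expi (h x)).
Proof.
move=> ch; split => x /=; apply: continuous_comp; first exact: ch.
- exact: continuous_cos.
- exact: ch.
- exact: continuous_sin.
Qed.

Lemma ccontinuous_expi_affine (a b : R) : ccontinuous (fun r : R => expi (a * r + b)).
Proof.
apply: ccontinuous_expi => r; apply: cvgD; last exact: cvg_cst.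
by apply: cvgM; [exact: cvg_cst|exact: cvg_id].
Qed.

(** The resolvent identity for [u(r) = e^(i a r)], where [u - u' = (1 - i a) u]. *)
Lemma cintegral_gexp_expi (a : R) :
  cintegral leb setT (fun r => real_complex R (gexp r) * expi (a * r)) =
  (1 - imag a)^-1.
Proof.
have ig : cintegrable leb setT (fun r => real_complex R (gexp r) * expi (a * r)).
  apply: cintegrable_lty.
    apply: cmeasurableM.
      by apply: cmeasurable_real; exact: measurable_gexp.
    by apply: cmeasurable_expi; exact: measurable_funM.
  under eq_integral do rewrite normcM' normc_expi normc_real mulr1 ger0_norm ?gexp_ge0//.
  by rewrite integral_gexp ltry.
have aN0 : 1 - imag a != 0 :> R[i].
  by rewrite eq_complex /= !oppr0 !addr0 oner_eq0.
apply: (mulfI aN0); rewrite mulfV// -cintegralZ//.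
transitivity (expi (a * 0 + 0) : R[i]); last by rewrite mulr0 addr0 expi0.
rewrite -(@cexp_resolvent _ _ (Num.max 1 `|a|) (cderiv_expi a 0)).
- by apply: eq_cintegral => r _; rewrite addr0; ring.
- by apply: ccontinuousM; [exact: ccontinuous_cst|exact: ccontinuous_expi_affine].
- by move=> r; rewrite normc_expi le_max lexx.
- move=> r; rewrite normcM' normc_expi mulr1 normc_imag.
  by rewrite le_max lexx orbT.
Qed.

Lemma lebesgue_set1 (a : R) : leb [set a] = 0%E.
Proof. exact: lebesgue_measure_set1. Qed.

(** The frequency [0], where the representation degenerates, is negligible. *)
Lemma cintegral_lebesgue_ae0 (D : set R) (g h : R -> R[i]) :
  measurable D -> (forall x, x != 0 -> D x) -> cmeasurable g -> cmeasurable h ->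
  (forall x, x != 0 -> g x = h x) ->
  cintegral leb D g = cintegral leb setT h.
Proof.
move=> mD D0 mg mh gh.
have H (u v : R -> R) : measurable_fun setT u -> measurable_fun setT v ->
    (forall x, x != 0 -> u x = v x) -> \int[leb]_(x in D) u x = \int[leb]_x v x.
  move=> mu mv uv; rewrite Rintegral_mkcond /Rintegral; congr fine.
  apply: ae_eq_integral => //.
  - apply/measurable_EFinP; apply/measurable_restrict => //.
    exact: measurable_funTS.
  - by apply/measurable_EFinP.
  - exists [set 0]; split => //; first exact: lebesgue_set1.
    move=> x /= xP; apply/eqP; apply: contra_notT xP => x0 _.
    by rewrite patchE ifT ?uv// inE; exact: D0.
case: mg mh => g1 g2 [h1 h2].
by apply: complexP; rewrite ?cRe_int ?cIm_int; apply: H => // x x0; rewrite gh.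
Qed.

Lemma integral_expN_abs_lty : (\int[leb]_z (expR (- `|z|))%:E < +oo)%E.
Proof.
have cE0 : continuous (fun z : R => expR (- `|z|)).
  move=> z; apply: continuous_comp; last exact: continuous_expR.
  by apply: continuous_comp; [exact: norm_continuous|exact: opp_continuous].
rewrite ge0_symfun_integralT//=.
- have -> : (\int[leb]_(x in [set x : R | (0 <= x)%R]) (expR (- `|x|))%:E =
     \int[leb]_x (gexp x)%:E)%E.
    rewrite integral_mkcond; apply: eq_integral => x _; rewrite patchE.
    case: ifPn => [|]; first by rewrite inE /= => x0; rewrite gexpE// ger0_norm.
    by rewrite notin_setE /= => /negP; rewrite -ltNge => x0; rewrite gexp_lt0.
  by rewrite integral_gexp -EFinM ltry.
- by move=> x /=; rewrite normrN.
Qed.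

Lemma cintegrable_poisson_kernel (a : R) :
  cintegrable leb setT (fun z => real_complex R (expR (- `|z|)) * expi (a * z)).
Proof.
apply: cintegrable_lty.
  apply: cmeasurableM; last by apply: cmeasurable_expi; exact: measurable_funM.
  apply: cmeasurable_real; apply: continuous_measurable_fun.
  move=> z; apply: continuous_comp; last exact: continuous_expR.
  by apply: continuous_comp; [exact: norm_continuous|exact: opp_continuous].
under eq_integral do rewrite normcM' normc_expi normc_real mulr1 ger0_norm ?expR_ge0//.
exact: integral_expN_abs_lty.
Qed.

(** [e^(-|z|)] is the sum of [gexp z] and its reflection, which gives
    [(1 - i a)^-1 + (1 + i a)^-1]. *)
Lemma poisson_kernel (a : R) :
  cintegral leb setT (fun z => real_complex R (expR (- `|z|)) * expi (a * z)) =
  real_complex R (2 * (1 + a ^+ 2)^-1).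
Proof.
have mgexp (b : R) : cmeasurable
    (fun r : R => real_complex R (gexp r) * expi (b * r)).
  apply: cmeasurableM; first by apply: cmeasurable_real; exact: measurable_gexp.
  by apply: cmeasurable_expi; exact: measurable_funM.
have ig (b : R) : cintegrable leb setT (fun r => real_complex R (gexp r) * expi (b * r)).
  apply: cintegrable_lty; first exact: mgexp.
  under eq_integral do rewrite normcM' normc_expi normc_real mulr1 ger0_norm ?gexp_ge0//.
  by rewrite integral_gexp ltry.
have mN : measurable_fun setT (fun r : measurableTypeR R => - r : measurableTypeR R).
  exact: measurable_funN.
have NE A : measurable A -> leb A = leb ((fun r : measurableTypeR R => - r : measurableTypeR R) @^-1` A).
  by move=> mA; rewrite -lebesgue_measureN.
have mgN : cmeasurable (fun r : measurableTypeR R => real_complex R (gexp (- r)) * expi (a * r)).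
  have := cmeasurable_comp (mgexp (- a)) mN.
  by under eq_fun do rewrite mulrNN.
have igN : cintegrable leb setT (fun r => real_complex R (gexp (- r)) * expi (a * r)).
  apply: (cintegrable_image mN NE) => //.
  have := ig (- a); congr cintegrable; apply/funext => r.
  by rewrite opprK mulrN mulNr.
rewrite (@cintegral_lebesgue_ae0 setT _ (fun r : R => real_complex R (gexp r) * expi (a * r) +
   real_complex R (gexp (- r)) * expi (a * r)))//.
- rewrite cintegralD// cintegral_gexp_expi (cintegral_image mN NE)//.
  rewrite [X in _ + X](_ : _ = (1 - imag (- a))^-1); last first.
    rewrite -cintegral_gexp_expi; apply: eq_cintegral => r _.
    by rewrite opprK mulrN mulNr.
  have a0 : 1 + a ^+ 2 != 0 by rewrite gt_eqF// ltr_wpDr// sqr_ge0.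
  apply/eqP; rewrite eq_complex /= !oppr0 !addr0 !add0r !opprK !expr1n !sqrrN.
  apply/andP; split; apply/eqP; field => //.
- exact: cintegrable_measurable (cintegrable_poisson_kernel a).
- exact: cmeasurableD.
- move=> x x0; rewrite -mulrDl -rmorphD /=; congr (real_complex R _ * _).
  have [xlt0|xgt0] := ltP x 0.
    by rewrite (gexp_lt0 xlt0) add0r gexpE ?ltr0_norm// oppr_ge0 ltW.
  rewrite (gexpE xgt0) (gexp_lt0 (r := - x)) ?addr0 ?ger0_norm//.
  by rewrite oppr_lt0 lt_neqAle eq_sym x0.
Qed.

End one_dimensional_integrals.

(** * Square-integrable functions and orthonormal systems *)

Section square_integrable.
Variables (R : realType) (n : nat).
Local Notation vect := ('rV[R]_n -> R[i]).
Implicit Types (phi psi chi : vect).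
Local Notation leb := (lebesgue_rV R n).

(** The squared norm, before it is known to be finite. *)
Definition energy phi : \bar R := (\int[leb]_xi (normc (phi xi) ^+ 2)%:E)%E.

Lemma energy_ge0 phi : (0 <= energy phi)%E.
Proof. by apply: integral_ge0 => x _; rewrite lee_fin sqr_ge0. Qed.

Lemma L2_normE phi : L2_norm phi = (energy phi `^ 2^-1)%E.
Proof.
rewrite /L2_norm unlock; congr (_ `^ _)%E; apply: eq_integral => x _ /=.
by rewrite ger0_norm ?normc_ge0// powR_mulrn ?normc_ge0.
Qed.

Lemma L2_norm_le phi (e : R) : 0 <= e ->
  (L2_norm phi <= e%:E)%E <-> (energy phi <= (e ^+ 2)%:E)%E.
Proof.
move=> e0; have E0 := energy_ge0 phi; have N0 := @Lnorm_ge0 _ _ _ leb 2%:E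
  (fun xi => (normc (phi xi))%:E).
have E2 : energy phi = (L2_norm phi `^ 2)%E.
  by rewrite L2_normE -poweRrM mulVf// poweRe1.
split => h.
  rewrite E2; apply: (@le_trans _ _ (e%:E `^ 2)%E).
    by apply: gt0_ler_poweR => //; rewrite in_itv /= ?leey ?lee_fin ?andbT// e0.
  by rewrite poweR_EFin powR_mulrn.
rewrite L2_normE; apply: (@le_trans _ _ ((e ^+ 2)%:E `^ 2^-1)%E).
  by apply: gt0_ler_poweR => //; rewrite in_itv /= ?leey ?lee_fin ?andbT ?sqr_ge0.
by rewrite poweR_EFin -powR_mulrn// -powRrM mulfV// powRr1.
Qed.

Lemma L2P phi : L2 phi <-> cmeasurable phi /\ (energy phi < +oo)%E.
Proof.
rewrite /L2; split => -[mphi h]; split => //.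
  by move: h; rewrite L2_normE => /lty_poweRy; apply; rewrite invr_neq0.
by rewrite L2_normE; exact: poweR_lty.
Qed.

Lemma L2_measurable phi : L2 phi -> cmeasurable phi. Proof. by case. Qed.
Lemma L2_energy phi : L2 phi -> (energy phi < +oo)%E. Proof. by move/L2P => []. Qed.

Definition sqnorm phi : R := fine (energy phi).

Lemma sqnorm_ge0 phi : 0 <= sqnorm phi. Proof. by rewrite fine_ge0// energy_ge0. Qed.

Lemma sqnormK phi : L2 phi -> (sqnorm phi)%:E = energy phi.
Proof. by move=> /L2_energy h; rewrite fineK// ge0_fin_numE// energy_ge0. Qed.

Lemma measurable_sqr_normc d (T : measurableType d) (g : T -> R[i]) :
  cmeasurable g -> measurable_fun setT (fun x => (normc (g x) ^+ 2)%:E).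
Proof. by move=> mg; apply/measurable_EFinP/measurable_funX/measurable_normc. Qed.

Lemma sqr_normcD (z w : R[i]) : normc (z + w) ^+ 2 <= 2 * normc z ^+ 2 + 2 * normc w ^+ 2.
Proof.
rewrite !normc_sqr !cE; have := sqr_ge0 (cRe z - cRe w); have := sqr_ge0 (cIm z - cIm w).
by rewrite !sqrrB !sqrrD; lra.
Qed.

Lemma energyD phi psi : cmeasurable phi -> cmeasurable psi ->
  (energy (fun x => phi x + psi x)%R <= 2%:E * energy phi + 2%:E * energy psi)%E.
Proof.
move=> mphi mpsi; have m1 := measurable_sqr_normc mphi.
have m2 := measurable_sqr_normc mpsi.
rewrite -!ge0_integralZl ?lee_fin//; try (by move=> x _; rewrite lee_fin sqr_ge0).
rewrite -ge0_integralD//; first last.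
- exact: emeasurable_funM.
- by move=> x _; rewrite -EFinM lee_fin mulr_ge0 ?sqr_ge0.
- exact: emeasurable_funM.
- by move=> x _; rewrite -EFinM lee_fin mulr_ge0 ?sqr_ge0.
apply: ge0_le_integral => //.
- by move=> x _; rewrite lee_fin sqr_ge0.
- exact/measurable_sqr_normc/cmeasurableD.
- by apply: emeasurable_funD; exact: emeasurable_funM.
- by move=> x _; rewrite -!EFinM -EFinD lee_fin sqr_normcD.
Qed.

Lemma L2D phi psi : L2 phi -> L2 psi -> L2 (fun x => phi x + psi x).
Proof.
move=> l1 l2; have m1 := L2_measurable l1; have m2 := L2_measurable l2.
apply/L2P; split; first exact: cmeasurableD.
apply: le_lt_trans (energyD m1 m2) _.
by rewrite -(sqnormK l1) -(sqnormK l2) -!EFinM -EFinD ltry.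
Qed.

Lemma energyZ (z : R[i]) phi : cmeasurable phi ->
  energy (fun x => z * phi x) = ((normc z ^+ 2)%:E * energy phi)%E.
Proof.
move=> mphi; rewrite -ge0_integralZl ?lee_fin ?sqr_ge0//.
- by apply: eq_integral => x _; rewrite normcM' exprMn EFinM.
- exact: measurable_sqr_normc.
- by move=> x _; rewrite lee_fin sqr_ge0.
Qed.

Lemma L2Z (z : R[i]) phi : L2 phi -> L2 (fun x => z * phi x).
Proof.
move=> l1; have m1 := L2_measurable l1.
apply/L2P; split; first by apply: cmeasurableM => //; exact: cmeasurable_cst.
by rewrite energyZ// -(sqnormK l1) -EFinM ltry.
Qed.

Lemma L2_0 : L2 (fun _ : 'rV[R]_n => 0 : R[i]).
Proof.
apply/L2P; split; first exact: cmeasurable_cst.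
rewrite /energy (eq_integral (fun _ => 0%E)) ?integral0 ?ltry// => x _.
by rewrite normc0' expr0n.
Qed.

Lemma L2B phi psi : L2 phi -> L2 psi -> L2 (fun x => phi x - psi x).
Proof.
move=> l1 l2; have := L2D l1 (L2Z (-1) l2).
by under eq_fun do rewrite mulN1r.
Qed.

Lemma L2_sum I (r : seq I) (e : I -> vect) : (forall i, L2 (e i)) ->
  L2 (fun x => \sum_(i <- r) e i x).
Proof.
move=> le; elim: r => [|i r ih].
  by under eq_fun do rewrite big_nil; exact: L2_0.
by under eq_fun do rewrite big_cons; exact: L2D.
Qed.

Lemma L2_conj phi : L2 phi -> L2 (fun x => conjc (phi x)).
Proof.
move=> /L2P[m1 e1]; apply/L2P; split; first exact: cmeasurable_conj.
by apply: le_lt_trans e1; rewrite /energy; under eq_integral do rewrite normc_conj.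
Qed.

Lemma L2_le phi (u : 'rV[R]_n -> R) : cmeasurable phi -> measurable_fun setT u ->
  (forall x, normc (phi x) <= u x) -> (\int[leb]_x (u x ^+ 2)%:E < +oo)%E -> L2 phi.
Proof.
move=> mphi mu ub ul; apply/L2P; split => //; apply: le_lt_trans ul.
apply: ge0_le_integral => //.
- by move=> x _; rewrite lee_fin sqr_ge0.
- exact: measurable_sqr_normc.
- by apply/measurable_EFinP; exact: measurable_funX.
- by move=> x _; rewrite lee_fin lerXn2r ?nnegrE ?normc_ge0// (le_trans _ (ub x)) ?normc_ge0.
Qed.

(** The weighted arithmetic-geometric inequality takes the place of
    Cauchy-Schwarz; optimising over [t] would recover the latter. *)
Lemma mulr_le_weighted (t a b : R) : 0 < t ->
  a * b <= 2^-1 * (t * a ^+ 2 + t^-1 * b ^+ 2).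
Proof.
move=> t0; have := sqr_ge0 (t * a - b); rewrite sqrrB exprMn => h.
have tE : t^-1 * t = 1 by rewrite mulVf// gt_eqF.
have : 0 <= t^-1 * (t ^+ 2 * a ^+ 2 - t * a * b *+ 2 + b ^+ 2).
  by rewrite mulr_ge0// invr_ge0 ltW.
have -> : t^-1 * (t ^+ 2 * a ^+ 2 - t * a * b *+ 2 + b ^+ 2) =
    (t^-1 * t) * (t * a ^+ 2) - (t^-1 * t) * (2 * (a * b)) + t^-1 * b ^+ 2 by ring.
by rewrite tE !mul1r; lra.
Qed.

Lemma mulr_le_sqrD (a b : R) : 0 <= a -> 0 <= b -> a * b <= a ^+ 2 + b ^+ 2.
Proof.
move=> a0 b0; have := sqr_ge0 (a - b); have := sqr_ge0 a; have := sqr_ge0 b.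
by rewrite sqrrB; lra.
Qed.

Let weighted_integral (t : R) phi psi : 0 < t -> L2 phi -> L2 psi ->
  (\int[leb]_x (2^-1 * (t * normc (phi x) ^+ 2 + t^-1 * normc (psi x) ^+ 2))%:E =
   (2^-1 * (t * sqnorm phi + t^-1 * sqnorm psi))%:E)%E.
Proof.
move=> t0 l1 l2; have t0' := ltW t0.
have ti0 : 0 <= t^-1 by rewrite invr_ge0.
have m1 := measurable_sqr_normc (L2_measurable l1).
have m2 := measurable_sqr_normc (L2_measurable l2).
have p1 x : (0 <= (normc (phi x) ^+ 2)%:E)%E by rewrite lee_fin sqr_ge0.
have p2 x : (0 <= (normc (psi x) ^+ 2)%:E)%E by rewrite lee_fin sqr_ge0.
rewrite (eq_integral (fun x => (2^-1)%R%:E * (t%:E * (normc (phi x) ^+ 2)%:E +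
  (t^-1)%R%:E * (normc (psi x) ^+ 2)%:E))%E); last first.
  by move=> x _; rewrite !EFinM EFinD !EFinM.
rewrite ge0_integralZl ?lee_fin//; first last.
- by move=> x _; rewrite adde_ge0// mule_ge0// lee_fin.
- by apply: emeasurable_funD; exact: emeasurable_funM.
rewrite ge0_integralD//; first last.
- exact: emeasurable_funM.
- by move=> x _; rewrite mule_ge0// lee_fin.
- exact: emeasurable_funM.
- by move=> x _; rewrite mule_ge0// lee_fin.
rewrite !ge0_integralZl// -!/(energy _) -!sqnormK//.
Qed.

Lemma L2_cintegrable phi psi : L2 phi -> L2 psi ->
  cintegrable leb setT (fun x => phi x * conjc (psi x)).
Proof.
move=> l1 l2; have m1 := L2_measurable l1; have m2 := L2_measurable l2.
apply: (cintegrable_le (u := fun x => 2^-1 * (1 * normc (phi x) ^+ 2 + 1^-1 * normc (psi x) ^+ 2))).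
- by apply: cmeasurableM => //; exact: cmeasurable_conj.
- apply: measurable_funM => //; apply: measurable_funD; apply: measurable_funM => //;
    exact/measurable_funX/measurable_normc.
- by move=> x; rewrite normcM' normc_conj mulr_le_weighted.
- by rewrite weighted_integral// ltry.
Qed.

Lemma normc_inner_le (t : R) phi psi : 0 < t -> L2 phi -> L2 psi ->
  normc (inner phi psi) <= t * sqnorm phi + t^-1 * sqnorm psi.
Proof.
move=> t0 l1 l2; have m1 := L2_measurable l1; have m2 := L2_measurable l2.
apply: le_trans (normc_cintegral_le (u := fun x => 2^-1 *
  (t * normc (phi x) ^+ 2 + t^-1 * normc (psi x) ^+ 2)) _ _ _ _) _.
- by apply: cmeasurableM => //; exact: cmeasurable_conj.
- apply: measurable_funM => //; apply: measurable_funD; apply: measurable_funM => //;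
    exact/measurable_funX/measurable_normc.
- by move=> x; rewrite normcM' normc_conj mulr_le_weighted.
- by rewrite weighted_integral// ltry.
- by rewrite weighted_integral//= mulrA divff// mul1r.
Qed.

Lemma innerDl phi psi chi : L2 phi -> L2 psi -> L2 chi ->
  inner (fun x => phi x + psi x) chi = inner phi chi + inner psi chi.
Proof.
move=> l1 l2 l3; rewrite /inner -cintegralD; try exact: L2_cintegrable.
by apply: eq_cintegral => x _; rewrite mulrDl.
Qed.

Lemma innerZl z phi chi : L2 phi -> L2 chi ->
  inner (fun x => z * phi x) chi = z * inner phi chi.
Proof.
move=> l1 l3; rewrite /inner -cintegralZ; try exact: L2_cintegrable.
by apply: eq_cintegral => x _; rewrite mulrA.
Qed.

Lemma inner0l chi : inner (fun _ => 0) chi = 0.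
Proof. by rewrite /inner -[RHS](cintegral0 leb); apply: eq_cintegral => x _; rewrite mul0r. Qed.

Lemma innerC phi psi : L2 phi -> L2 psi -> inner phi psi = conjc (inner psi phi).
Proof.
move=> l1 l2; rewrite /inner -cintegral_conj; last exact: L2_cintegrable.
by apply: eq_cintegral => x _; rewrite rmorphM /= conjcK mulrC.
Qed.

Lemma innerBl phi psi chi : L2 phi -> L2 psi -> L2 chi ->
  inner (fun x => phi x - psi x) chi = inner phi chi - inner psi chi.
Proof.
move=> l1 l2 l3; rewrite -mulN1r -innerZl// -innerDl//; last exact: L2Z.
by congr inner; apply/funext => x; rewrite mulN1r.
Qed.

Lemma inner_suml I (r : seq I) (b : I -> R[i]) (e : I -> vect) chi :
  (forall i, L2 (e i)) -> L2 chi ->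
  inner (fun x => \sum_(i <- r) b i * e i x) chi = \sum_(i <- r) b i * inner (e i) chi.
Proof.
move=> le lchi; elim: r => [|i r ih].
  by rewrite big_nil -[RHS](inner0l chi); congr inner; apply/funext => x; rewrite big_nil.
rewrite big_cons -ih -innerZl// -innerDl//.
- by congr inner; apply/funext => x; rewrite big_cons.
- exact: L2Z.
- by apply: L2_sum => j; exact: L2Z.
Qed.

Lemma inner_sumr I (r : seq I) (b : I -> R[i]) (e : I -> vect) chi :
  (forall i, L2 (e i)) -> L2 chi ->
  inner chi (fun x => \sum_(i <- r) b i * e i x) =
  \sum_(i <- r) conjc (b i) * inner chi (e i).
Proof.
move=> le lchi; rewrite innerC//; last by apply: L2_sum => i; exact: L2Z.
rewrite inner_suml// rmorph_sum; apply: eq_bigr => i _.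
by rewrite rmorphM /=; congr (_ * _); rewrite [RHS]innerC.
Qed.

Lemma inner_self phi : L2 phi -> inner phi phi = real_complex R (sqnorm phi).
Proof.
move=> l1; apply: complexP; rewrite ?cRe_int ?cIm_int cE.
  by congr fine; apply: eq_integral => x _; rewrite mulc_conj.
rewrite -[RHS](mul0r (fine (leb setT))) -Rintegral_cst//.
by apply: eq_Rintegral => x _; rewrite mulc_conj cE.
Qed.

End square_integrable.

Section orthonormal_systems.
Variables (R : realType) (n : nat).
Local Notation vect := ('rV[R]_n -> R[i]).
Implicit Types (phi psi chi : vect).

(** An orthonormal system indexed by a set of indices is padded by zero vectors,
    so that sums can run over all indices. *)
Definition padded_orthonormal (dom : pred nat) (e : nat -> vect) :=
  [/\ forall j, L2 (e j),
      forall j k, inner (e j) (e k) = ((j == k) && dom j)%:R &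
      forall j, ~~ dom j -> e j = fun=> 0].

Definition proj (e : nat -> vect) (phi : vect) N : vect :=
  fun xi => \sum_(0 <= j < N) inner phi (e j) * e j xi.

Section padded.
Variables (dom : pred nat) (e : nat -> vect).
Hypothesis one : padded_orthonormal dom e.

Let le j : L2 (e j). Proof. by case: one. Qed.

Lemma L2_combination (b : nat -> R[i]) N :
  L2 (fun xi => \sum_(0 <= j < N) b j * e j xi).
Proof. by apply: L2_sum => j; exact: L2Z. Qed.

(** Completing the square: the best coefficients of an approximation along an
    orthonormal system are the inner products. *)
Lemma pythagoras phi (b : nat -> R[i]) N : L2 phi ->
  sqnorm (fun xi => phi xi - \sum_(0 <= j < N) b j * e j xi) =
  sqnorm phi - \sum_(0 <= j < N) normc (inner phi (e j)) ^+ 2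
  + \sum_(0 <= j < N | dom j) normc (inner phi (e j) - b j) ^+ 2.
Proof.
move=> lphi; have [_ ee e0] := one; have lb := L2_combination b N.
pose c j := inner phi (e j).
pose B : vect := fun xi => \sum_(0 <= j < N) b j * e j xi.
have cB : inner phi B = \sum_(0 <= j < N) conjc (b j) * c j by rewrite inner_sumr.
have BB : inner B B = \sum_(0 <= j < N | dom j) b j * conjc (b j).
  rewrite inner_suml// [in RHS]big_mkcond /=; apply: eq_big_nat => j /andP[_ jN].
  rewrite inner_sumr// (bigD1_seq j) ?mem_index_iota ?iota_uniq//=.
  rewrite big1 ?addr0 => [|k kj]; rewrite ee; last first.
    by rewrite eq_sym (negbTE kj) mulr0.
  by rewrite eqxx; case: ifP => _; rewrite /= ?mulr1 ?mulr0.
have c0 j : ~~ dom j -> c j = 0.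
  by move=> dj; rewrite /c e0// innerC ?inner0l ?conjc0//; exact: L2_0.
have lB : L2 (fun xi => phi xi - B xi) by exact: L2B.
apply: (fmorph_inj (real_complex R)).
transitivity (inner (fun xi => phi xi - B xi) (fun xi => phi xi - B xi)).
  by rewrite inner_self.
have -> : inner (fun xi => phi xi - B xi) (fun xi => phi xi - B xi) =
    inner phi phi - inner phi B - conjc (inner phi B) + inner B B.
  have h psi : L2 psi -> inner psi (fun xi => phi xi - B xi) =
      conjc (inner phi psi) - conjc (inner B psi).
    by move=> lpsi; rewrite innerC// innerBl// rmorphB.
  rewrite innerBl// !h// -(innerC lphi lphi) -(innerC lphi lb) -(innerC lb lb).
  by rewrite opprB addrA addrAC.
rewrite inner_self// BB cB rmorphD rmorphB/= -!addrA; congr (_ + _).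
rewrite rmorph_sum !rmorph_sum /= [X in _ = _ + X]big_mkcond [X in _ + (_ + X) = _]big_mkcond.
rewrite -!sumrN -!big_split /=; apply: eq_bigr => j _.
case: ifPn => [dj|/c0 cj0]; last first.
  by rewrite -/(c j) cj0 mulr0 conjc0 normc0' expr0n /= !oppr0 !addr0.
rewrite -/(c j) -!mulc_conj !rmorphM !rmorphB /= conjcK; ring.
Qed.




Lemma sqnorm_proj phi N : L2 phi ->
  sqnorm (fun xi => phi xi - proj e phi N xi) =
  sqnorm phi - \sum_(0 <= j < N) normc (inner phi (e j)) ^+ 2.
Proof.
move=> lphi; rewrite pythagoras//.
by rewrite [X in _ + X]big1 ?addr0// => j _; rewrite subrr normc0' expr0n.
Qed.

Lemma bessel phi N : L2 phi ->
  \sum_(0 <= j < N) normc (inner phi (e j)) ^+ 2 <= sqnorm phi.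
Proof. by move=> lphi; rewrite -subr_ge0 -sqnorm_proj// sqnorm_ge0. Qed.

Lemma proj_best phi (b : nat -> R[i]) N : L2 phi ->
  sqnorm (fun xi => phi xi - proj e phi N xi) <=
  sqnorm (fun xi => phi xi - \sum_(0 <= j < N) b j * e j xi).
Proof.
move=> lphi; rewrite sqnorm_proj// pythagoras// lerDl.
by apply: sumr_ge0 => j _; exact: sqr_ge0.
Qed.

Lemma bessel_pair phi psi N : L2 phi -> L2 psi ->
  \sum_(0 <= j < N) normc (inner phi (e j) * inner (e j) psi) <=
  2^-1 * (sqnorm phi + sqnorm psi).
Proof.
move=> l1 l2; apply: (@le_trans _ _ (\sum_(0 <= j < N)
    2^-1 * (normc (inner phi (e j)) ^+ 2 + normc (inner psi (e j)) ^+ 2))).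
  apply: ler_sum => j _; rewrite normcM' (innerC (le j) l2) normc_conj.
  by have := @mulr_le_weighted R 1 (normc (inner phi (e j))) (normc (inner psi (e j))) ltr01;
    rewrite invr1 !mul1r.
by rewrite -mulr_sumr ler_pM2l// big_split lerD//= bessel.
Qed.

(** The defining convergence of an orthonormal basis, in terms of energies. *)
Definition complete_system := forall phi, L2 phi -> forall eps : R, 0 < eps ->
  \forall N \near \oo, sqnorm (fun xi => phi xi - proj e phi N xi) <= eps.

(** The remainder is [<phi - proj phi, psi>], which [normc_inner_le] bounds by
    [t |phi - proj phi|^2 + |psi|^2 / t]; [t] is taken large first. *)
Lemma parseval phi psi : complete_system -> L2 phi -> L2 psi ->
  ccvg (fun N => \sum_(0 <= j < N) inner phi (e j) * inner (e j) psi)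
    (inner phi psi).
Proof.
move=> cs l1 l2.
have lP N : L2 (proj e phi N) by exact: L2_combination.
have E N : \sum_(0 <= j < N) inner phi (e j) * inner (e j) psi =
    inner phi psi - inner (fun xi => phi xi - proj e phi N xi) psi.
  by rewrite innerBl// opprB addrC subrK /proj inner_suml.
suff small : forall eps : R, 0 < eps -> \forall N \near \oo,
    normc (inner (fun xi => phi xi - proj e phi N xi) psi) <= eps.
  split; apply/cvgrPdist_le => eps eps0; near=> N; rewrite E.
    by rewrite -cReB subKr (le_trans (Re_le_normc _))//; near: N; exact: small.
  by rewrite -cImB subKr (le_trans (Im_le_normc _))//; near: N; exact: small.
move=> eps eps0.
(* the term in [psi] is then at most [eps / 2], whatever [N] *)
pose t := 2 * (sqnorm psi + 1) / eps.
have t0 : 0 < t by rewrite divr_gt0// mulr_gt0// ltr_wpDl ?sqnorm_ge0.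
near=> N; apply: le_trans (normc_inner_le t0 _ l2) _; first exact: L2B.
have h1 : t^-1 * sqnorm psi <= eps / 2.
  have p1 : 0 < sqnorm psi + 1 by rewrite ltr_wpDl ?sqnorm_ge0.
  have -> : t^-1 * sqnorm psi = (eps / 2) * (sqnorm psi / (sqnorm psi + 1)).
    by rewrite /t; field; rewrite ?gt_eqF.
  rewrite ler_piMr ?divr_ge0 ?(ltW eps0)// ler_pdivrMr// mul1r lerDl//.
have h2 : sqnorm (fun xi => phi xi - proj e phi N xi) <= eps / 2 / t.
  by near: N; apply: cs => //; rewrite divr_gt0// divr_gt0.
rewrite [leRHS](splitr eps) lerD//.
by rewrite mulrC -ler_pdivlMr.
Unshelve. all: by end_near. Qed.

End padded.

Section basis.
Variables (D : set nat) (e : nat -> vect).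

(** The vectors outside of the index set carry no information, and are replaced
    by zero. *)
Definition pad : nat -> vect := fun j => if j \in D then e j else fun=> 0.

Lemma orthonormal_basis_padded : orthonormal_basis D e ->
  padded_orthonormal (fun j => j \in D) pad /\ complete_system pad.
Proof.
move=> [le ee ce]; have lp j : L2 (pad j).
  by rewrite /pad; case: ifPn => [/set_mem/le//|_]; exact: L2_0.
have i0 phi : L2 phi -> inner phi (fun=> 0) = 0.
  by move=> l1; rewrite innerC ?inner0l ?conjc0//; exact: L2_0.
split.
  split => //; last by move=> j jD; rewrite /pad (negbTE jD).
  move=> j k; rewrite /pad; case: ifPn => [jD|jD]; last by rewrite inner0l andbF.
  case: ifPn => [kD|kD]; first by rewrite andbT ee//; exact: set_mem.
  rewrite i0; last by apply/le/set_mem.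
  by case: eqP => // jk; rewrite -jk jD in kD.
move=> phi lphi eps eps0.
have /fine_cvgP[_] := ce _ lphi.
have PE N : (fun xi => phi xi - \sum_(0 <= j < N | j \in D) inner phi (e j) * e j xi) =
    (fun xi => phi xi - proj pad phi N xi).
  apply/funext => xi; congr (_ - _); rewrite /proj big_mkcond; apply: eq_bigr => j _.
  by rewrite /pad; case: ifPn => // _; rewrite i0// mul0r.
have Lf N : L2 (fun xi => phi xi - proj pad phi N xi).
  by apply: L2B => //; apply: L2_sum => j; exact: L2Z.
have s0 : 0 < Num.sqrt eps by rewrite sqrtr_gt0.
move=> /cvgrPdist_le /(_ _ s0); apply: filterS => N.
rewrite /= PE sub0r normrN ger0_norm ?fine_ge0 ?Lnorm_ge0// => h.
rewrite -lee_fin sqnormK// -(sqr_sqrtr (ltW eps0)).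
apply/(L2_norm_le _ (ltW s0)); rewrite -lee_fin fineK// in h.
by rewrite ge0_fin_numE ?Lnorm_ge0//; case: (Lf N).
Qed.

End basis.

Lemma padded_orthonormal_basis (dom : pred nat) (e : nat -> vect) :
  padded_orthonormal dom e -> complete_system e ->
  orthonormal_basis [set j | dom j] e.
Proof.
move=> [le ee e0] ce; split => //.
  by move=> j k /= dj dk; rewrite ee dj andbT.
move=> phi lphi.
have i0 : inner phi (fun=> 0) = 0.
  by rewrite innerC ?inner0l ?conjc0//; exact: L2_0.
have PE N : (fun xi => phi xi - \sum_(0 <= j < N | j \in [set j | dom j]) inner phi (e j) * e j xi) =
    (fun xi => phi xi - proj e phi N xi).
  apply/funext => xi; congr (_ - _); rewrite /proj big_mkcond; apply: eq_bigr => j _.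
  case: ifPn => // jD; rewrite e0 ?i0 ?mul0r//.
  by apply: contra jD => dj; rewrite inE.
have Lf N : L2 (fun xi => phi xi - proj e phi N xi).
  by apply: L2B => //; apply: L2_sum => j; exact: L2Z.
under eq_fun do rewrite PE.
apply/fine_cvgP; split.
  by apply: nearW => N; rewrite ge0_fin_numE ?Lnorm_ge0//; case: (Lf N).
apply/cvgrPdist_le => eps eps0.
have e20 : 0 < eps ^+ 2 by rewrite exprn_gt0.
have := ce _ lphi _ e20; apply: filterS => N h /=.
rewrite sub0r normrN ger0_norm ?fine_ge0 ?Lnorm_ge0//.
rewrite -lee_fin fineK; last by rewrite ge0_fin_numE ?Lnorm_ge0//; case: (Lf N).
by apply/(L2_norm_le _ (ltW eps0)); rewrite -sqnormK// lee_fin.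
Qed.

End orthonormal_systems.

(** * Traces of superpositions of rank-one operators *)

Section trace_of_rank_one_superposition.
Context d (T : measurableType d) (R : realType) (n : nat).
Variable nu : {measure set T -> \bar R}.
Local Notation vect := ('rV[R]_n -> R[i]).
Local Notation leb := (lebesgue_rV R n).
Variables U V : T * 'rV[R]_n -> R[i].
Hypotheses (mU : cmeasurable U) (mV : cmeasurable V).
Hypotheses (LU : forall w, L2 (fun xi => U (w, xi)))
           (LV : forall w, L2 (fun xi => V (w, xi))).
Hypotheses (EU : (\int[nu]_w energy (fun xi => U (w, xi)) < +oo)%E)
           (EV : (\int[nu]_w energy (fun xi => V (w, xi)) < +oo)%E).

Let measurable_energy (F : T * 'rV[R]_n -> R[i]) : cmeasurable F ->
  measurable_fun setT (fun w => energy (fun xi => F (w, xi))).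
Proof.
move=> mF; apply: (measurable_fun_fubini_tonelli_F (m2 := leb)
  (fun p => (normc (F p) ^+ 2)%:E)).
  exact: measurable_sqr_normc.
by move=> p; rewrite lee_fin sqr_ge0.
Qed.

Let dominant w : R :=
  2^-1 * (sqnorm (fun xi => V (w, xi)) + sqnorm (fun xi => U (w, xi))).

Let measurable_dominant : measurable_fun setT dominant.
Proof.
apply: measurable_funM => //; apply: measurable_funD;
  (apply: measurableT_comp; [exact: fine_measurable|exact: measurable_energy]).
Qed.

Let dominant_lty : (\int[nu]_w (dominant w)%:E < +oo)%E.
Proof.
rewrite (eq_integral (fun w => (2^-1)%:E * (energy (fun xi => V (w, xi)) +
   energy (fun xi => U (w, xi))))%E); last first.
  by move=> w _; rewrite EFinM EFinD !sqnormK.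
rewrite ge0_integralZl ?lee_fin//; last 2 first.
- by apply: emeasurable_funD; exact: measurable_energy.
- by move=> w _; rewrite adde_ge0// energy_ge0.
rewrite ge0_integralD//; try exact: measurable_energy;
  try by move=> w _; exact: energy_ge0.
by apply: lte_mul_pinfty; rewrite ?lee_fin// lte_add_pinfty.
Qed.

Let cmeasurable_inner (F G : T * 'rV[R]_n -> R[i]) : cmeasurable F -> cmeasurable G ->
  cmeasurable (fun w => inner (fun xi => F (w, xi)) (fun xi => G (w, xi))).
Proof.
move=> mF mG; apply: (cmeasurable_cintegral leb (g := fun p => F p * conjc (G p))).
by apply: cmeasurableM => //; exact: cmeasurable_conj.
Qed.

Let coef (e : nat -> vect) j w :=
  inner (fun xi => V (w, xi)) (e j) * inner (e j) (fun xi => U (w, xi)).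

Let cmeasurable_coef e j : L2 (e j) -> cmeasurable (coef e j).
Proof.
move=> le; have me : cmeasurable (fun p : T * 'rV[R]_n => e j p.2).
  by apply: (cmeasurable_comp (L2_measurable le)).
by apply: cmeasurableM; [exact: (cmeasurable_inner mV me)|exact: (cmeasurable_inner me mU)].
Qed.

(** A superposition of rank-one operators [phi |-> <phi, U_w> V_w] with [U] and
    [V] square integrable is trace class: over any orthonormal basis Bessel's
    inequality bounds the diagonal, and Parseval's identity sums it pointwise
    in [w], so that dominated convergence gives the trace. *)
Lemma has_trace_superposition (S : vect -> vect) :
  (forall phi, L2 phi -> inner (S phi) phi = cintegral nu setT (fun w =>
     inner phi (fun xi => U (w, xi)) * inner (fun xi => V (w, xi)) phi)) ->
  has_trace S (cintegral nu setT (fun w =>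
     inner (fun xi => V (w, xi)) (fun xi => U (w, xi)))).
Proof.
move=> hS D e onb; have [ortho cs] := orthonormal_basis_padded onb.
have lp j : L2 (pad D e j) by case: ortho.
pose g := coef (pad D e).
have aE j : (if j \in D then inner (S (e j)) (e j) else 0) = cintegral nu setT (g j).
  rewrite /g /coef /pad; case: ifPn => [/set_mem jD|jD].
    rewrite hS; last by case: onb => le _ _; exact: le.
    by apply: eq_cintegral => w _; rewrite mulrC.
  rewrite -[LHS](cintegral0 nu); apply: eq_cintegral => w _.
  by rewrite inner0l mulr0.
have sum_le N w : \sum_(0 <= j < N) normc (g j w) <= dominant w.
  exact: bessel_pair ortho _ _ _ (LV w) (LU w).
have g_le j w : normc (g j w) <= dominant w.
  apply: le_trans (sum_le j.+1 w); rewrite big_nat_recr//= lerDr.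
  by apply: sumr_ge0 => i _; exact: normc_ge0.
have mg j : cmeasurable (g j) by exact: cmeasurable_coef.
have ig j : cintegrable nu setT (g j).
  exact: cintegrable_le (mg j) measurable_dominant (g_le j) dominant_lty.
have mng j : measurable_fun setT (fun w => (normc (g j w))%:E).
  exact/measurable_EFinP/measurable_normc.
have ng0 j w : (0 <= (normc (g j w))%:E)%E by rewrite lee_fin normc_ge0.
have d0 w : 0 <= dominant w by rewrite (le_trans _ (g_le 0 w))// normc_ge0.
have nE : (fun j => ComplexField.Normc.normc (if j \in D then inner (S (e j)) (e j) else 0)) =
    (fun j => normc (cintegral nu setT (g j))).
  by apply/funext => j; rewrite aE.
have sE h : (fun j => h (if j \in D then inner (S (e j)) (e j) else 0) : R) =
    (fun j => h (cintegral nu setT (g j))).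
  by apply/funext => j; rewrite aE.
have gsum : ccvg (fun N => \sum_(0 <= j < N) cintegral nu setT (g j))
   (cintegral nu setT (fun w => inner (fun xi => V (w, xi)) (fun xi => U (w, xi)))).
  under eq_fun do rewrite -cintegral_sum//.
  apply: (cdominated_convergence (u := dominant)) => //.
  - by move=> N; exact: cmeasurable_sum.
  - exact: cmeasurable_inner.
  - by move=> w; exact: parseval ortho _ _ cs (LV w) (LU w).
  - move=> N w; apply: le_trans (sum_le N w).
    elim/big_ind2 : _ => // [|z1 x1 z2 x2 h1 h2]; first by rewrite normc0'.
    by rewrite (le_trans (normcD_le _ _))// lerD.
split.
- rewrite nE; apply: nondecreasing_is_cvgn.
    by apply/nondecreasing_seqP => N; rewrite /series /= big_nat_recr//= lerDl normc_ge0.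
  exists (2 * fine (\int[nu]_w (dominant w)%:E)) => _ [N _ <-] /=.
  apply: (@le_trans _ _ (\sum_(0 <= j < N) 2 * fine (\int[nu]_w (normc (g j w))%:E))).
    apply: ler_sum => j _; apply: normc_cintegral_le => //.
      exact: measurable_normc.
    exact: cintegrable_normc_lty.
  have fin j : (\int[nu]_w (normc (g j w))%:E)%E \is a fin_num.
    by rewrite ge0_fin_numE ?cintegrable_normc_lty//; exact: integral_ge0.
  rewrite -mulr_sumr ler_pM2l// -lee_fin -sumEFin.
  under eq_bigr do rewrite fineK//.
  rewrite fineK; last by rewrite ge0_fin_numE//; apply: integral_ge0 => w _; rewrite lee_fin.
  rewrite -ge0_integral_sum//; apply: ge0_le_integral => //.
  + by move=> w _; apply: sume_ge0.
  + exact: emeasurable_sum.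
  + exact/measurable_EFinP.
  + by move=> w _; rewrite sumEFin lee_fin.
- rewrite (sE (@complex.Re R)).
  rewrite (_ : series _ = (fun N => cRe (\sum_(0 <= j < N) cintegral nu setT (g j)))).
    by case: gsum.
  by apply/funext => N; rewrite /series /= cRe_sum.
- rewrite (sE (@complex.Im R)).
  rewrite (_ : series _ = (fun N => cIm (\sum_(0 <= j < N) cintegral nu setT (g j)))).
    by case: gsum.
  by apply/funext => N; rewrite /series /= cIm_sum.
Qed.

End trace_of_rank_one_superposition.

(** * Existence of an orthonormal basis *)

Section sqnorm_estimates.
Variables (R : realType) (n : nat).
Local Notation vect := ('rV[R]_n -> R[i]).
Implicit Types (phi psi chi : vect).
Local Notation leb := (lebesgue_rV R n).

Lemma sqnormD phi psi : L2 phi -> L2 psi ->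
  sqnorm (fun x => phi x + psi x) <= 2 * sqnorm phi + 2 * sqnorm psi.
Proof.
move=> l1 l2; rewrite -lee_fin sqnormK; last exact: L2D.
rewrite EFinD !EFinM !sqnormK//.
by apply: energyD; [exact: L2_measurable l1|exact: L2_measurable l2].
Qed.

Lemma sqnormZ z phi : L2 phi -> sqnorm (fun x => z * phi x) = normc z ^+ 2 * sqnorm phi.
Proof.
move=> l1; apply: EFin_inj; rewrite EFinM !sqnormK//; last exact: L2Z.
by rewrite energyZ//; exact: L2_measurable.
Qed.

Lemma sqnorm_split phi chi psi : L2 phi -> L2 psi -> L2 chi ->
  sqnorm (fun x => phi x - chi x) <=
  2 * sqnorm (fun x => phi x - psi x) + 2 * sqnorm (fun x => psi x - chi x).
Proof.
move=> l1 l2 l3; rewrite [X in sqnorm X <= _](_ : _ =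
    (fun x => (phi x - psi x) + (psi x - chi x))).
  by apply: sqnormD; exact: L2B.
by apply/funext => x; rewrite addrA subrK.
Qed.

(** Dominated convergence in the mean. *)
Lemma sqnorm_dominated (psi_ : nat -> vect) phi (u : 'rV[R]_n -> R) :
  (forall k, cmeasurable (psi_ k)) -> cmeasurable phi ->
  (forall x, ccvg (psi_ ^~ x) (phi x)) ->
  measurable_fun setT u -> (forall k x, normc (psi_ k x) <= u x) ->
  (forall x, normc (phi x) <= u x) ->
  (\int[leb]_x (u x ^+ 2)%:E < +oo)%E ->
  forall eps : R, 0 < eps -> exists k, sqnorm (fun x => phi x - psi_ k x) <= eps.
Proof.
move=> mpsi mphi cv mu psiu phiu ul eps eps0.
have u0 x : 0 <= u x by rewrite (le_trans _ (phiu x))// normc_ge0.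
have : (fun k => \int[leb]_x (normc (phi x - psi_ k x) ^+ 2)) @ \oo -->
    \int[leb]_x (0 : R).
  apply: (@Rdominated_convergence _ _ R leb (fun k x => normc (phi x - psi_ k x) ^+ 2)
    (fun=> 0) (fun x => 4 * u x ^+ 2)).
  - by move=> k; apply/measurable_funX/measurable_normc/cmeasurableB.
  - exact: measurable_cst.
  - move=> x; have [c1 c2] := cv x.
    under eq_fun do rewrite normc_sqr !cE.
    have c (a : nat -> R) (l : R) : a @ \oo --> l -> (fun k => (l - a k) ^+ 2) @ \oo --> (0 : R).
      move=> al; have h : (fun k => l - a k) @ \oo --> (0 : R).
        by have := cvgB (cvg_cst (l : R^o)) al; rewrite subrr; apply.
      by have := cvgM h h; rewrite mulr0; apply.
    by have := cvgD (c _ _ c1) (c _ _ c2); rewrite addr0; apply.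
  - by apply: measurable_funM => //; exact: measurable_funX.
  - move=> k x; rewrite ger0_norm ?sqr_ge0//.
    have := sqr_normcD (phi x) (- psi_ k x); rewrite normcN => h.
    apply: le_trans h _.
    have h1 : normc (phi x) ^+ 2 <= u x ^+ 2 by rewrite lerXn2r ?nnegrE ?normc_ge0 ?phiu.
    have h2 : normc (psi_ k x) ^+ 2 <= u x ^+ 2 by rewrite lerXn2r ?nnegrE ?normc_ge0 ?psiu.
    lra.
  - under eq_integral do rewrite EFinM.
    rewrite ge0_integralZl ?lee_fin//.
    + by apply: lte_mul_pinfty; rewrite ?lee_fin.
    + by apply/measurable_EFinP; exact: measurable_funX.
    + by move=> x _; rewrite lee_fin sqr_ge0.
rewrite Rintegral_cst// mul0r => /cvgrPdist_le /(_ _ eps0) [k _ /(_ k (leqnn k))] /=.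
rewrite sub0r normrN => h; exists k; apply: le_trans h; exact: ler_norm.
Qed.

End sqnorm_estimates.

Section rational_boxes.
Variables (R : realType) (n : nat).
Local Notation leb := (lebesgue_rV R n).

Definition rbox (ab : 'rV[rat]_n * 'rV[rat]_n) : set 'rV[R]_n :=
  [set x | forall i, ratr (ab.1 0 i) < x 0 i < ratr (ab.2 0 i)].

Lemma measurable_rbox ab : measurable (rbox ab).
Proof.
rewrite (_ : rbox ab = \bigcap_(i in [set: 'I_n])
    ((fun x : 'rV[R]_n => x 0 i) @^-1` `]ratr (ab.1 0 i), ratr (ab.2 0 i)[%classic)).
  apply: fin_bigcap_measurable; first exact: finite_finset.
  move=> i _; rewrite -[X in measurable X]setTI.
  by apply: coord_rV_measurable => //; exact: measurable_itv.
apply/seteqP; split => x /= h i; first by move=> _; rewrite ?in_itv; exact: h.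
by have := h i I; rewrite ?in_itv.
Qed.

Lemma rbox_setI : setI_closed (range rbox).
Proof.
move=> _ _ [p _ <-] [q _ <-]; exists (\row_i Num.max (p.1 0 i) (q.1 0 i),
  \row_i Num.min (p.2 0 i) (q.2 0 i)) => //.
have ratr_max (a b : rat) : ratr (Num.max a b) = Num.max (ratr a) (ratr b) :> R.
  by case: (leP a b) => h; [rewrite max_r// ler_rat|rewrite max_l// ler_rat ltW].
have ratr_min (a b : rat) : ratr (Num.min a b) = Num.min (ratr a) (ratr b) :> R.
  by case: (leP a b) => h; [rewrite min_l// ler_rat|rewrite min_r// ler_rat ltW].
apply/seteqP; split => x /=.
  move=> h; split => i; have := h i; rewrite /= !mxE ratr_max ratr_min gt_max lt_min;
    by move=> /andP[/andP[? ?] /andP[? ?]]; apply/andP.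
move=> [h1 h2] i; have := h1 i; have := h2 i; rewrite /= !mxE ratr_max ratr_min gt_max lt_min.
by move=> /andP[-> ->] /andP[-> ->].
Qed.

Lemma rbox_generate : @measurable _ 'rV[R]_n = <<s range rbox >>.
Proof.
apply/seteqP; split; last first.
  apply: smallest_sub; first exact: sigma_algebra_measurable.
  by move=> _ [ab _ <-]; exact: measurable_rbox.
apply: smallest_sub; first exact: smallest_sigma_algebra.
move=> U /= oU; have [I ->] := open_rV_bigcup oU; rewrite bigcup_mkcond.
apply: (@countable_bigcupT_measurable _ (g_sigma_algebraType (range rbox))).
  exact: countableP.
case=> q k; case: ifPn => _; last exact: measurable0.
apply: sub_sigma_algebra; exists (\row_i (q 0 i - k.+1%:R^-1), \row_i (q 0 i + k.+1%:R^-1)) => //.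
apply/seteqP; split => x /= h i; have := h i; rewrite !mxE ltr_distlC;
  by rewrite rmorphB rmorphD /= fmorphV rmorph_nat.
Qed.

Lemma rbox_lty ab : (leb (rbox ab) < +oo)%E.
Proof.
have mi (i : 'I_n) : measurable (`]ratr (ab.1 0 i), ratr (ab.2 0 i)[%classic : set R).
  exact: measurable_itv.
have := @ge0_integral_prod_rV R n (fun i => \1_(`]ratr (ab.1 0 i), ratr (ab.2 0 i)[%classic))
  (fun i => fine (lebesgue_measure (`]ratr (ab.1 0 i), ratr (ab.2 0 i)[%classic : set R))).
move=> h; rewrite -(setIT (rbox ab)) -integral_indic//; last exact: measurable_rbox.
rewrite (eq_integral (fun v : 'rV[R]_n =>
   (\prod_i \1_(`]ratr (ab.1 0 i), ratr (ab.2 0 i)[%classic) (v 0 i))%:E)).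
  rewrite h ?ltry// => i.
  rewrite integral_indic// setIT fineK// lebesgue_measure_itv /=.
  by case: ifP.
move=> v _; congr EFin; rewrite indicE.
have [vb|vb] := boolP (v \in rbox ab).
  rewrite big1 // => i _; rewrite indicE mem_set//= in_itv /=.
  by move/set_mem : vb; exact.
have [i vi] : exists i, ~~ (ratr (ab.1 0 i) < v 0 i < ratr (ab.2 0 i)).
  apply/existsP; rewrite -negb_forall; apply: contra vb => /forallP h'.
  by apply/mem_set => i; exact: h'.
rewrite (bigD1 i)//= indicE memNset ?mul0r//= in_itv /=; exact/negP.
Qed.

End rational_boxes.

Arguments rbox R {n} ab.

Section density.
Variables (R : realType) (n : nat).
Local Notation vect := ('rV[R]_n -> R[i]).
Implicit Types (phi psi chi : vect).
Local Notation leb := (lebesgue_rV R n).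

Definition cindic (A : set 'rV[R]_n) : vect := fun x => real_complex R (\1_A x).

Lemma normc_cindic A x : normc (cindic A x) = \1_A x.
Proof. by rewrite normc_real ger0_norm. Qed.

Lemma L2_cindic A : measurable A -> (leb A < +oo)%E -> L2 (cindic A).
Proof.
move=> mA Aoo; apply/L2P; split.
  by apply: cmeasurable_real; exact: measurable_indic.
rewrite /energy (eq_integral (fun x => (\1_A x)%:E)) ?integral_indic ?setIT// => x _.
by rewrite normc_cindic indicE; case: (_ \in _); rewrite ?expr1n ?expr0n.
Qed.

(** Countably many boxes generate the space, which makes the Gram-Schmidt
    process applicable. *)
Inductive box_span : vect -> Prop :=
| box_span0 : box_span (fun=> 0)
| box_spanD phi psi : box_span phi -> box_span psi -> box_span (fun x => phi x + psi x)
| box_spanZ z phi : box_span phi -> box_span (fun x => z * phi x)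
| box_span_box ab : box_span (cindic (rbox R ab)).

Lemma box_span_L2 phi : box_span phi -> L2 phi.
Proof.
elim=> [|? ? _ h1 _ h2|? ? _ h|ab]; [exact: L2_0|exact: L2D|exact: L2Z|].
by apply: L2_cindic; [exact: measurable_rbox|exact: rbox_lty].
Qed.

Definition approximable phi := L2 phi /\
  forall eps : R, 0 < eps -> exists2 psi, box_span psi &
    sqnorm (fun x => phi x - psi x) <= eps.

Lemma sqnorm0 : sqnorm (fun _ : 'rV[R]_n => 0 : R[i]) = 0.
Proof.
rewrite /sqnorm /energy (eq_integral (cst 0%E)) ?integral0// => x _.
by rewrite normc0' expr0n.
Qed.

Lemma approximable_span phi : box_span phi -> approximable phi.
Proof.
move=> sphi; split; first exact: box_span_L2.
move=> eps eps0; exists phi => //; under eq_fun do rewrite subrr.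
by rewrite sqnorm0 ltW.
Qed.

Lemma approximableD phi psi : approximable phi -> approximable psi ->
  approximable (fun x => phi x + psi x).
Proof.
move=> [l1 a1] [l2 a2]; split; first exact: L2D.
move=> eps eps0; have e4 : 0 < eps / 4 by rewrite divr_gt0.
have [g1 s1 h1] := a1 _ e4; have [g2 s2 h2] := a2 _ e4.
exists (fun x => g1 x + g2 x); first exact: box_spanD.
have := sqnormD (L2B l1 (box_span_L2 s1)) (L2B l2 (box_span_L2 s2)) => h.
rewrite [X in sqnorm X <= _](_ : _ = (fun x => (phi x - g1 x) + (psi x - g2 x))).
  by apply: le_trans h _; lra.
by apply/funext => x; rewrite opprD addrACA.
Qed.

Lemma approximableZ z phi : approximable phi -> approximable (fun x => z * phi x).
Proof.
move=> [l1 a1]; split; first exact: L2Z.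
move=> eps eps0; have z0 : 0 < normc z ^+ 2 + 1 by rewrite ltr_wpDl// sqr_ge0.
have e' : 0 < eps / (normc z ^+ 2 + 1) by rewrite divr_gt0.
have [g s h] := a1 _ e'; exists (fun x => z * g x); first exact: box_spanZ.
under eq_fun do rewrite -mulrBr.
rewrite sqnormZ; last by apply: L2B => //; exact: box_span_L2.
rewrite ler_pdivlMr// in h; apply: le_trans h.
by rewrite mulrDr mulr1 mulrC lerDl sqnorm_ge0.
Qed.

Lemma approximable_sum I (r : seq I) (F : I -> vect) :
  (forall i, approximable (F i)) -> approximable (fun x => \sum_(i <- r) F i x).
Proof.
move=> aF; elim: r => [|i r ih].
  by under eq_fun do rewrite big_nil; exact/approximable_span/box_span0.
by under eq_fun do rewrite big_cons; exact: approximableD.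
Qed.

Lemma approximable_limit phi : L2 phi ->
  (forall eps : R, 0 < eps -> exists2 psi, approximable psi &
    sqnorm (fun x => phi x - psi x) <= eps) -> approximable phi.
Proof.
move=> l1 a1; split => // eps eps0; have e4 : 0 < eps / 4 by rewrite divr_gt0.
have [psi [l2 a2] h1] := a1 _ e4; have [g s h2] := a2 _ e4.
exists g => //; apply: le_trans (sqnorm_split l1 l2 (box_span_L2 s)) _; lra.
Qed.

(** Cubes exhaust the space and keep indicators square integrable. *)
Definition cube (m : nat) : set 'rV[R]_n := rbox R (const_mx (- m%:R), const_mx m%:R).

Lemma cubeP m x : cube m x <-> forall i, `|x 0 i| < m%:R.
Proof.
by split => h i; have := h i; rewrite /= !mxE rmorphN /= ratr_nat ltr_norml.
Qed.

Lemma in_cube x : \forall m \near \oo, x \in cube m.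
Proof.
pose M := \sum_i `|x 0 i|.
near=> m; apply/mem_set/cubeP => i.
have xM : `|x 0 i| <= M by rewrite /M (bigD1 i)//= lerDl sumr_ge0.
apply: le_lt_trans xM _.
have M0 : 0 <= M by apply: sumr_ge0.
apply: lt_le_trans (archi_boundP M0) _; rewrite ler_nat.
near: m; exact: nbhs_infty_ge.
Unshelve. all: by end_near. Qed.

Lemma measurable_cube m : measurable (cube m). Proof. exact: measurable_rbox. Qed.

Lemma cube_lty m (A : set 'rV[R]_n) : measurable A -> (leb (A `&` cube m) < +oo)%E.
Proof.
move=> mA; apply: le_lt_trans (rbox_lty R (const_mx (- m%:R), const_mx m%:R)).
by apply: le_measure; rewrite ?inE//; [by apply: measurableI => //; exact: measurable_cube|exact: measurable_cube].
Qed.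

(** Dynkin's argument inside a fixed cube: boxes form a pi-system generating the
    Borel sets, and closure of the span is stable under complements and
    disjoint unions. *)
Lemma approximable_cindic m A : measurable A -> approximable (cindic (A `&` cube m)).
Proof.
move=> mA; have mQ := measurable_cube m.
move: A mA; rewrite rbox_generate.
apply: (@dynkin_induction _ 'rV[R]_n (range (rbox R))).
- exact: rbox_generate.
- exact: rbox_setI.
- by rewrite setTI; apply/approximable_span/box_span_box.
- move=> B GB; have : range (@rbox R n) (B `&` cube m) by apply: rbox_setI => //; eexists.
  by move=> [ab _ <-]; apply/approximable_span/box_span_box.
- move=> A mA aA; have -> : cindic (~` A `&` cube m) =
      (fun x => cindic (cube m) x + (-1) * cindic (A `&` cube m) x).
    apply/funext => x; rewrite mulN1r /cindic -rmorphB; congr (real_complex R _).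
    rewrite !indicE !in_setI in_setC.
    by case: (x \in A); case: (x \in cube m); rewrite /= ?subr0 ?subrr.
  apply: approximableD; first exact/approximable_span/box_span_box.
  exact: approximableZ.
- move=> F mF tF aF.
  have mUF : measurable (\bigcup_k F k) by exact: bigcup_measurable.
  apply: approximable_limit.
    by apply: L2_cindic; [exact: measurableI|exact: cube_lty].
  move=> eps eps0.
  pose psi_ N : vect := fun x => \sum_(0 <= k < N) cindic (F k `&` cube m) x.
  have psiE N x : psi_ N x = cindic (\bigcup_(k < N) F k `&` cube m) x.
    rewrite /psi_ /cindic -rmorph_sum; congr (real_complex R _).
    rewrite indicE in_setI; under eq_bigr do rewrite indicE in_setI.
    case: (x \in cube m); last by rewrite andbF big1// => k _; rewrite andbF.
    under eq_bigr do rewrite andbT.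
    rewrite andbT; have [xU|xU] := boolP (x \in \bigcup_(k < N) F k).
      have [k /= kN Fkx] := set_mem xU.
      rewrite (bigD1_seq k) ?mem_index_iota ?iota_uniq//= mem_set// big1 ?addr0// => j jk.
      rewrite memNset// => Fjx; move/trivIsetP : tF => /(_ j k I I jk) Fjk.
      by have : (F j `&` F k) x by []; rewrite Fjk.
    rewrite big1_seq// => k /=; rewrite mem_index_iota => kN.
    rewrite memNset// => Fkx; move/negP : xU; apply; apply/mem_set; exists k => //.
  have mpsi N : cmeasurable (psi_ N).
    apply: cmeasurable_sum => k; apply: cmeasurable_real; apply: measurable_indic.
    exact: measurableI.
  have [||||||||k hk] := @sqnorm_dominated R n psi_ (cindic (\bigcup_k F k `&` cube m))
      (\1_(cube m)) _ _ _ _ _ _ _ eps.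
  - exact: mpsi.
  - by apply: cmeasurable_real; apply: measurable_indic; exact: measurableI.
  - move=> x; suff h : \forall N \near \oo, psi_ N x = cindic (\bigcup_k F k `&` cube m) x.
      by split; apply: cvg_near_cst; apply: filterS h => N ->.
    have [xU|xU] := pselect ((\bigcup_k F k) x); last first.
      apply: nearW => N; rewrite psiE /cindic !indicE !in_setI; congr (real_complex R (_ && _)%:R).
      rewrite !memNset// => -[k _ Fkx]; apply: xU; exists k => //.
    have [k _ Fkx] := xU; exists k.+1 => // N /= kN.
    rewrite psiE /cindic !indicE !in_setI; congr (real_complex R (_ && _)%:R).
    by rewrite !mem_set//; exists k.
  - exact: measurable_indic.
  - move=> N x; rewrite psiE normc_cindic !indicE in_setI ler_nat.
    by case: (_ \in _); case: (_ \in _).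
  - move=> x; rewrite normc_cindic !indicE in_setI ler_nat.
    by case: (_ \in _); case: (_ \in _).
  - rewrite (eq_integral (fun x => (\1_(cube m) x)%:E)).
      by rewrite integral_indic// setIT; exact: rbox_lty.
    by move=> x _; rewrite indicE; case: (_ \in _); rewrite ?expr1n ?expr0n.
  - exact: eps0.
  - by exists (psi_ k) => //; apply: approximable_sum => j; exact: aF.
Qed.

Import HBNNSimple.

(** Simple functions cut off on cubes increase to the given function. *)
Lemma approximable_ge0 (h : 'rV[R]_n -> R) : (forall x, 0 <= h x) ->
  L2 (fun x => real_complex R (h x)) -> approximable (fun x => real_complex R (h x)).
Proof.
move=> h0 lh; have [mh _] := L2_measurable lh.
have mhE : measurable_fun setT (EFin \o h) by exact/measurable_EFinP.
pose f := nnsfun_approx measurableT mhE.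
have fh k x : f k x <= h x.
  by rewrite -lee_fin /f nnsfun_approxE; apply: (le_approx k) => // y _; rewrite lee_fin.
have fcv x : f ^~ x @ \oo --> h x.
  under eq_fun do rewrite /f nnsfun_approxE.
  rewrite -[h x]/(fine ((EFin \o h) x)); apply: cvg_approx; rewrite ?ltry//.
  by move=> y _; rewrite lee_fin.
apply: approximable_limit => // eps eps0.
pose psi_ m : vect := fun x => real_complex R (f m x) * cindic (cube m) x.
have psiE m : psi_ m = fun x => \sum_(y <- finmap.enum_fset (fset_set (range (f m))))
    real_complex R y * cindic (f m @^-1` [set y] `&` cube m) x.
  apply/funext => x; rewrite /psi_ fimfunE fsbig_finite//= rmorph_sum mulr_suml.
  apply: eq_bigr => y _; rewrite rmorphM -mulrA /cindic -rmorphM; congr (_ * real_complex R _).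
  by rewrite !indicE in_setI -natrM mulnb.
have mpsi m : cmeasurable (psi_ m).
  by apply: cmeasurableM; apply: cmeasurable_real => //; apply: measurable_indic; exact: measurable_cube.
have [|||||k hk] := @sqnorm_dominated R n psi_ (fun x => real_complex R (h x)) h mpsi
    (L2_measurable lh) _ _ _ _ _ eps eps0.
- move=> x; suff c : (fun m => f m x * \1_(cube m) x) @ \oo --> h x.
    split; rewrite /psi_ /cindic.
      by under eq_fun do rewrite -real_complexM cE.
    by under eq_fun do rewrite -real_complexM cE; exact: cvg_cst.
  have c1 : (fun m => \1_(cube m) x : R) @ \oo --> (1 : R).
    apply: cvg_near_cst; near=> m; rewrite indicE; have -> // : x \in cube m.
    by near: m; exact: in_cube.
  by have := cvgM (fcv x) c1; rewrite mulr1; apply.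
- exact: mh.
- move=> m x; rewrite normcM' normc_cindic normc_real ger0_norm//.
  rewrite (le_trans _ (fh m x))// ler_piMr// indicE; by case: (_ \in _).
- by move=> x; rewrite normc_real ger0_norm.
- have := L2_energy lh; congr (_ < _)%E; apply: eq_integral => x _.
  by rewrite normc_real ger0_norm.
exists (psi_ k) => //; rewrite psiE; apply: approximable_sum => y.
by apply: approximableZ; exact: approximable_cindic.
Unshelve. all: by end_near. Qed.

Lemma approximable_L2 phi : L2 phi -> approximable phi.
Proof.
move=> lphi; have [m1 m2] := L2_measurable lphi.
have part (u : 'rV[R]_n -> R) : measurable_fun setT u ->
    (forall x, 0 <= u x) -> (forall x, u x <= normc (phi x)) ->
    approximable (fun x => real_complex R (u x)).
  move=> mu u0 ub; apply: approximable_ge0 => //.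
  apply: (L2_le (u := fun x => normc (phi x))).
  - exact: cmeasurable_real.
  - exact/measurable_normc/L2_measurable.
  - by move=> x; rewrite normc_real ger0_norm.
  - exact: L2_energy.
have abs_part (u : 'rV[R]_n -> R) : measurable_fun setT u ->
    (forall x, `|u x| <= normc (phi x)) ->
    approximable (fun x => real_complex R (u x)).
  move=> mu ub.
  have -> : (fun x => real_complex R (u x)) = (fun x =>
      real_complex R (Num.max (u x) 0) + (-1) * real_complex R (Num.max (- u x) 0)).
    apply/funext => x; rewrite mulN1r -rmorphB; congr (real_complex R _).
    have [h|] := boolP (0 <= u x); last rewrite -ltNge => /ltW h.
      by rewrite (max_l h) max_r ?subr0// oppr_le0.
    by rewrite (max_r h) max_l ?oppr_ge0// sub0r opprK.
  apply: approximableD; last apply: approximableZ; apply: part.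
  - exact: measurable_maxr.
  - by move=> x; rewrite le_max lexx orbT.
  - by move=> x; rewrite ge_max normc_ge0 andbT (le_trans (ler_norm _)).
  - by apply: measurable_maxr => //; exact: measurable_funN.
  - by move=> x; rewrite le_max lexx orbT.
  - by move=> x; rewrite ge_max normc_ge0 andbT (le_trans (ler_norm _))// normrN.
have -> : phi = (fun x => real_complex R (cRe (phi x)) +
    imag 1 * real_complex R (cIm (phi x))).
  by apply/funext => x; apply: complexP; rewrite !cE; ring.
apply: approximableD; last apply: approximableZ; apply: abs_part => // x.
  exact: Re_le_normc.
exact: Im_le_normc.
Qed.

End density.

Section gram_schmidt.
Variables (R : realType) (n : nat).
Local Notation vect := ('rV[R]_n -> R[i]).
Implicit Types (phi psi chi : vect).
Variable c : nat -> vect.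
Hypothesis lc : forall j, L2 (c j).

(** A vector of norm zero is sent to zero, so that dependent vectors are dropped
    by the Gram-Schmidt process. *)
Definition normalize phi : vect := fun x =>
  real_complex R (if sqnorm phi == 0 then 0 else (Num.sqrt (sqnorm phi))^-1) * phi x.

(* [gs_upto N] lists the first N vectors; later entries are junk *)
Fixpoint gs_upto N : nat -> vect :=
  if N is M.+1 then
    fun j => if j == M then
      normalize (fun x => c M x - proj (gs_upto M) (c M) M x) else gs_upto M j
  else fun _ _ => 0.

Definition gs j : vect := gs_upto j.+1 j.
Definition gs_residual j : vect := fun x => c j x - proj gs (c j) j x.

Lemma gs_uptoE N j : (j < N)%N -> gs_upto N j = gs j.
Proof.
elim: N => // N ih; rewrite ltnS leq_eqVlt => /predU1P[->//|jN].
by rewrite /= (ltn_eqF jN) ih.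
Qed.

Lemma gsE j : gs j = normalize (gs_residual j).
Proof.
rewrite /gs /= eqxx; congr normalize; apply/funext => x.
congr (_ - _); apply: eq_big_nat => k /andP[_ kj].
by rewrite gs_uptoE.
Qed.

Let dom j := sqnorm (gs_residual j) != 0.

Lemma L2_gs j : L2 (gs j).
Proof.
elim/ltn_ind: j => j ih; rewrite gsE; apply: L2Z; apply: L2B => //.
rewrite (_ : proj _ _ _ = (fun x => \sum_(0 <= k < j)
   inner (c j) (gs_upto j k) * gs_upto j k x)); last first.
  by apply/funext => x; apply: eq_big_nat => k /andP[_ kj]; rewrite gs_uptoE.
apply: L2_sum => k; apply: L2Z.
have [kj|jk] := ltnP k j; first by rewrite gs_uptoE//; exact: ih.
rewrite (_ : gs_upto j k = fun=> 0); first exact: L2_0.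
elim: (j) jk => //= i hi ik; rewrite gtn_eqF// hi// ltnW//.
Qed.

Lemma L2_gs_residual j : L2 (gs_residual j).
Proof. by apply: L2B => //; apply: L2_sum => k; apply: L2Z; exact: L2_gs. Qed.

Lemma padded_gs : padded_orthonormal dom gs.
Proof.
have inner0r phi : L2 phi -> inner phi (fun=> 0) = 0.
  by move=> l1; rewrite innerC ?inner0l ?conjc0//; exact: L2_0.
have e0 j : ~~ dom j -> gs j = fun=> 0.
  by rewrite negbK => r0; rewrite gsE /normalize r0; apply/funext => x; rewrite mul0r.
have norm1 j : inner (gs j) (gs j) = (dom j)%:R.
  case dj : (dom j); last by rewrite e0 ?dj// inner0l.
  rewrite inner_self; last exact: L2_gs.
  rewrite gsE sqnormZ; last exact: L2_gs_residual.
  rewrite normc_real (negbTE dj) real_normK ?num_real// exprVn sqr_sqrtr ?sqnorm_ge0//.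
  by rewrite mulVf.
have orth j : forall k, (k < j)%N -> inner (gs j) (gs k) = 0.
  elim/ltn_ind: j => j ih k kj; rewrite gsE innerZl; [|exact: L2_gs_residual|exact: L2_gs].
  rewrite /gs_residual innerBl//; [|by apply: L2_sum => i; apply: L2Z; exact: L2_gs|exact: L2_gs].
  rewrite /proj inner_suml; [|exact: L2_gs|exact: L2_gs].
  rewrite (bigD1_seq k) ?mem_index_iota ?iota_uniq//= norm1.
  rewrite big1_seq ?addr0 => [|i /andP[ik]]; last first.
    rewrite mem_index_iota => /= ij; move: ik; rewrite neq_ltn => /orP[ik|ki].
      have -> : inner (gs i) (gs k) = conjc (inner (gs k) (gs i)).
        by apply: innerC; exact: L2_gs.
      by rewrite ih ?conjc0 ?mulr0.
    by rewrite ih ?mulr0.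
  case dk : (dom k); first by rewrite mulr1 subrr mulr0.
  by rewrite e0 ?dk// inner0r// mul0r subrr mulr0.
split; [exact: L2_gs| |exact: e0] => j k.
case: (ltngtP j k) => jk.
- rewrite innerC; [|exact: L2_gs|exact: L2_gs].
  by rewrite orth// conjc0.
- by rewrite orth.
- by rewrite jk norm1.
Qed.

(** The residual of [c j] has been normalised and added to the system at step
    [j], hence nothing of [c j] is left over. *)
Lemma gs_captures j N : (j < N)%N -> sqnorm (fun x => c j x - proj gs (c j) N x) = 0.
Proof.
have one := padded_gs.
have h0 : sqnorm (fun x => c j x - proj gs (c j) j.+1 x) = 0.
  apply/eqP; rewrite eq_le sqnorm_ge0 andbT.
  pose b k := if k == j then real_complex R (Num.sqrt (sqnorm (gs_residual j)))
              else inner (c j) (gs k).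
  have bE x : c j x - \sum_(0 <= k < j.+1) b k * gs k x =
      gs_residual j x - real_complex R (Num.sqrt (sqnorm (gs_residual j))) * gs j x.
    rewrite big_nat_recr//= {2}/b eqxx opprD addrA; congr (_ - _); congr (_ - _).
    by apply: eq_big_nat => k /andP[_ kj]; rewrite /b (ltn_eqF kj).
  apply: le_trans (proj_best one b j.+1 (lc j)) _.
  under eq_fun do rewrite bE.
  have [r0|r0] := eqVneq (sqnorm (gs_residual j)) 0.
    rewrite (_ : (fun x => _) = gs_residual j) ?r0//.
    by apply/funext => x; rewrite sqrtr0 mul0r subr0.
  rewrite (_ : (fun x => _) = fun=> 0) ?sqnorm0//.
  apply/funext => x; rewrite gsE /normalize (negbTE r0) mulrA -rmorphM mulfV ?mul1r ?subrr//.
  by rewrite gt_eqF// sqrtr_gt0 lt_neqAle eq_sym r0 sqnorm_ge0.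
move=> jN; apply/eqP; rewrite eq_le sqnorm_ge0 andbT -{1}h0.
rewrite (sqnorm_proj one)// (sqnorm_proj one)// lerD2l lerN2.
rewrite (big_cat_nat (n := j.+1) (p := N))//= lerDl.
by apply: sumr_ge0 => k _; exact: sqr_ge0.
Qed.

End gram_schmidt.

Section orthonormal_basis_exists.
Variables (R : realType) (n : nat).
Local Notation vect := ('rV[R]_n -> R[i]).
Implicit Types (phi psi chi : vect).

(** Traces are determined by testing against every orthonormal basis, so they
    are unique only because a basis exists: the Gram-Schmidt process applied to
    the indicators of rational boxes. *)
Lemma exists_orthonormal_basis :
  exists (D : set nat) (e : nat -> vect), orthonormal_basis D e.
Proof.
pose c j : vect := if unpickle j is Some ab then cindic (rbox R ab) else fun=> 0.
have lc j : L2 (c j).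
  rewrite /c; case: unpickle => [ab|]; last exact: L2_0.
  exact/box_span_L2/box_span_box.
have one := padded_gs lc.
have captured psi : box_span psi -> exists N0, forall N, (N0 <= N)%N ->
    sqnorm (fun x => psi x - proj (gs c) psi N x) = 0.
  have lg := L2_gs lc.
  have lp phi N : L2 phi -> L2 (fun x => phi x - proj (gs c) phi N x).
    by move=> l1; apply: L2B => //; apply: L2_sum => k; exact: L2Z.
  elim => [|phi chi s1 [N1 h1] s2 [N2 h2]|z phi s1 [N1 h1]|ab].
  - exists 0%N => N _; rewrite -[RHS](@sqnorm0 R n); congr sqnorm; apply/funext => x.
    by rewrite /proj big1 ?subr0// => j _; rewrite inner0l mul0r.
  - have l1 := box_span_L2 s1; have l2 := box_span_L2 s2.
    exists (maxn N1 N2) => N; rewrite geq_max => /andP[/h1 e1 /h2 e2].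
    apply/eqP; rewrite eq_le sqnorm_ge0 andbT.
    have := sqnormD (lp _ N l1) (lp _ N l2); rewrite e1 e2 mulr0 addr0.
    congr (_ <= _); congr sqnorm; apply/funext => x; rewrite addrACA -opprD /proj -big_split.
    by congr (_ - _); apply: eq_bigr => j _ /=; rewrite innerDl// mulrDl.
  - have l1 := box_span_L2 s1.
    exists N1 => N /h1 e1; rewrite (_ : (fun x => _) =
        (fun x => z * (phi x - proj (gs c) phi N x))).
      by rewrite sqnormZ ?e1 ?mulr0//; exact: lp.
    apply/funext => x; rewrite mulrBr /proj mulr_sumr; congr (_ - _).
    by apply: eq_bigr => j _; rewrite innerZl// mulrA.
  - exists (pickle ab).+1 => N h.
    have -> : cindic (rbox R ab) = c (pickle ab) by rewrite /c pickleK.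
    exact: gs_captures.
exists [set j | sqnorm (gs_residual c j) != 0], (gs c).
apply: padded_orthonormal_basis => // phi lphi eps eps0.
have [_ aphi] := approximable_L2 lphi.
have e2 : 0 < eps / 2 by rewrite divr_gt0.
have [psi spsi hpsi] := aphi _ e2; have [N0 hN0] := captured _ spsi.
have lpsi := box_span_L2 spsi.
exists N0 => // N /= N0N.
apply: le_trans (proj_best one (fun j => inner psi (gs c j)) N lphi) _.
apply: le_trans (sqnorm_split lphi lpsi _) _.
  by apply: L2_sum => k; apply: L2Z; exact: L2_gs.
by have := hN0 _ N0N; rewrite /proj => ->; lra.
Qed.

Lemma trace_unique (S : vect -> vect) c : has_trace S c -> trace S = c.
Proof.
move=> hc; have [D [e one]] := exists_orthonormal_basis.
apply: xget_unique => // c' hc'.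
have [_ r1 i1] := hc D e one; have [_ r2 i2] := hc' D e one.
by apply: complexP; [exact: cvg_unique r2 r1|exact: cvg_unique i2 i1].
Qed.

End orthonormal_basis_exists.

(** * Weak integrals and the Schroedinger representation *)

Section weighted_jensen.
Context d (T : measurableType d) (R : realType) (nu : {measure set T -> \bar R}).
Variables (al B : T -> R).
Hypotheses (mal : measurable_fun setT al) (mB : measurable_fun setT B).
Hypotheses (al0 : forall w, 0 <= al w) (B0 : forall w, 0 <= B w).
Hypotheses (ial : (\int[nu]_w (al w)%:E < +oo)%E)
           (iB : (\int[nu]_w (al w * B w ^+ 2)%:E < +oo)%E).

Let malB : measurable_fun setT (fun w => al w * B w).
Proof. exact: measurable_funM. Qed.
Let malB2 : measurable_fun setT (fun w => al w * B w ^+ 2).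
Proof. by apply: measurable_funM => //; exact: measurable_funX. Qed.

Lemma weighted_mean_lty : (\int[nu]_w (al w * B w)%:E < +oo)%E.
Proof.
apply: (@le_lt_trans _ _ (\int[nu]_w ((al w)%:E + (al w * B w ^+ 2)%:E))%E).
  apply: ge0_le_integral => //.
  - by move=> w _; rewrite lee_fin mulr_ge0.
  - exact/measurable_EFinP.
  - by apply: emeasurable_funD; exact/measurable_EFinP.
  - move=> w _; rewrite -EFinD lee_fin -{2}(mulr1 (al w)) -mulrDr ler_wpM2l//.
    have := sqr_ge0 (B w - 1); rewrite sqrrB1; have := B0 w; lra.
rewrite ge0_integralD//; try (by apply/measurable_EFinP).
- by rewrite lte_add_pinfty.
- by move=> w _; rewrite lee_fin.
- by move=> w _; rewrite lee_fin mulr_ge0// sqr_ge0.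
Qed.

Let fin_int (u : T -> R) : (forall w, 0 <= u w) -> (\int[nu]_w (u w)%:E < +oo)%E ->
  (fine (\int[nu]_w (u w)%:E))%:E = (\int[nu]_w (u w)%:E)%E.
Proof.
by move=> u0 ul; rewrite fineK// ge0_fin_numE//; apply: integral_ge0 => w _; rewrite lee_fin.
Qed.

(** Integrating [2 c al B <= al B^2 + c^2 al] and choosing [c] gives the
    Cauchy-Schwarz inequality for the measure of density [al], up to the
    harmless [1] that avoids a division by zero. *)
Lemma weighted_mean_sqr :
  fine (\int[nu]_w (al w * B w)%:E) ^+ 2 <=
  (fine (\int[nu]_w (al w)%:E) + 1) * fine (\int[nu]_w (al w * B w ^+ 2)%:E).
Proof.
set m := fine (\int[nu]_w (al w * B w)%:E); set a := fine (\int[nu]_w (al w)%:E).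
set b := fine _.
have a0 : 0 <= a by apply: fine_ge0; apply: integral_ge0 => w _; rewrite lee_fin.
have m0 : 0 <= m by apply: fine_ge0; apply: integral_ge0 => w _; rewrite lee_fin mulr_ge0.
have a1 : 0 < a + 1 by rewrite ltr_wpDl.
(* [c] minimises [c^2 (a + 1) - 2 c m] *)
pose c := m / (a + 1); have c0 : 0 <= c by rewrite divr_ge0// ltW.
have cm : c * (a + 1) = m by rewrite /c divfK// gt_eqF.
clearbody c.
have key : 2 * c * m <= b + c ^+ 2 * a.
  rewrite -lee_fin EFinD (EFinM (2 * c)) (EFinM (c ^+ 2)) /m /a /b !fin_int//; last 3 first.
  - by move=> w; rewrite mulr_ge0// sqr_ge0.
  - by move=> w; rewrite mulr_ge0.
  - exact: weighted_mean_lty.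
  rewrite -!ge0_integralZl ?lee_fin ?mulr_ge0 ?sqr_ge0//;
    try (by move=> w _; rewrite lee_fin ?mulr_ge0); try exact/measurable_EFinP.
  rewrite -ge0_integralD//;
    try (by move=> w _; rewrite -?EFinM lee_fin; do ?[exact: sqr_ge0|apply: mulr_ge0]);
    try (by apply: emeasurable_funM => //; exact/measurable_EFinP);
    try exact/measurable_EFinP.
  apply: ge0_le_integral => //.
  - by move=> w _; rewrite -EFinM lee_fin; do ?apply: mulr_ge0.
  - by apply: emeasurable_funM => //; exact/measurable_EFinP.
  - by apply: emeasurable_funD; [|apply: emeasurable_funM => //]; exact/measurable_EFinP.
  - move=> w _; rewrite -!EFinM -EFinD lee_fin.
    have := mulr_ge0 (al0 w) (sqr_ge0 (B w - c)); rewrite sqrrB; lra.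
have : 0 <= (a + 1) * (b + c ^+ 2 * a - 2 * c * m).
  by rewrite mulr_ge0 ?(ltW a1)// subr_ge0.
have -> : (a + 1) * (b + c ^+ 2 * a - 2 * c * m) =
   (a + 1) * b + c * a * (c * (a + 1)) - 2 * (c * (a + 1)) * m by ring.
rewrite cm => h; have ca : c * a <= m by rewrite -cm ler_wpM2l// lerDl.
have := ler_wpM2r m0 ca; rewrite expr2; lra.
Qed.

End weighted_jensen.

Section ae_cintegral.
Context d (T : measurableType d) (R : realType) (nu : {measure set T -> \bar R}).

Lemma ae_cintegral (g h : T -> R[i]) : cmeasurable g -> cmeasurable h ->
  {ae nu, forall x, g x = h x} -> cintegral nu setT g = cintegral nu setT h.
Proof.
move=> [g1 g2] [h1 h2] gh; apply: complexP; rewrite ?cRe_int ?cIm_int;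
  congr fine; apply: ae_eq_integral => //; try exact/measurable_EFinP;
  by apply: filterS gh => x /= ->.
Qed.

End ae_cintegral.

Section weak_integrals.
Context d (T : measurableType d) (R : realType) (n : nat).
Variable nu : {sigma_finite_measure set T -> \bar R}.
Local Notation vect := ('rV[R]_n -> R[i]).
Local Notation leb := (lebesgue_rV R n).
Variables (F : T -> vect) (al : T -> R) (B : T -> 'rV[R]_n -> R) (C : R).
Hypotheses (mF : cmeasurable (fun p : T * 'rV[R]_n => F p.1 p.2))
  (mal : measurable_fun setT al)
  (mB : measurable_fun setT (fun p : T * 'rV[R]_n => B p.1 p.2)).
Hypotheses (al0 : forall w, 0 <= al w) (B0 : forall w xi, 0 <= B w xi).
Hypotheses (FB : forall w xi, normc (F w xi) <= al w * B w xi).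
Hypotheses (BC : forall w, (\int[leb]_xi (B w xi ^+ 2)%:E <= C%:E)%E).
Hypotheses (ial : (\int[nu]_w (al w)%:E < +oo)%E).

Let chi : vect := fun xi => cintegral nu setT (fun w => F w xi).

Let mswap : measurable_fun setT (fun p : 'rV[R]_n * T => (p.2, p.1)).
Proof. exact: measurable_fun_pair. Qed.

Let ial0 : (0 <= \int[nu]_w (al w)%:E)%E.
Proof. by apply: integral_ge0 => w _; rewrite lee_fin. Qed.

Let mchi : cmeasurable chi.
Proof.
apply: (cmeasurable_cintegral nu (g := fun p => F p.2 p.1)).
exact: cmeasurable_comp mF mswap.
Qed.

Let mal1 : measurable_fun setT (fun p : T * 'rV[R]_n => al p.1).
Proof. exact: measurableT_comp mal _. Qed.

Let mass p : R := al p.1 * B p.1 p.2 ^+ 2.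
Let mmass : measurable_fun setT (mass : T * 'rV[R]_n -> R).
Proof. by apply: measurable_funM => //; exact: measurable_funX. Qed.
Let mass0 p : 0 <= mass p.
Proof. by rewrite mulr_ge0// sqr_ge0. Qed.

Let C0 : (forall w : T, 0 <= C).
Proof.
move=> w; rewrite -lee_fin; apply: le_trans (BC w).
by apply: integral_ge0 => x _; rewrite lee_fin sqr_ge0.
Qed.

Let mass_lty : (\int[leb]_xi \int[nu]_w (mass (w, xi))%:E < +oo)%E.
Proof.
have mE : measurable_fun setT (fun p => (mass p)%:E) by exact/measurable_EFinP.
rewrite -(fubini_tonelli (fun p => (mass p)%:E)) //.
have mBw w : measurable_fun setT (fun xi => (B w xi ^+ 2)%:E).
  apply/measurable_EFinP/measurable_funX.
  exact: (measurableT_comp mB (pair1_measurable w)).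
apply: (@le_lt_trans _ _ (\int[nu]_w ((al w)%:E * `|C|%:E))%E).
  apply: ge0_le_integral => //.
  - by move=> w _; apply: integral_ge0 => x _; rewrite lee_fin.
  - exact: (measurable_fun_fubini_tonelli_F (m2 := leb) (fun p => (mass p)%:E)).
  - by apply: emeasurable_funM => //; exact/measurable_EFinP.
  - move=> w _; rewrite /mass /=; under eq_integral do rewrite EFinM.
    rewrite ge0_integralZl ?lee_fin//; last by move=> x _; rewrite lee_fin sqr_ge0.
    by rewrite lee_wpmul2l ?lee_fin// (le_trans (BC w))// lee_fin ler_norm.
rewrite ge0_integralZr ?lee_fin//.
- by rewrite lte_mul_pinfty ?ge0_fin_numE ?ltry.
- exact/measurable_EFinP.
- by move=> w _; rewrite lee_fin.
Qed.

Let mass_xi xi := (\int[nu]_w (mass (w, xi))%:E)%E.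

Let mBx xi : measurable_fun setT (fun w => B w xi).
Proof. exact: (measurableT_comp mB (pair2_measurable xi)). Qed.
Let mFx xi : cmeasurable (fun w => F w xi).
Proof. exact: (cmeasurable_comp mF (pair2_measurable xi)). Qed.

Let chi_le xi : ((normc (chi xi) ^+ 2)%:E <=
  (4 * (fine (\int[nu]_w (al w)%:E) + 1))%:E * mass_xi xi)%E.
Proof.
have a0 : 0 <= fine (\int[nu]_w (al w)%:E).
  by apply: fine_ge0; apply: integral_ge0 => w _; rewrite lee_fin.
have [moo|] := ltP (mass_xi xi) +oo%E; last first.
  by rewrite leye_eq => /eqP ->; rewrite gt0_muley ?leey// lte_fin mulr_gt0// ltr_wpDl.
have m0 : (0 <= mass_xi xi)%E by apply: integral_ge0 => w _; rewrite lee_fin.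
have lt1 := weighted_mean_lty mal (mBx xi) al0 (B0 ^~ xi) ial moo.
have := weighted_mean_sqr mal (mBx xi) al0 (B0 ^~ xi) ial moo.
have := normc_cintegral_le (mFx xi) (measurable_funM mal (mBx xi)) (FB ^~ xi) lt1.
rewrite -/(chi xi); set m := fine _; set M := fine (\int[nu]_w (al w * _)%:E) => h1 h2.
have -> : mass_xi xi = M%:E by rewrite fineK// ge0_fin_numE.
rewrite -EFinM lee_fin -mulrA.
apply: (@le_trans _ _ ((2 * m) ^+ 2)).
  by rewrite lerXn2r ?nnegrE ?normc_ge0// (le_trans (normc_ge0 _) h1).
by rewrite exprMn -natrX ler_pM2l.
Qed.

Lemma L2_weak_integral : L2 chi.
Proof.
apply/L2P; split => //.
have mm : measurable_fun setT mass_xi.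
  apply: (measurable_fun_fubini_tonelli_G (m1 := nu) (fun p => (mass p)%:E)) => //.
  exact/measurable_EFinP.
have a0 : 0 <= fine (\int[nu]_w (al w)%:E).
  by apply: fine_ge0; apply: integral_ge0 => w _; rewrite lee_fin.
have k0 : 0 <= 4 * (fine (\int[nu]_w (al w)%:E) + 1) by rewrite mulr_ge0// addr_ge0.
have m0 xi : (0 <= mass_xi xi)%E by apply: integral_ge0 => w _; rewrite lee_fin.
apply: (@le_lt_trans _ _ (\int[leb]_xi
    ((4 * (fine (\int[nu]_w (al w)%:E) + 1))%:E * mass_xi xi))%E).
  apply: ge0_le_integral => //.
  - by move=> x _; rewrite lee_fin sqr_ge0.
  - exact: measurable_sqr_normc.
  - exact: emeasurable_funM.
rewrite ge0_integralZl ?lee_fin//.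
by apply: lte_mul_pinfty; rewrite ?lee_fin.
Qed.

Section pairing.
Variables (psi : vect) (lpsi : L2 psi).

Let G (p : T * 'rV[R]_n) := F p.1 p.2 * conjc (psi p.2).

Let mG : cmeasurable G.
Proof.
apply: cmeasurableM => //; apply: cmeasurable_conj.
exact: (cmeasurable_comp (L2_measurable lpsi)).
Qed.

Let iG : cintegrable (nu \x leb)%E setT G.
Proof.
have mpsi := L2_measurable lpsi.
apply: (cintegrable_fibered (a := al)
  (u := fun p : T * 'rV[R]_n => B p.1 p.2 ^+ 2 + normc (psi p.2) ^+ 2)
  (C := C + sqnorm psi)) => //.
- apply: measurable_funD; apply: measurable_funX => //.
  by apply: measurable_normc; exact: (cmeasurable_comp mpsi).
- by move=> p; rewrite addr_ge0// sqr_ge0.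
- move=> w xi; rewrite /G normcM' normc_conj /=.
  apply: (@le_trans _ _ (al w * (B w xi * normc (psi xi)))).
    by rewrite mulrA ler_wpM2r ?normc_ge0.
  by rewrite ler_wpM2l// mulr_le_sqrD ?normc_ge0.
- move=> w /=; under eq_integral do rewrite EFinD.
  have mBw : measurable_fun setT (fun xi => (B w xi ^+ 2)%:E).
    apply/measurable_EFinP/measurable_funX.
    exact: (measurableT_comp mB (pair1_measurable w)).
  rewrite ge0_integralD//; try by move=> x _; rewrite lee_fin sqr_ge0.
  + by rewrite EFinD sqnormK// leeD.
  + exact: measurable_sqr_normc.
Qed.

Lemma inner_weak_integral :
  cintegrable nu setT (fun w => inner (F w) psi) /\
  inner chi psi = cintegral nu setT (fun w => inner (F w) psi).
Proof.
split; first exact: (cfubini iG).1.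
rewrite /inner -[RHS](cfubini_swap (m1 := leb) (m2 := nu) (g := fun p => G (p.2, p.1))).
  apply: ae_cintegral.
  - by apply: cmeasurableM => //; apply: cmeasurable_conj; exact: L2_measurable.
  - apply: (cmeasurable_cintegral nu (g := fun p => G (p.2, p.1))).
    exact: cmeasurable_comp mG mswap.
  - have mm : measurable_fun setT mass_xi.
      apply: (measurable_fun_fubini_tonelli_G (m1 := nu) (fun p => (mass p)%:E)) => //.
      exact/measurable_EFinP.
    have im : leb.-integrable setT mass_xi.
      apply/integrableP; split => //; apply: le_lt_trans mass_lty.
      have m0 x : (0 <= mass_xi x)%E by apply: integral_ge0 => w _; rewrite lee_fin.
      by under eq_integral do rewrite gee0_abs//.
    apply: filterS (integrable_ae measurableT im) => xi /(_ I) fxi.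
    have moo : (mass_xi xi < +oo)%E.
      by move: fxi; rewrite ge0_fin_numE//; apply: integral_ge0 => w _; rewrite lee_fin.
    have lt1 := weighted_mean_lty mal (mBx xi) al0 (B0 ^~ xi) ial moo.
    have iF := cintegrable_le (mFx xi) (measurable_funM mal (mBx xi)) (FB ^~ xi) lt1.
    by rewrite mulrC -cintegralZ//; apply: eq_cintegral => w _; rewrite mulrC.
exact: cintegrable_swap iG.
Qed.

End pairing.

(** A superposition of vectors with integrable weights exists pointwise almost
    everywhere, and this pointwise integral is the weak integral. *)
Lemma weak_integral_spec : is_weak_integral nu F (weak_integral nu F).
Proof.
have ex : exists c, [set c | is_weak_integral nu F c] c.
  by exists chi; split; [exact: L2_weak_integral|exact: inner_weak_integral].
exact: (xgetPex (fun=> 0) ex).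
Qed.

End weak_integrals.

Section schroedinger.
Variables (R : realType) (n : nat).
Local Notation vect := ('rV[R]_n -> R[i]).
Local Notation leb := (lebesgue_rV R n).
Implicit Types (phi psi : vect) (p q : heisenberg R n).

Lemma measurable_hx d (T : measurableType d) (f : T -> heisenberg R n) :
  measurable_fun setT f -> measurable_fun setT (fun x => hx (f x)).
Proof. by move=> mf; do 2 apply: measurable_fun_lsubmx. Qed.

Lemma measurable_hy d (T : measurableType d) (f : T -> heisenberg R n) :
  measurable_fun setT f -> measurable_fun setT (fun x => hy (f x)).
Proof. by move=> mf; apply: measurable_fun_rsubmx; apply: measurable_fun_lsubmx. Qed.

Lemma measurable_ht d (T : measurableType d) (f : T -> heisenberg R n) :
  measurable_fun setT f -> measurable_fun setT (fun x => ht (f x)).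
Proof. by move=> mf; apply: measurable_fun_coord; apply: measurable_fun_rsubmx. Qed.

Lemma cmeasurable_rho d (T : measurableType d) (lambda : R)
    (p : T -> heisenberg R n) (xi : T -> 'rV[R]_n) phi : cmeasurable phi ->
  measurable_fun setT p -> measurable_fun setT xi ->
  cmeasurable (fun w => rho lambda (p w) phi (xi w)).
Proof.
move=> mphi mp mxi; have mx := measurable_hx mp; have my := measurable_hy mp.
apply: cmeasurableM.
  apply: cmeasurable_expi; apply: measurable_funM => //.
  apply: measurable_funD; first apply: measurable_funD.
  - exact: measurable_ht.
  - exact: measurable_fun_dot.
  - by apply: measurable_funM => //; exact: measurable_fun_dot.
by apply: (cmeasurable_comp mphi); exact: measurable_fun_rVD.
Qed.

Lemma normc_rho (lambda : R) p phi xi : normc (rho lambda p phi xi) = normc (phi (xi + hy p)).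
Proof. by rewrite normcM' normc_expi mul1r. Qed.

Lemma energy_rho (lambda : R) p phi : cmeasurable phi ->
  energy (rho lambda p phi) = energy phi.
Proof.
move=> mphi; rewrite /energy [RHS](ge0_integral_rV_shift (hy p)).
- by apply: eq_integral => x _; rewrite normc_rho.
- exact: measurable_sqr_normc.
- by move=> x; rewrite lee_fin sqr_ge0.
Qed.

Lemma L2_rho (lambda : R) p phi : L2 phi -> L2 (rho lambda p phi).
Proof.
move=> lphi; have mphi := L2_measurable lphi; apply/L2P; split.
  exact: cmeasurable_rho.
by rewrite energy_rho//; exact: L2_energy.
Qed.

Lemma dotC (u v : 'rV[R]_n) : dot u v = dot v u.
Proof. by apply: eq_bigr => i _; rewrite mulrC. Qed.
Lemma dotDr (u v w : 'rV[R]_n) : dot u (v + w) = dot u v + dot u w.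
Proof. by rewrite -big_split; apply: eq_bigr => i _; rewrite mxE mulrDr. Qed.
Lemma dotZr (u v : 'rV[R]_n) a : dot u (a *: v) = a * dot u v.
Proof. by rewrite mulr_sumr; apply: eq_bigr => i _; rewrite mxE mulrCA. Qed.
Lemma dotNr (u v : 'rV[R]_n) : dot u (- v) = - dot u v.
Proof. by rewrite -scaleN1r dotZr mulN1r. Qed.
Lemma dotNl (u v : 'rV[R]_n) : dot (- u) v = - dot u v.
Proof. by rewrite dotC dotNr dotC. Qed.
Lemma dotBr (u v w : 'rV[R]_n) : dot u (v - w) = dot u v - dot u w.
Proof. by rewrite dotDr dotNr. Qed.

Lemma hxN p : hx (- p) = - hx p. Proof. by apply: rV_eqP => j; rewrite !mxE. Qed.
Lemma hyN p : hy (- p) = - hy p. Proof. by apply: rV_eqP => j; rewrite !mxE. Qed.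
Lemma htN p : ht (- p) = - ht p. Proof. by rewrite /ht !mxE. Qed.

(** The inverse of [p] in the Heisenberg group is [- p]. *)
Lemma inner_rho (lambda : R) p phi psi : L2 phi -> L2 psi ->
  inner (rho lambda p phi) psi = inner phi (rho lambda (- p) psi).
Proof.
move=> l1 l2; rewrite /inner (cintegral_rV_shift (- hy p)); last first.
  by apply: cmeasurableM; [exact/L2_measurable/L2_rho|
    exact/cmeasurable_conj/L2_measurable].
apply: eq_cintegral => x _; rewrite /rho hyN hxN htN subrK conjcM conj_expi.
rewrite mulrCA mulrA; congr (expi _ * _ * _).
by rewrite dotBr !dotNl !dotNr -mulrN; congr (_ * _); lra.
Qed.

Section representation.
Variable lambda : R.

Lemma fourier_spec (f : heisenberg R n -> R[i]) phi : cmeasurable f ->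
  (\int[lebesgue_rV R (n + n + 1)]_p (normc (f p))%:E < +oo)%E -> L2 phi ->
  is_weak_integral (lebesgue_rV R (n + n + 1))
    (fun p xi => f p * rho lambda p phi xi) (fourier f lambda phi).
Proof.
move=> mf fi lphi; have mphi := L2_measurable lphi.
have mr : cmeasurable (fun p : heisenberg R n * 'rV[R]_n => rho lambda p.1 phi p.2).
  exact: cmeasurable_rho.
apply: (weak_integral_spec (al := fun p => normc (f p))
   (B := fun p xi => normc (rho lambda p phi xi)) (C := sqnorm phi)) => //.
- by apply: cmeasurableM => //; exact: cmeasurable_comp mf _.
- exact: measurable_normc.
- exact: (measurable_normc mr).
- by move=> p; exact: normc_ge0.
- by move=> p xi; exact: normc_ge0.
- by move=> p xi; rewrite normcM'.
- by move=> p; rewrite -/(energy _) energy_rho// sqnormK.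
Qed.

Variable mu : {finite_measure set (heisenberg R n) -> \bar R}.

Let mu1_lty : (\int[mu]_p (1:R)%:E < +oo)%E.
Proof. by rewrite integral_cst// mul1e -ge0_fin_numE//; exact: fin_num_measure. Qed.

Lemma fourier_measure_spec phi : L2 phi ->
  is_weak_integral mu (fun p => rho lambda p phi) (fourier_measure mu lambda phi).
Proof.
move=> lphi; have mphi := L2_measurable lphi.
have mr : cmeasurable (fun p : heisenberg R n * 'rV[R]_n => rho lambda p.1 phi p.2).
  exact: cmeasurable_rho.
apply: (weak_integral_spec (al := fun p => 1)
   (B := fun p xi => normc (rho lambda p phi xi)) (C := sqnorm phi)) => //.
- exact: (measurable_normc mr).
- by move=> p xi; exact: normc_ge0.
- by move=> p xi; rewrite mul1r.
- by move=> p; rewrite -/(energy _) energy_rho// sqnormK.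
Qed.

(** As [rho lambda p] is unitary with inverse [rho lambda (- p)], the adjoint is
    the weak integral of [rho lambda (- p)]. *)
Lemma adjoint_fourier_measure_spec phi : L2 phi ->
  let chi := adjoint (fourier_measure mu lambda) phi in
  L2 chi /\ forall psi, L2 psi ->
    inner (fourier_measure mu lambda psi) phi = inner psi chi.
Proof.
move=> lphi chi; have mphi := L2_measurable lphi.
have mN : measurable_fun setT (fun p : heisenberg R n * 'rV[R]_n => - p.1).
  by apply: measurable_fun_rVN.
have mr : cmeasurable (fun p : heisenberg R n * 'rV[R]_n => rho lambda (- p.1) phi p.2).
  exact: cmeasurable_rho.
have [l1 w1] : is_weak_integral mu (fun p => rho lambda (- p) phi)
    (weak_integral mu (fun p => rho lambda (- p) phi)).
  apply: (weak_integral_spec (al := fun p => 1)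
     (B := fun p xi => normc (rho lambda (- p) phi xi)) (C := sqnorm phi)) => //.
  - exact: (measurable_normc mr).
  - by move=> p xi; exact: normc_ge0.
  - by move=> p xi; rewrite mul1r.
  - by move=> p; rewrite -/(energy _) energy_rho// sqnormK.
have ex : exists c, [set c | L2 c /\ forall psi, L2 psi ->
    inner (fourier_measure mu lambda psi) phi = inner psi c] c.
  exists (weak_integral mu (fun p => rho lambda (- p) phi)); split => // psi lpsi.
  have [_ w2] := fourier_measure_spec lpsi.
  rewrite (w2 _ lphi).2 innerC// (w1 _ lpsi).2 -cintegral_conj; last exact: (w1 _ lpsi).1.
  apply: eq_cintegral => p _; rewrite inner_rho// innerC//; exact: L2_rho.
exact: (xgetPex (fun=> 0) ex).
Qed.

(** The adjoint moves to the other side of the inner product, where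
    [fourier_measure mu lambda] is weakly the integral of [rho lambda]. *)
Lemma inner_adjoint_fourier (f : heisenberg R n -> R[i]) phi : cmeasurable f ->
  (\int[lebesgue_rV R (n + n + 1)]_p (normc (f p))%:E < +oo)%E -> L2 phi ->
  inner ((adjoint (fourier_measure mu lambda) \o fourier f lambda) phi) phi =
  cintegral mu setT (fun p => inner (fourier f lambda phi) (rho lambda p phi)).
Proof.
move=> mf fi lphi; have [l1 _] := fourier_spec mf fi lphi.
have [l2 h] := adjoint_fourier_measure_spec l1.
have [l3 w3] := fourier_measure_spec lphi.
rewrite /= innerC// -h// (w3 _ l1).2 -cintegral_conj; last exact: (w3 _ l1).1.
by apply: eq_cintegral => p _; rewrite -innerC//; exact: L2_rho.
Qed.

End representation.

End schroedinger.

(** * Closure and decay properties of Schwartz functions *)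

Section real_schwartz_class.
Variables (R : realType) (N : nat).
Implicit Types (u v : 'rV[R]_N -> R).

(** Membership is generated rather than defined by estimates, so that closure
    under the operations used below needs no Leibniz formula for iterated
    derivatives. *)
Inductive sch : ('rV[R]_N -> R) -> Prop :=
| sch_partial u s : real_schwartz u -> sch (iter_partial s u)
| schD u v : sch u -> sch v -> sch (fun x => u x + v x)
| schZ c u : sch u -> sch (fun x => c * u x)
| sch_coord k u : sch u -> sch (fun x => x 0 k * u x).

Lemma sch_schwartz u : real_schwartz u -> sch u.
Proof. exact: (@sch_partial u [::]). Qed.

Lemma sch_continuous u : sch u -> continuous u.
Proof.
elim=> {u} [u s [su _]|u v _ cu _ cv|c u _ cu|k u _ cu] x.
- by case: (su s) => + _; apply.
- exact: (cvgD (cu x) (cv x)).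
- exact: (cvgM (cvg_cst (c : R^o)) (cu x)).
- exact: (cvgM (@coord_continuous _ _ _ 0 k x) (cu x)).
Qed.

Lemma is_derive_coord k i (x : 'rV[R]_N) :
  is_derive x ('e_i) (fun y : 'rV[R]_N => y 0 k) (i == k)%:R.
Proof.
have h : (fun h => h^-1 *: ((fun y : 'rV[R]_N => y 0 k) (h *: 'e_i + x) - x 0 k)) @ 0^'
    --> ((i == k)%:R : R).
  apply: cvg_near_cst; near=> h.
  rewrite !mxE addrK eqxx /= /GRing.scale /= mulrA mulVf ?mul1r 1?eq_sym//.
  by rewrite eq_sym; near: h; exact: nbhs_dnbhs_neq.
by apply: DeriveDef; [apply/cvg_ex; eexists; exact: h|exact: cvg_lim].
Unshelve. all: by end_near. Qed.

(** Only for a product with a coordinate does a derivative leave the generators,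
    and Leibniz' rule brings it back. *)
Lemma sch_derive u i : sch u ->
  (forall x, derivable u x 'e_i) /\ sch (fun x => 'D_('e_i) u x).
Proof.
elim=> {u} [u s su|u v su [du su'] sv [dv sv']|c u su [du su']|k u su [du su']].
- split; first by case: su => /(_ s)[_ +] _; exact.
  exact: (@sch_partial u (i :: s)).
- split; first by move=> x; exact: derivableD.
  rewrite (_ : (fun x => _) = (fun x => 'D_('e_i) u x + 'D_('e_i) v x)).
    exact: schD.
  by apply/funext => x; rewrite deriveD.
- split; first by move=> x; exact: derivableZ.
  rewrite (_ : (fun x => _) = (fun x => c * 'D_('e_i) u x)); first exact: schZ.
  by apply/funext => x; exact: deriveZ.
- have dc x := is_derive_coord k i x.
  split; first by move=> x; apply: derivableM.
  rewrite (_ : (fun x => _) = (fun x : 'rV[R]_N => x 0 k * 'D_('e_i) u x + (i == k)%:R * u x)).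
    by apply: schD; [exact: sch_coord|exact: schZ].
  apply/funext => x; rewrite deriveM// derive_val.
  by rewrite /GRing.scale /= [X in _ + X]mulrC.
Qed.

Lemma sch_bounded u : sch u -> forall alpha : 'I_N -> nat, exists C : R,
  forall x : 'rV[R]_N, `|(\prod_i x 0 i ^+ alpha i) * u x| <= C.
Proof.
elim=> {u} [u s [_ +] alpha|u v _ bu _ bv alpha|c u _ bu alpha|k u _ bu alpha].
- by move=> /(_ alpha s).
- have [C1 h1] := bu alpha; have [C2 h2] := bv alpha; exists (C1 + C2) => x.
  by rewrite mulrDr (le_trans (ler_normD _ _))// lerD.
- have [C h] := bu alpha; exists (`|c| * C) => x.
  by rewrite mulrCA normrM ler_wpM2l.
- have [C h] := bu (fun i => (alpha i + (i == k))%N); exists C => x.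
  rewrite mulrCA; apply: le_trans (h x); rewrite le_eqVlt; apply/orP; left; apply/eqP.
  rewrite mulrA; congr `|_ * _|.
  under [in RHS]eq_bigr do rewrite exprD.
  rewrite big_split /= mulrC; congr (_ * _).
  rewrite (bigD1 k)//= eqxx expr1 big1 ?mulr1// => i ik.
  by rewrite (negbTE ik) expr0.
Qed.

Definition cauchy_weight m (v : 'rV[R]_m) : R := \prod_i (1 + v 0 i ^+ 2)^-1.

Lemma cauchy_weight_gt0 m (v : 'rV[R]_m) : 0 < cauchy_weight v.
Proof. by apply: prodr_gt0 => i _; rewrite invr_gt0 ltr_wpDr// sqr_ge0. Qed.

(** The class is stable under multiplication by [1 + x_i^2], and its members are
    bounded. *)
Lemma sch_decay u : sch u -> exists C : R, forall x, `|u x| <= C * cauchy_weight x.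
Proof.
move=> su; have sp (r : seq 'I_N) : sch (fun x => (\prod_(i <- r) (1 + x 0 i ^+ 2)) * u x).
  elim: r => [|i r ih].
    by under eq_fun do rewrite big_nil mul1r.
  rewrite (_ : (fun x => _) = (fun x : 'rV[R]_N => (\prod_(i <- r) (1 + x 0 i ^+ 2)) * u x +
    x 0 i * (x 0 i * ((\prod_(i <- r) (1 + x 0 i ^+ 2)) * u x)))).
    by apply: schD => //; do 2 apply: sch_coord.
  by apply/funext => x; rewrite big_cons; ring.
have [C h] := sch_bounded (sp (index_enum 'I_N)) (fun=> 0%N); exists C => x.
have := h x; rewrite big1 ?mul1r => [|i _]; last by rewrite expr0.
rewrite normrM ger0_norm; last by apply: prodr_ge0 => i _; rewrite addr_ge0// sqr_ge0.
rewrite /cauchy_weight prodfV ler_pdivlMr; first by rewrite mulrC.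
by apply: prodr_gt0 => i _; rewrite ltr_wpDr// sqr_ge0.
Qed.

End real_schwartz_class.

Section complex_schwartz_class.
Variables (R : realType) (N : nat).
Implicit Types (f g : 'rV[R]_N -> R[i]).

Definition csch f := sch (fun x => cRe (f x)) /\ sch (fun x => cIm (f x)).

Lemma csch_schwartz f : schwartz f -> csch f.
Proof. by move=> [s1 s2]; split; exact: sch_schwartz. Qed.

Lemma cschD f g : csch f -> csch g -> csch (fun x => f x + g x).
Proof. by move=> [f1 f2] [g1 g2]; split; under eq_fun do rewrite cE; exact: schD. Qed.

Lemma cschZ z f : csch f -> csch (fun x => z * f x).
Proof.
move=> [f1 f2]; split; under eq_fun do rewrite cE.
  under eq_fun do rewrite -mulNr.
  by apply: schD; exact: schZ.
by apply: schD; exact: schZ.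
Qed.

Lemma cschB f g : csch f -> csch g -> csch (fun x => f x - g x).
Proof.
move=> cf cg; under eq_fun do rewrite -mulN1r.
by apply: cschD => //; exact: cschZ.
Qed.

Lemma csch_coord k f : csch f -> csch (fun x => real_complex R (x 0 k) * f x).
Proof.
move=> [f1 f2]; split; under eq_fun do rewrite cE.
  by under eq_fun do rewrite mul0r subr0; exact: sch_coord.
by under eq_fun do rewrite mul0r addr0; exact: sch_coord.
Qed.

Definition cpartial i f : 'rV[R]_N -> R[i] := fun x =>
  Complex ('D_('e_i) (fun y => cRe (f y)) x) ('D_('e_i) (fun y => cIm (f y)) x).

Lemma csch_partial i f : csch f -> csch (cpartial i f).
Proof. by move=> [/(sch_derive i)[_ f1] /(sch_derive i)[_ f2]]; split. Qed.

Lemma csch_continuous f : csch f -> ccontinuous f.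
Proof. by move=> [f1 f2]; split; exact: sch_continuous. Qed.

Lemma csch_decay f : csch f -> exists2 C : R, 0 <= C &
  forall x, normc (f x) <= C * cauchy_weight x.
Proof.
move=> [/sch_decay[C1 h1] /sch_decay[C2 h2]].
have c1 : 0 <= C1.
  by have := le_trans (normr_ge0 _) (h1 0); rewrite pmulr_lge0// cauchy_weight_gt0.
have c2 : 0 <= C2.
  by have := le_trans (normr_ge0 _) (h2 0); rewrite pmulr_lge0// cauchy_weight_gt0.
exists (C1 + C2) => [|x]; first exact: addr_ge0.
by rewrite mulrDl (le_trans (normc_le_ReIm _))// lerD.
Qed.

Lemma derive_along_line (u : 'rV[R]_N -> R) i x :
  (forall y, derivable u y 'e_i) ->
  forall r : R, is_derive r 1 (fun s => u (x + s *: 'e_i)) ('D_('e_i) u (x + r *: 'e_i)).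
Proof.
move=> du r; have E : (fun h => h^-1 *: ((fun s => u (x + s *: 'e_i)) (h *: (1:R) + r)
       - u (x + r *: 'e_i))) =
    (fun h => h^-1 *: (u (h *: 'e_i + (x + r *: 'e_i)) - u (x + r *: 'e_i))).
  apply/funext => h; congr (_ *: (u _ - _)).
  have -> : h *: (1 : R) = h by rewrite /GRing.scale /= mulr1.
  by rewrite scalerDl addrCA.
have := du (x + r *: 'e_i) => d1.
apply: DeriveDef; first by rewrite /derivable E.
by rewrite /derive E.
Qed.

Lemma csch_along_line f i x : csch f ->
  cderiv (fun r => f (x + r *: 'e_i)) (fun r => cpartial i f (x + r *: 'e_i)).
Proof.
move=> [/(sch_derive i)[d1 _] /(sch_derive i)[d2 _]] r.
by split; [exact: (derive_along_line x d1)|exact: (derive_along_line x d2)].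
Qed.

End complex_schwartz_class.

Lemma cmeasurable_continuous (R : realType) N (f : 'rV[R]_N -> R[i]) :
  ccontinuous f -> cmeasurable f.
Proof.
have h (u : 'rV[R]_N -> R) : continuous u -> measurable_fun setT u.
  move=> cu; apply: (@measurability _ _ _ _ _ _ (@RGenOpens.G R)).
    exact: RGenOpens.measurableE.
  move=> _ [_ [a [b ->]] <-]; rewrite setTI; apply: open_rV_measurable.
  by apply: open_comp; [move=> x _; exact: cu|exact: interval_open].
by move=> [c1 c2]; split; exact: h.
Qed.

(** * Cauchy weights and integrals of derivatives *)

Section cauchy_weights.
Variables (R : realType) (m : nat).
Local Notation leb := (lebesgue_rV R m).
Implicit Types v : 'rV[R]_m.

Lemma cauchy_weight_ge0 v : 0 <= cauchy_weight v.
Proof. exact/ltW/cauchy_weight_gt0. Qed.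

Lemma cauchy_weight_le1 v : cauchy_weight v <= 1.
Proof.
suff : 0 <= cauchy_weight v <= 1 by case/andP.
rewrite /cauchy_weight; elim/big_ind: _ => // [|x y /andP[x0 x1] /andP[y0 y1]|i _].
- by rewrite ler01 lexx.
- by rewrite mulr_ge0// mulr_ile1.
- by rewrite invr_ge0 addr_ge0 ?sqr_ge0//= invf_le1 ?ltr_wpDr ?sqr_ge0// lerDl sqr_ge0.
Qed.

Lemma measurable_cauchy_weight : measurable_fun setT (fun v => cauchy_weight v).
Proof.
apply: (measurable_prod_coord (F := fun _ x => (1 + x ^+ 2)^-1)) => i.
apply: continuous_measurable_fun; exact: continuous_oneDsqrV.
Qed.

Lemma integral_cauchy_weight :
  (\int[leb]_v (cauchy_weight v)%:E = (\prod_(i < m) pi)%:E)%E.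
Proof.
apply: (ge0_integral_prod_rV (F := fun _ x => (1 + x ^+ 2)^-1)) => [i|i x|i].
- apply: continuous_measurable_fun; exact: continuous_oneDsqrV.
- by rewrite invr_ge0 addr_ge0// sqr_ge0.
- exact: integral_cauchy.
Qed.

Lemma integral_cauchy_weight_lty (C : R) : 0 <= C ->
  (\int[leb]_v (C * cauchy_weight v)%:E < +oo)%E.
Proof.
move=> C0; apply: ge0_integral_scale_lty => //; first exact: measurable_cauchy_weight.
  by move=> v; exact: cauchy_weight_ge0.
by rewrite integral_cauchy_weight ltry.
Qed.

End cauchy_weights.

Section vanishing_integral.
Variables (R : realType) (m : nat) (i : 'I_m).
Local Notation leb := (lebesgue_rV R m).
Local Notation leb1 := (@lebesgue_measure R).
Variables (H H' : 'rV[R]_m -> R[i]) (C : R).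
Hypotheses (C0 : 0 <= C) (dH : forall v,
  cderiv (fun r => H (v + r *: 'e_i)) (fun r => H' (v + r *: 'e_i))).
Hypotheses (cH : ccontinuous H) (cH' : ccontinuous H').
Hypotheses (HC : forall v, normc (H v) <= C * cauchy_weight v)
  (H'C : forall v, normc (H' v) <= C * cauchy_weight v).

Lemma cintegrable_rV_shift (a : 'rV[R]_m) (g : 'rV[R]_m -> R[i]) :
  cintegrable leb setT g -> cintegrable leb setT (fun v => g (v + a)).
Proof.
move=> ig; have mg := cintegrable_measurable ig; apply: cintegrable_lty.
  by apply: (cmeasurable_comp mg); exact: measurable_fun_rVD.
rewrite -(ge0_integral_rV_shift a (u := fun v => (normc (g v))%:E)).
- exact: cintegrable_normc_lty.
- exact/measurable_EFinP/measurable_normc.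
- by move=> v; rewrite lee_fin normc_ge0.
Qed.

Lemma cintegral_gexp_cst (z : R[i]) :
  cintegral leb1 setT (fun r => real_complex R (gexp r) * z) = z.
Proof.
rewrite -[RHS](@cexp_resolvent R (fun=> z) (fun=> 0) (normc z)) => [|r|//|//|r].
- by apply: eq_cintegral => r _; rewrite subr0.
- by split; exact: is_derive_cst.
- exact: ccontinuous_cst.
- by rewrite normc0' normc_ge0.
Qed.

Lemma continuous_line (v : 'rV[R]_m) : continuous (fun r : R => v + r *: 'e_i).
Proof.
move=> r; apply: (@cvgD _ _ _ _ _ (fun=> v) (fun r : R => r *: 'e_i)).
  exact: cvg_cst.
exact: scalel_continuous.
Qed.

(** Integrating the resolvent identity along [e_i] over the whole space and
    using translation invariance gives [int H = int H - int H']. *)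
Lemma cintegral_derivative0 : cintegral leb setT H' = 0.
Proof.
have mH := cmeasurable_continuous cH; have mH' := cmeasurable_continuous cH'.
have iH : cintegrable leb setT H.
  apply: (cintegrable_le mH _ HC); last exact: integral_cauchy_weight_lty.
  by apply: measurable_funM => //; exact: measurable_cauchy_weight.
have iH' : cintegrable leb setT H'.
  apply: (cintegrable_le mH' _ H'C); last exact: integral_cauchy_weight_lty.
  by apply: measurable_funM => //; exact: measurable_cauchy_weight.
have iD : cintegrable leb setT (fun v => H v - H' v).
  have := cintegrableD iH (cintegrableZ (-1) iH').
  by under eq_fun do rewrite mulN1r.
have intD : cintegral leb setT (fun v => H v - H' v) =
    cintegral leb setT H - cintegral leb setT H'.
  rewrite -[in RHS]mulN1r -cintegralZ// -cintegralD//; last exact: cintegrableZ.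
  by apply: eq_cintegral => v _; rewrite mulN1r.
pose g (p : 'rV[R]_m * measurableTypeR R) :=
  real_complex R (gexp p.2) * (H (p.1 + p.2 *: 'e_i) - H' (p.1 + p.2 *: 'e_i)).
have mline : measurable_fun setT (fun p : 'rV[R]_m * measurableTypeR R => p.1 + p.2 *: 'e_i).
  by apply: measurable_fun_rVD => //; exact: measurable_fun_rVZ.
have mgexp : measurable_fun setT (fun p : 'rV[R]_m * measurableTypeR R => gexp p.2).
  exact: (measurableT_comp (@measurable_gexp R)).
have mg : cmeasurable g.
  apply: cmeasurableM; first exact: cmeasurable_real.
  by apply: cmeasurableB; [exact: (cmeasurable_comp mH mline)|exact: (cmeasurable_comp mH' mline)].
have ig' : cintegrable (leb1 \x leb)%E setT
    (fun p : measurableTypeR R * 'rV[R]_m => g (p.2, p.1)).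
  apply: (cintegrable_fibered (a := fun r : measurableTypeR R => gexp r)
    (u := fun p : measurableTypeR R * 'rV[R]_m => 2 * C * cauchy_weight (p.2 + p.1 *: 'e_i))
    (C := 2 * C * \prod_(i < m) pi)).
  - by apply: (cmeasurable_comp mg); exact: measurable_fun_pair.
  - exact: measurable_gexp.
  - apply: measurable_funM => //; apply: (measurableT_comp (@measurable_cauchy_weight R m)).
    by apply: measurable_fun_rVD => //; exact: measurable_fun_rVZ.
  - by move=> r; exact: gexp_ge0.
  - by move=> p; rewrite !mulr_ge0// cauchy_weight_ge0.
  - move=> r v; rewrite /g normcM' normc_real ger0_norm ?gexp_ge0//=.
    rewrite ler_wpM2l ?gexp_ge0// (le_trans (normcD_le _ _))// normcN.
    by rewrite -mulrA mulr_natl mulr2n lerD.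
  - move=> r; have mcw := @measurable_cauchy_weight R m.
    rewrite -(ge0_integral_rV_shift (r *: 'e_i) (u := fun v => (2 * C * cauchy_weight v)%:E)).
    + under eq_integral do rewrite EFinM.
      rewrite ge0_integralZl ?lee_fin ?mulr_ge0//.
      * by rewrite integral_cauchy_weight.
      * exact/measurable_EFinP.
      * by move=> v _; rewrite lee_fin cauchy_weight_ge0.
    + by apply/measurable_EFinP; exact: measurable_funM.
    + by move=> v; rewrite lee_fin !mulr_ge0// cauchy_weight_ge0.
  - by rewrite integral_gexp ltry.
have ig : cintegrable (leb \x leb1)%E setT g.
  rewrite (_ : g = fun z => g (z.1, z.2)); first exact: cintegrable_swap ig'.
  by apply/funext => -[v r].
(* integrating [g] in [r] first gives [H], by the resolvent identity along lines;
   integrating in [v] first gives [H - H'], by translation invariance *)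
have lhsE : cintegral leb setT (fun v => cintegral leb1 setT (fun r => g (v, r))) =
    cintegral leb setT H.
  apply: eq_cintegral => v _.
  rewrite -[RHS]/(H v) -[in RHS](addr0 v) -[in RHS](scale0r 'e_i).
  apply: (@cexp_resolvent R (fun r => H (v + r *: 'e_i)) (fun r => H' (v + r *: 'e_i)) C) => //.
  - have [c1 c2] := cH'; split => r.
      exact: (continuous_comp (@continuous_line v r) (c1 _)).
    exact: (continuous_comp (@continuous_line v r) (c2 _)).
  - by move=> r; rewrite (le_trans (HC _))// ler_piMr// cauchy_weight_le1.
  - by move=> r; rewrite (le_trans (H'C _))// ler_piMr// cauchy_weight_le1.
have rhsE : cintegral leb1 setT (fun r => cintegral leb setT (fun v => g (v, r))) =
    cintegral leb setT (fun v => H v - H' v).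
  rewrite -[RHS]cintegral_gexp_cst; apply: eq_cintegral => r _.
  rewrite /g /= cintegralZ; last exact: (cintegrable_rV_shift (r *: 'e_i) iD).
  by rewrite -(cintegral_rV_shift (r *: 'e_i) (g := fun v => H v - H' v))//; exact: cmeasurableB.
have := cfubini_swap ig; rewrite lhsE rhsE intD => HE.
by rewrite -[RHS](subrr (cintegral leb setT H)) [in X in _ = _ - X]HE opprB addrC subrK.
Qed.

End vanishing_integral.

(** * The Fourier transform in the central and x variables *)

Section heisenberg_coordinates.
Variables (R : realType) (n : nat).
Implicit Types (v : 'rV[R]_n.+1) (y : 'rV[R]_n).

(** The coordinates of a point of the group, in the order [(x, y, t)], in terms
    of those of [v = (t, x)] and [y]. *)
Definition vcoord (i : 'I_n.+1) : 'I_(n + n + 1) :=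
  if unlift ord0 i is Some j then lshift 1 (lshift n j) else rshift (n + n) ord0.
Definition ycoord (k : 'I_n) : 'I_(n + n + 1) := lshift 1 (rshift n k).

Lemma vcoord_lift j : vcoord (lift ord0 j) = lshift 1 (lshift n j).
Proof. by rewrite /vcoord liftK. Qed.
Lemma vcoord0 : vcoord ord0 = rshift (n + n) ord0.
Proof. by rewrite /vcoord unlift_none. Qed.

Lemma heis_coordP (P : 'I_(n + n + 1) -> Prop) :
  (forall i, P (vcoord i)) -> (forall k, P (ycoord k)) -> forall j, P j.
Proof.
move=> Pv Py j; case: (split_ordP j) => [a ->|b ->].
  case: (split_ordP a) => [c ->|k ->]; last exact: Py.
  by rewrite -vcoord_lift; exact: Pv.
by rewrite (ord1 b) -vcoord0; exact: Pv.
Qed.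

Lemma heis_point_vcoord v y i : heis_point v y 0 (vcoord i) = v 0 i.
Proof.
rewrite /heis_point; case: (unliftP ord0 i) => [j|] ->.
  by rewrite vcoord_lift !row_mxEl mxE.
by rewrite vcoord0 row_mxEr mxE.
Qed.

Lemma heis_point_ycoord v y k : heis_point v y 0 (ycoord k) = y 0 k.
Proof. by rewrite /heis_point row_mxEl row_mxEr. Qed.

Lemma vcoord_inj : injective vcoord.
Proof.
move=> i j; case: (unliftP ord0 i) => [a|] ->; case: (unliftP ord0 j) => [b|] ->;
  rewrite ?vcoord_lift ?vcoord0 //.
- by move=> /lshift_inj/lshift_inj ->.
- by move=> /eqP; rewrite eq_lrshift.
- by move=> /eqP; rewrite eq_rlshift.
Qed.

Lemma ycoord_inj : injective ycoord.
Proof. by move=> a b /lshift_inj/rshift_inj. Qed.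

Lemma vcoord_neq_ycoord i k : (vcoord i == ycoord k) = false.
Proof.
case: (unliftP ord0 i) => [a|] ->; rewrite ?vcoord_lift ?vcoord0 /ycoord.
  by rewrite eq_lshift eq_lrshift.
by rewrite eq_rlshift.
Qed.

Lemma heis_point_shiftv v y i (r : R) :
  heis_point (v + r *: 'e_i) y = heis_point v y + r *: 'e_(vcoord i).
Proof.
apply: rV_eqP; apply: heis_coordP => [j|k].
  rewrite heis_point_vcoord [LHS]mxE [RHS]mxE heis_point_vcoord; congr (_ + _).
  by rewrite !mxE (inj_eq vcoord_inj).
rewrite heis_point_ycoord [RHS]mxE heis_point_ycoord -[LHS]addr0; congr (_ + _).
by rewrite !mxE eq_sym vcoord_neq_ycoord andbF mulr0.
Qed.

Lemma heis_point_shifty v y k (r : R) :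
  heis_point v (y + r *: 'e_k) = heis_point v y + r *: 'e_(ycoord k).
Proof.
apply: rV_eqP; apply: heis_coordP => [j|k'].
  rewrite heis_point_vcoord [RHS]mxE heis_point_vcoord -[LHS]addr0; congr (_ + _).
  by rewrite !mxE vcoord_neq_ycoord andbF mulr0.
rewrite heis_point_ycoord [LHS]mxE [RHS]mxE heis_point_ycoord; congr (_ + _).
by rewrite !mxE (inj_eq ycoord_inj).
Qed.

Lemma cauchy_weight_heis v y :
  cauchy_weight (heis_point v y) = cauchy_weight v * cauchy_weight y.
Proof.
rewrite /cauchy_weight big_split_ord big_split_ord /= big_ord1 [in RHS]big_ord_recl.
rewrite mulrC mulrA; congr (_ * _ * _).
- by rewrite -(ord1 ord0) -vcoord0 heis_point_vcoord.
- by apply: eq_bigr => j _; rewrite -vcoord_lift heis_point_vcoord.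
- by apply: eq_bigr => j _; rewrite heis_point_ycoord.
Qed.

Lemma continuous_rV (T : topologicalType) N (g : T -> 'rV[R]_N) :
  (forall i, continuous (fun x => g x 0 i)) -> continuous g.
Proof.
move=> cg x; apply/cvg_ballP => e e0.
have : \forall t \near x, forall j : 'I_N, ball (g x 0 j) e (g t 0 j).
  by apply: filter_forall => j; have /cvg_ballP := cg j x; apply.
apply: filterS => t h; rewrite /ball /=; split => // i j.
by rewrite (ord1 i); exact: h.
Qed.

Lemma continuous_heis_point y : continuous (fun v => heis_point v y).
Proof.
apply: continuous_rV; apply: heis_coordP => [i|k] v.
  by under eq_fun do rewrite heis_point_vcoord; exact: coord_continuous.
by under eq_fun do rewrite heis_point_ycoord; exact: cst_continuous.
Qed.

Lemma continuous_dot (z : 'rV[R]_n.+1) : continuous (fun v => dot v z).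
Proof.
have cs (r : seq 'I_n.+1) : continuous (fun v : 'rV[R]_n.+1 => \sum_(i <- r) v 0 i * z 0 i).
  elim: r => [|i r ih] v.
    by under eq_fun do rewrite big_nil; exact: cst_continuous.
  under eq_fun do rewrite big_cons.
  exact: (cvgD (cvgM (@coord_continuous _ _ _ 0 i v) (cvg_cst (z 0 i : R^o))) (ih v)).
exact: cs.
Qed.

Lemma dot_shift (v z : 'rV[R]_n.+1) i (r : R) : dot (v + r *: 'e_i) z = z 0 i * r + dot v z.
Proof.
rewrite dotC dotDr addrC dotZr mulrC (dotC v); congr (_ * _ + _).
rewrite /dot (bigD1 i)//= big1 => [|j ji]; first by rewrite addr0 mxE !eqxx mulr1.
by rewrite mxE (negbTE ji) andbF mulr0.
Qed.

End heisenberg_coordinates.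

Lemma eq_cderiv (R : realType) (u u' v v' : R -> R[i]) :
  u =1 v -> u' =1 v' -> cderiv u u' -> cderiv v v'.
Proof. by move=> /funext -> /funext ->. Qed.

Section central_fourier.
Variables (R : realType) (n : nat).
Local Notation leb := (lebesgue_rV R n.+1).
Implicit Types (f : heisenberg R n -> R[i]) (z v : 'rV[R]_n.+1) (y : 'rV[R]_n).

(** The Euclidean Fourier transform in the central and [x] variables; [y] stays
    a parameter. Every operator-valued transform below is a kernel built from it. *)
Definition Phi f z y : R[i] :=
  cintegral leb setT (fun v => f (heis_point v y) * expi (dot v z)).

Lemma csch_heis_decay f : csch f -> exists2 C : R, 0 <= C & forall v y,
  normc (f (heis_point v y)) <= C * cauchy_weight v * cauchy_weight y.
Proof.
move=> /csch_decay[C C0 h]; exists C => // v y.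
by apply: le_trans (h _) _; rewrite cauchy_weight_heis mulrA.
Qed.

Lemma csch_heis_decay_v f : csch f -> exists2 C : R, 0 <= C & forall v y,
  normc (f (heis_point v y)) <= C * cauchy_weight v.
Proof.
move=> /csch_heis_decay[C C0 h]; exists C => // v y.
apply: le_trans (h v y) _; rewrite ler_piMr ?cauchy_weight_le1//.
by rewrite mulr_ge0// cauchy_weight_ge0.
Qed.

Lemma ccontinuous_heis f y : csch f -> ccontinuous (fun v => f (heis_point v y)).
Proof.
move=> /csch_continuous[c1 c2]; split => v.
  exact: (continuous_comp (@continuous_heis_point R n y v) (c1 _)).
exact: (continuous_comp (@continuous_heis_point R n y v) (c2 _)).
Qed.

Lemma ccontinuous_Phi_integrand f z y : csch f ->
  ccontinuous (fun v => f (heis_point v y) * expi (dot v z)).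
Proof.
move=> cf; apply: ccontinuousM; first exact: ccontinuous_heis.
by apply: ccontinuous_expi; exact: continuous_dot.
Qed.

Lemma Phi_integrable f z y : csch f ->
  cintegrable leb setT (fun v => f (heis_point v y) * expi (dot v z)).
Proof.
move=> cf; have [C C0 h] := csch_heis_decay_v cf.
apply: (@cintegrable_le _ _ R leb _ (fun v => C * cauchy_weight v)).
- exact/cmeasurable_continuous/ccontinuous_Phi_integrand.
- by apply: measurable_funM => //; exact: measurable_cauchy_weight.
- by move=> v; rewrite normcM' normc_expi mulr1.
- exact: integral_cauchy_weight_lty.
Qed.

Lemma Phi_bounded f : csch f -> exists2 C : R, 0 <= C & forall z y, normc (Phi f z y) <= C.
Proof.
move=> cf; have [C C0 h] := csch_heis_decay_v cf.
exists (2 * fine (\int[leb]_v (C * cauchy_weight v)%:E)).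
  rewrite mulr_ge0// fine_ge0//; apply: integral_ge0 => v _.
  by rewrite lee_fin mulr_ge0// cauchy_weight_ge0.
move=> z y; apply: normc_cintegral_le.
- exact/cmeasurable_continuous/ccontinuous_Phi_integrand.
- by apply: measurable_funM => //; exact: measurable_cauchy_weight.
- by move=> v; rewrite normcM' normc_expi mulr1.
- exact: integral_cauchy_weight_lty.
Qed.

Lemma PhiD f g z y : csch f -> csch g ->
  Phi (fun p => f p + g p) z y = Phi f z y + Phi g z y.
Proof.
move=> cf cg; rewrite /Phi -cintegralD; try exact: Phi_integrable.
by apply: eq_cintegral => v _; rewrite mulrDl.
Qed.

Lemma PhiZ f (c : R[i]) z y : csch f -> Phi (fun p => c * f p) z y = c * Phi f z y.
Proof.
move=> cf; rewrite /Phi -cintegralZ; try exact: Phi_integrable.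
by apply: eq_cintegral => v _; rewrite mulrA.
Qed.

Lemma PhiB f g z y : csch f -> csch g ->
  Phi (fun p => f p - g p) z y = Phi f z y - Phi g z y.
Proof.
move=> cf cg; rewrite -mulN1r -PhiZ// -PhiD//; last exact: cschZ.
by congr Phi; apply/funext => p; rewrite mulN1r.
Qed.

Lemma Phi_ycoord f k z y : csch f ->
  Phi (fun p => real_complex R (p 0 (ycoord k)) * f p) z y = real_complex R (y 0 k) * Phi f z y.
Proof.
move=> cf; rewrite /Phi -cintegralZ; try exact: Phi_integrable.
by apply: eq_cintegral => v _; rewrite mulrA heis_point_ycoord.
Qed.

(** Integration by parts in the form [cintegral_derivative0]. *)
Lemma Phi_partial f i z y : csch f ->
  Phi (cpartial (vcoord i) f) z y = - imag (z 0 i) * Phi f z y.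
Proof.
move=> cf; have cf' := csch_partial (vcoord i) cf.
have [C1 C10 h1] := csch_heis_decay_v cf; have [C2 C20 h2] := csch_heis_decay_v cf'.
have zi0 : 0 <= `|z 0 i| by [].
have iz := cintegrableZ (imag (z 0 i)) (Phi_integrable z y cf).
apply/eqP; rewrite mulNr -addr_eq0; apply/eqP.
rewrite /Phi -cintegralZ; last exact: Phi_integrable.
rewrite -cintegralD//; last exact: Phi_integrable.
apply: (@cintegral_derivative0 R n.+1 i (fun v => f (heis_point v y) * expi (dot v z)) _
   (C2 + (1 + `|z 0 i|) * C1)).
- by rewrite addr_ge0// mulr_ge0// addr_ge0.
- move=> v; have d1 := csch_along_line (vcoord i) (heis_point v y) cf.
  apply: eq_cderiv (cderivM d1 (cderiv_expi (z 0 i) (dot v z))) => r.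
    by rewrite heis_point_shiftv dot_shift.
  by rewrite heis_point_shiftv dot_shift mulrCA.
- exact: ccontinuous_Phi_integrand.
- apply: ccontinuousD; first exact: ccontinuous_Phi_integrand.
  by apply: ccontinuousM; [exact: ccontinuous_cst|exact: ccontinuous_Phi_integrand].
- move=> v; rewrite normcM' normc_expi mulr1 (le_trans (h1 _ _))//.
  rewrite ler_wpM2r ?cauchy_weight_ge0// mulrDl mul1r addrCA lerDl.
  by rewrite addr_ge0// mulr_ge0.
- move=> v; rewrite (le_trans (normcD_le _ _))// !normcM' normc_expi normc_imag !mulr1.
  rewrite mulrDl lerD ?h2// -!mulrA mulrDl mul1r.
  rewrite -[leLHS]add0r lerD ?mulr_ge0 ?cauchy_weight_ge0//.
  by rewrite ler_wpM2l.
Qed.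

Lemma Phi_multiplier f i z y : csch f ->
  (1 + imag (z 0 i)) * Phi f z y = Phi (fun p => f p - cpartial (vcoord i) f p) z y.
Proof.
move=> cf; rewrite PhiB//; last exact: csch_partial.
by rewrite Phi_partial// mulNr opprK mulrDl mul1r.
Qed.

Lemma csch_multiplier f i : csch f -> csch (fun p => f p - cpartial (vcoord i) f p).
Proof. by move=> cf; apply: cschB => //; exact: csch_partial. Qed.

Lemma normc_1imag (a : R) : normc (1 + imag a) ^+ 2 = 1 + a ^+ 2.
Proof. by rewrite normc_sqr !cE addr0 add0r /= expr1n. Qed.

Lemma normc_prod_1imag m (a : 'rV[R]_m) :
  normc (\prod_i (1 + imag (a 0 i))) ^+ 2 = (cauchy_weight a)^-1.
Proof.
rewrite normc_prod -prodrXl /cauchy_weight prodfV invrK.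
by apply: eq_bigr => i _; rewrite normc_1imag.
Qed.

(** Multiplying [Phi f] by [1 + i z_i] amounts to replacing [f] by another function
    of the class, and [Phi] is bounded; doing so twice for every [i] gives a
    multiplier of modulus [(cauchy_weight z)^-1]. *)
Lemma Phi_decay f : csch f -> exists2 C : R, 0 <= C &
  forall z y, normc (Phi f z y) <= C * cauchy_weight z.
Proof.
move=> cf.
have [g cg gE] : exists2 g, csch g & forall z y,
    \prod_(i <- index_enum 'I_n.+1 ++ index_enum 'I_n.+1) (1 + imag (z 0 i)) * Phi f z y = Phi g z y.
  elim: (_ ++ _) => [|i r [g cg gE]].
    by exists f => // z y; rewrite big_nil mul1r.
  exists (fun p => g p - cpartial (vcoord i) g p); first exact: csch_multiplier.
  by move=> z y; rewrite -Phi_multiplier// -gE big_cons mulrA.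
have [C C0 h] := Phi_bounded cg; exists C => // z y.
have := h z y; rewrite -gE big_cat /= !normcM' -expr2 normc_prod_1imag.
by rewrite mulrC ler_pdivrMr ?cauchy_weight_gt0.
Qed.

End central_fourier.

(** * The integral kernel of the Fourier transform *)

Section green_function.
Variables (R : realType) (m : nat).

(** The kernel of the product over the coordinates of the resolvents
    [(1 + d_k)^-1]. *)
(** The Green function of [prod_i (1 + d_i)]. *)
Definition green (r : 'rV[R]_m) : R := \prod_i gexp (r 0 i).

Lemma gexp_le1 (r : R) : gexp r <= 1.
Proof.
have [r0|r0] := ltP r 0; first by rewrite gexp_lt0.
by rewrite gexpE// -expR0 ler_expR oppr_le0.
Qed.

Lemma green_ge0 r : 0 <= green r.
Proof. by apply: prodr_ge0 => i _; exact: gexp_ge0. Qed.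

Lemma green_le1 r : green r <= 1.
Proof.
suff : 0 <= green r <= 1 by case/andP.
rewrite /green; elim/big_ind: _ => // [|x y /andP[x0 x1] /andP[y0 y1]|i _].
- by rewrite ler01 lexx.
- by rewrite mulr_ge0// mulr_ile1.
- by rewrite gexp_ge0 gexp_le1.
Qed.

Lemma measurable_green : measurable_fun setT green.
Proof.
exact: (measurable_prod_coord (fun _ : 'I_m => @measurable_gexp R)).
Qed.

Lemma integral_green : (\int[lebesgue_rV R m]_r (green r)%:E = 1%:E)%E.
Proof.
rewrite (ge0_integral_prod_rV (F := fun=> @gexp R) (c := fun=> 1)).
- by rewrite big1.
- by move=> i; exact: measurable_gexp.
- by move=> i x; exact: gexp_ge0.
- by move=> i; exact: integral_gexp.
Qed.

Lemma integral_sqr_green_lty : (\int[lebesgue_rV R m]_r (green r ^+ 2)%:E < +oo)%E.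
Proof.
apply: (@le_lt_trans _ _ (\int[lebesgue_rV R m]_r (green r)%:E)%E).
  apply: ge0_le_integral => //.
  - by move=> r _; rewrite lee_fin sqr_ge0.
  - by apply/measurable_EFinP; apply: measurable_funX; exact: measurable_green.
  - by apply/measurable_EFinP; exact: measurable_green.
  - by move=> r _; rewrite lee_fin expr2 ler_piMr ?green_ge0 ?green_le1.
by rewrite integral_green ltry.
Qed.

End green_function.

Section scaled_cauchy_weight.
Variables (R : realType) (m : nat).

Lemma integral_scaled_cauchy_weight_lty (c : R) : c != 0 ->
  (\int[lebesgue_rV R m]_v (cauchy_weight (c *: v))%:E < +oo)%E.
Proof.
move=> c0; have E : ((\prod_(i < m) pi)%:E = (`|c| ^+ m)%:E *
    \int[lebesgue_rV R m]_v (cauchy_weight (c *: v))%:E)%E.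
  rewrite -integral_cauchy_weight (ge0_integral_affine_rV 0 c0).
  - by congr (_ * _)%E; apply: eq_integral => v _; rewrite add0r.
  - by apply/measurable_EFinP; exact: measurable_cauchy_weight.
  - by move=> v; rewrite lee_fin cauchy_weight_ge0.
have cn : 0 < `|c| ^+ m by rewrite exprn_gt0// normr_gt0.
rewrite ltNge leye_eq; apply/negP => /eqP Ioo.
by move: E; rewrite Ioo gt0_muley ?lte_fin.
Qed.

End scaled_cauchy_weight.

Section kernel.
Variables (R : realType) (n : nat) (lambda : R).
Local Notation leb := (lebesgue_rV R n).
Local Notation leb1 := (@lebesgue_measure R).
Implicit Types (f g h : heisenberg R n -> R[i]) (xi eta : 'rV[R]_n).

Definition frequency xi eta : 'rV[R]_n.+1 := rV_cons (lambda, (lambda / 2) *: (xi + eta)).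

(** The integral kernel of [fourier f lambda]. *)
Definition K f xi eta : R[i] := Phi f (frequency xi eta) (eta - xi).

Lemma frequency_lift xi eta k :
  frequency xi eta 0 (lift ord0 k) = lambda / 2 * (xi 0 k + eta 0 k).
Proof. by rewrite rV_consS /= !mxE. Qed.

(** On kernels the operators [1 + i lambda xi_k] and [1 + i lambda eta_k] act as
    differential operators on [f], because [lambda xi = lambda (xi + eta) / 2 -
    (lambda / 2) (eta - xi)]; the last difference is the coordinate [y]. *)
Lemma K_multl f k : csch f -> exists2 g, csch g & forall xi eta,
  (1 + imag ((lambda *: xi) 0 k)) * K f xi eta = K g xi eta.
Proof.
move=> cf; have cm := csch_multiplier (lift ord0 k) cf.
have cy := cschZ (imag (lambda / 2)) (csch_coord (ycoord k) cf).
exists (fun p => (f p - cpartial (vcoord (lift ord0 k)) f p) -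
   imag (lambda / 2) * (real_complex R (p 0 (ycoord k)) * f p)); first exact: cschB.
move=> xi eta; rewrite /K PhiB// -Phi_multiplier// PhiZ ?Phi_ycoord//; last exact: csch_coord.
rewrite frequency_lift mulrA -mulrBl; congr (_ * _).
by apply: complexP; rewrite !cE !mxE; field.
Qed.

Lemma K_multr f k : csch f -> exists2 g, csch g & forall xi eta,
  (1 + imag ((lambda *: eta) 0 k)) * K f xi eta = K g xi eta.
Proof.
move=> cf; have cm := csch_multiplier (lift ord0 k) cf.
have cy := cschZ (imag (lambda / 2)) (csch_coord (ycoord k) cf).
exists (fun p => (f p - cpartial (vcoord (lift ord0 k)) f p) +
   imag (lambda / 2) * (real_complex R (p 0 (ycoord k)) * f p)); first exact: cschD.
move=> xi eta; rewrite /K PhiD// -Phi_multiplier// PhiZ ?Phi_ycoord//; last exact: csch_coord.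
rewrite frequency_lift mulrA -mulrDl; congr (_ * _).
by apply: complexP; rewrite !cE !mxE; field.
Qed.

(** Both variables are controlled at once since the multipliers in [xi] and in
    [eta] can be iterated in any order. *)
Lemma K_decay f : csch f -> exists2 C : R, 0 <= C & forall xi eta,
  normc (K f xi eta) <= C * cauchy_weight (lambda *: xi) * cauchy_weight (lambda *: eta).
Proof.
move=> cf; set s := index_enum 'I_n ++ index_enum 'I_n.
have [g1 cg1 g1E] : exists2 g, csch g & forall xi eta,
    \prod_(k <- s) (1 + imag ((lambda *: eta) 0 k)) * K f xi eta = K g xi eta.
  elim: s => [|k r [g cg gE]]; first by exists f => // xi eta; rewrite big_nil mul1r.
  have [g' cg' gE'] := K_multr k cg; exists g' => // xi eta.
  by rewrite -gE' -gE big_cons mulrA.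
have [g2 cg2 g2E] : exists2 g, csch g & forall xi eta,
    \prod_(k <- s) (1 + imag ((lambda *: xi) 0 k)) * K g1 xi eta = K g xi eta.
  elim: s {g1E} => [|k r [g cg gE]]; first by exists g1 => // xi eta; rewrite big_nil mul1r.
  have [g' cg' gE'] := K_multl k cg; exists g' => // xi eta.
  by rewrite -gE' -gE big_cons mulrA.
have [C C0 hC] := Phi_bounded cg2; exists C => // xi eta.
have := hC (frequency xi eta) (eta - xi); rewrite -/(K g2 xi eta) -g2E -g1E.
rewrite /s !big_cat /= !normcM' -!expr2 !normc_prod_1imag => h.
have w1 := cauchy_weight_gt0 (lambda *: xi); have w2 := cauchy_weight_gt0 (lambda *: eta).
by rewrite -ler_pdivrMr// -ler_pdivrMr// mulrC (mulrC (normc _)).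
Qed.

Lemma cmeasurable_Phi d (T : measurableType d) f (z : T -> 'rV[R]_n.+1) (y : T -> 'rV[R]_n) :
  csch f -> measurable_fun setT z -> measurable_fun setT y ->
  cmeasurable (fun w => Phi f (z w) (y w)).
Proof.
move=> cf mz my.
have mf := cmeasurable_continuous (csch_continuous cf).
apply: (cmeasurable_cintegral (lebesgue_rV R n.+1)
  (g := fun p : T * 'rV[R]_n.+1 => f (heis_point p.2 (y p.1)) * expi (dot p.2 (z p.1)))).
apply: cmeasurableM.
  apply: (cmeasurable_comp mf); apply: measurable_heis_point => //.
  exact: measurableT_comp my _.
apply: cmeasurable_expi; apply: measurable_fun_dot => //.
exact: measurableT_comp mz _.
Qed.

Lemma cmeasurable_K d (T : measurableType d) f (xi eta : T -> 'rV[R]_n) :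
  csch f -> measurable_fun setT xi -> measurable_fun setT eta ->
  cmeasurable (fun w => K f (xi w) (eta w)).
Proof.
move=> cf mx me; apply: cmeasurable_Phi => //.
  apply: measurable_fun_rV_cons => //; apply: measurable_fun_rVZ => //.
  exact: measurable_fun_rVD.
exact: measurable_fun_rVB.
Qed.

Lemma frequency_shift xi eta k (r : R) :
  frequency (xi - r *: 'e_k) eta = frequency xi eta + (- (lambda / 2) * r) *: 'e_(lift ord0 k).
Proof.
apply: rV_eqP => j; rewrite [RHS]mxE.
case: (unliftP ord0 j) => [i|] ->.
  rewrite !frequency_lift !mxE eqxx /= (inj_eq lift_inj); ring.
by rewrite !rV_cons0 !mxE eqxx /= mulr0 addr0.
Qed.

(** The resolvent identity applied to [r |-> K lambda f (xi - r e_k) eta], whose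
    derivative is the kernel of another function of the class. *)
Lemma K_resolvent1 f k : csch f -> exists2 g, csch g & forall xi eta,
  K f xi eta = cintegral leb1 setT (fun r => real_complex R (gexp r) * K g (xi - r *: 'e_k) eta).
Proof.
move=> cf; have cf' := csch_partial (ycoord k) cf.
pose x k' (p : heisenberg R n) := p 0 (vcoord (lift ord0 k')).
pose g p := (f p - cpartial (ycoord k) f p) +
   imag (lambda / 2) * (real_complex R (x k p) * f p).
have cg : csch g.
  by apply: cschD; [exact: cschB|apply: cschZ; exact: csch_coord].
exists g => // xi eta.
pose y r := eta - (xi - r *: 'e_k).
have yE r : y r = (eta - xi) + r *: 'e_k by rewrite /y opprB addrCA addrC.
pose G (p : 'rV[R]_n.+1 * measurableTypeR R) := real_complex R (gexp p.2) *
  (g (heis_point p.1 (y p.2)) * expi (dot p.1 (frequency (xi - p.2 *: 'e_k) eta))).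
have inner_eq v : f (heis_point v (eta - xi)) * expi (dot v (frequency xi eta)) =
    cintegral leb1 setT (fun r => G (v, r)).
  (* along the line the point moves in the coordinate [y_k], and the phase
     varies at the rate [c] *)
  pose c := - (lambda / 2) * v 0 (lift ord0 k).
  pose p0 := heis_point v (eta - xi).
  pose u r := f (p0 + r *: 'e_(ycoord k)) * expi (c * r + dot v (frequency xi eta)).
  pose u' r := cpartial (ycoord k) f (p0 + r *: 'e_(ycoord k)) *
      expi (c * r + dot v (frequency xi eta)) +
    f (p0 + r *: 'e_(ycoord k)) * (imag c * expi (c * r + dot v (frequency xi eta))).
  have du : cderiv u u' by apply: cderivM; [exact: csch_along_line|exact: cderiv_expi].
  have cl h : csch h -> ccontinuous (fun r : R => h (p0 + r *: 'e_(ycoord k))).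
    move=> /csch_continuous[c1 c2]; split => r.
      exact: (continuous_comp (@continuous_line R _ (ycoord k) p0 r) (c1 _)).
    exact: (continuous_comp (@continuous_line R _ (ycoord k) p0 r) (c2 _)).
  have cu' : ccontinuous u'.
    apply: ccontinuousD; apply: ccontinuousM; try exact: cl;
      [exact: ccontinuous_expi_affine|].
    by apply: ccontinuousM; [exact: ccontinuous_cst|exact: ccontinuous_expi_affine].
  have [C1 C10 h1] := csch_decay cf; have [C2 C20 h2] := csch_decay cf'.
  have b1 p : normc (f p) <= C1.
    by rewrite (le_trans (h1 _))// ler_piMr// cauchy_weight_le1.
  have b2 p : normc (cpartial (ycoord k) f p) <= C2.
    by rewrite (le_trans (h2 _))// ler_piMr// cauchy_weight_le1.
  have -> : f (heis_point v (eta - xi)) * expi (dot v (frequency xi eta)) = u 0.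
    by rewrite /u scale0r addr0 mulr0 add0r.
  rewrite -(@cexp_resolvent R u u' (C1 + C2 + C1 * `|c|) du cu').
  - apply: eq_cintegral => r _; rewrite /G /=; congr (_ * _).
    have pE : heis_point v (y r) = p0 + r *: 'e_(ycoord k).
      by rewrite yE heis_point_shifty.
    have eE : dot v (frequency (xi - r *: 'e_k) eta) = c * r + dot v (frequency xi eta).
      rewrite frequency_shift dotC dot_shift dotC; congr (_ + _).
      by rewrite /c; ring.
    rewrite pE eE /u /u' /g -pE /x heis_point_vcoord pE.
    have -> : imag c = - (imag (lambda / 2) * real_complex R (v 0 (lift ord0 k))).
      by apply: complexP; rewrite /c !cE; ring.
    ring.
  - move=> r; rewrite normcM' normc_expi mulr1 (le_trans (b1 _))//.
    by rewrite -addrA lerDl addr_ge0// mulr_ge0.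
  - move=> r; rewrite (le_trans (normcD_le _ _))// !normcM' normc_expi normc_imag !mulr1.
    rewrite lerD//; first by rewrite (le_trans (b2 _))// lerDr.
    by rewrite ler_wpM2r.
rewrite /K /Phi (eq_cintegral _ (h := fun v => cintegral leb1 setT (fun r => G (v, r)))) => [|v _]; last exact: inner_eq.
have [C C0 hC] := csch_heis_decay_v cg.
have my : measurable_fun setT (fun p : 'rV[R]_n.+1 * measurableTypeR R => xi - p.2 *: 'e_k).
  by apply: measurable_fun_rVB => //; exact: measurable_fun_rVZ.
have mgexp : measurable_fun setT (fun p : 'rV[R]_n.+1 * measurableTypeR R => gexp p.2).
  exact: (measurableT_comp (@measurable_gexp R)).
have mG : cmeasurable G.
  apply: cmeasurableM; first exact: cmeasurable_real.
  apply: cmeasurableM.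
    apply: (cmeasurable_comp (cmeasurable_continuous (csch_continuous cg))).
    by apply: measurable_heis_point => //; exact: measurable_fun_rVB.
  apply: cmeasurable_expi; apply: measurable_fun_dot => //.
  apply: measurable_fun_rV_cons => //; apply: measurable_fun_rVZ => //.
  exact: measurable_fun_rVD.
have iG : cintegrable (lebesgue_rV R n.+1 \x leb1)%E setT G.
  apply: (cintegrable_fibered (a := fun v : 'rV[R]_n.+1 => C * cauchy_weight v)
    (u := fun p : 'rV[R]_n.+1 * measurableTypeR R => gexp p.2) (C := 1)) => //.
  - by apply: measurable_funM => //; exact: measurable_cauchy_weight.
  - by move=> v; rewrite mulr_ge0// cauchy_weight_ge0.
  - by move=> p; exact: gexp_ge0.
  - move=> v r; rewrite /G !normcM' normc_expi mulr1 normc_real ger0_norm ?gexp_ge0//.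
    by rewrite mulrC ler_wpM2r ?gexp_ge0// hC.
  - by move=> v; rewrite integral_gexp.
  - exact: integral_cauchy_weight_lty.
rewrite (cfubini_swap iG); apply: eq_cintegral => r _.
by rewrite /G /= cintegralZ//; exact: Phi_integrable.
Qed.

End kernel.

Section kernel_factorisation.
Variables (R : realType) (n : nat) (lambda : R).
Local Notation leb1 := (@lebesgue_measure R).
Implicit Types (f g h : heisenberg R n -> R[i]) (xi eta : 'rV[R]_n).

(** Directions are taken along an arbitrary map [w], which allows an induction on
    the number of directions. *)
Definition coordinate_sum m (w : 'I_m -> 'I_n) (r : 'rV[R]_m) : 'rV[R]_n :=
  \sum_i r 0 i *: 'e_(w i).

Lemma coordinate_sum_cons m (w : 'I_m.+1 -> 'I_n) (p : R * 'rV[R]_m) :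
  coordinate_sum w (rV_cons p) =
  p.1 *: 'e_(w ord0) + coordinate_sum (w \o lift ord0) p.2.
Proof.
rewrite /coordinate_sum big_ord_recl rV_cons0; congr (_ + _).
by apply: eq_bigr => i _; rewrite rV_consS.
Qed.

Lemma measurable_coordinate_sum d (T : measurableType d) m (w : 'I_m -> 'I_n)
    (r : T -> 'rV[R]_m) : measurable_fun setT r ->
  measurable_fun setT (fun x => coordinate_sum w (r x)).
Proof.
move=> mr; apply: measurable_fun_rV => j; rewrite /coordinate_sum.
under eq_fun do rewrite summxE.
apply: measurable_sum => i; apply: measurable_fun_coord.
by apply: measurable_fun_rVZ => //; exact: measurable_fun_coord.
Qed.

Lemma K_bounded f : csch f -> exists2 C : R, 0 <= C & forall xi eta, normc (K lambda f xi eta) <= C.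
Proof. by move=> /Phi_bounded[C C0 h]; exists C => // xi eta; exact: h. Qed.

Lemma K_resolvent m (w : 'I_m -> 'I_n) f : csch f -> exists2 h, csch h & forall xi eta,
  K lambda f xi eta = cintegral (lebesgue_rV R m) setT (fun r =>
    real_complex R (green r) * K lambda h (xi - coordinate_sum w r) eta).
Proof.
elim: m w f => [|m ih] w f cf.
  exists f => // xi eta.
  have E (r : 'rV[R]_0) : real_complex R (green r) * K lambda f (xi - coordinate_sum w r) eta =
      K lambda f xi eta.
    by rewrite /green /coordinate_sum !big_ord0 subr0 mul1r.
  have T1 : fine (lebesgue_rV R 0 [set: 'rV[R]_0]) = 1 by rewrite [lebesgue_rV _ _ _]diracT.
  by apply: complexP; rewrite ?cRe_int ?cIm_int -[LHS]mulr1 -T1 -Rintegral_cst//;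
    apply: eq_Rintegral => r _; rewrite E.
have [g cg gE] := K_resolvent1 lambda (w ord0) cf.
have [h ch hE] := ih (w \o lift ord0) g cg.
exists h => // xi eta; have [C C0 hC] := K_bounded ch.
have int_green k : (\int[lebesgue_rV R k]_r (green r * C)%:E < +oo)%E.
  under eq_integral do rewrite mulrC.
  apply: ge0_integral_scale_lty => //; first exact: measurable_green.
    by move=> r; exact: green_ge0.
  by rewrite integral_green ltry.
pose F (r : 'rV[R]_m.+1) := real_complex R (green r) * K lambda h (xi - coordinate_sum w r) eta.
have mF : cmeasurable F.
  apply: cmeasurableM; first by apply: cmeasurable_real; exact: measurable_green.
  apply: cmeasurable_K => //; apply: measurable_fun_rVB => //.
  exact: measurable_coordinate_sum.
have iF : cintegrable (lebesgue_rV R m.+1) setT F.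
  apply: (@cintegrable_le _ _ R _ F (fun r => green r * C) mF).
  - by apply: measurable_funM => //; exact: measurable_green.
  - move=> r; rewrite /F normcM' normc_real ger0_norm ?green_ge0//.
    by rewrite ler_wpM2l ?green_ge0.
  - exact: int_green.
have ip : cintegrable (leb1 \x lebesgue_rV R m)%E setT (fun p => F (rV_cons p)).
  have := cintegrable_normc_lty iF.
  rewrite (ge0_integral_image (@rV_cons_measurable R m) (@lebesgue_rV_consE R m)).
  - apply: cintegrable_lty; exact: (cmeasurable_comp mF (@rV_cons_measurable R m)).
  - exact/measurable_EFinP/measurable_normc.
  - by move=> v; rewrite lee_fin normc_ge0.
rewrite (cintegral_image (@rV_cons_measurable R m) (@lebesgue_rV_consE R m) mF).
rewrite -(cfubini ip).2 gE; apply: eq_cintegral => r0 _; rewrite hE.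
have i0 : cintegrable (lebesgue_rV R m) setT (fun y => real_complex R (green y) *
    K lambda h (xi - r0 *: 'e_(w ord0) - coordinate_sum (w \o lift ord0) y) eta).
  apply: (@cintegrable_le _ _ R _ _ (fun r => green r * C)).
  - apply: cmeasurableM; first by apply: cmeasurable_real; exact: measurable_green.
    apply: cmeasurable_K => //; apply: measurable_fun_rVB => //.
    exact: measurable_coordinate_sum.
  - by apply: measurable_funM => //; exact: measurable_green.
  - move=> r; rewrite normcM' normc_real ger0_norm ?green_ge0//.
    by rewrite ler_wpM2l ?green_ge0.
  - exact: int_green.
rewrite -(cintegralZ _ i0); apply: eq_cintegral => y _.
rewrite /F coordinate_sum_cons /= mulrA -real_complexM opprD addrA.
congr (real_complex R _ * _); rewrite /green big_ord_recl rV_cons0; congr (_ * _).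
by apply: eq_bigr => i _; rewrite rV_consS.
Qed.

Lemma coordinate_sum_id (r : 'rV[R]_n) : coordinate_sum id r = r.
Proof. by rewrite /coordinate_sum [RHS]row_sum_delta. Qed.

(** The kernel factors through a Green function that is square integrable and
    translation invariant: this exhibits [fourier f lambda] as a superposition
    of rank-one operators indexed by [s]. *)
Lemma K_green f : csch f -> exists2 h, csch h & forall xi eta,
  K lambda f xi eta = cintegral (lebesgue_rV R n) setT (fun s =>
    real_complex R (green (xi - s)) * K lambda h s eta).
Proof.
move=> cf; have [h ch hE] := @K_resolvent n id f cf; exists h; [exact: ch|move=> xi eta].
rewrite hE (cintegral_rV_reflect xi).
  by apply: eq_cintegral => s _; rewrite coordinate_sum_id subKr.
apply: cmeasurableM; first by apply: cmeasurable_real; exact: measurable_green.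
apply: cmeasurable_K => //; apply: measurable_fun_rVB => //.
exact: measurable_coordinate_sum.
Qed.

End kernel_factorisation.

(** * The Fourier transform as an integral operator *)

Section fourier_kernel.
Variables (R : realType) (n : nat).
Local Notation vect := ('rV[R]_n -> R[i]).
Local Notation leb := (lebesgue_rV R n).
Implicit Types (phi psi : vect) (p q : heisenberg R n) (f : heisenberg R n -> R[i]).

Lemma hx_heis_point (v : 'rV[R]_n.+1) (y : 'rV[R]_n) : hx (heis_point v y) = rV_tail v.
Proof. by rewrite /hx /heis_point !row_mxKl. Qed.
Lemma hy_heis_point (v : 'rV[R]_n.+1) (y : 'rV[R]_n) : hy (heis_point v y) = y.
Proof. by rewrite /hy /heis_point row_mxKl row_mxKr. Qed.
Lemma ht_heis_point (v : 'rV[R]_n.+1) (y : 'rV[R]_n) : ht (heis_point v y) = rV_head v.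
Proof. by rewrite /ht /heis_point row_mxKr mxE. Qed.

Lemma heis_pointK p : heis_point (rV_cons (ht p, hx p)) (hy p) = p.
Proof.
rewrite /heis_point rV_tail_cons rV_head_cons /hx /hy hsubmxK -[RHS]hsubmxK.
by congr row_mx; apply: rV_eqP => j; rewrite mxE (ord1 j).
Qed.

Lemma dot_rV_cons (v : 'rV[R]_n.+1) (t : R) (x : 'rV[R]_n) :
  dot v (rV_cons (t, x)) = t * rV_head v + dot (rV_tail v) x.
Proof.
rewrite /dot big_ord_recl rV_cons0 mulrC; congr (_ + _).
by apply: eq_bigr => i _; rewrite rV_consS mxE.
Qed.

Lemma rho_heis_point (lambda : R) v y phi xi :
  rho lambda (heis_point v y) phi xi =
  expi (dot v (frequency lambda xi (xi + y))) * phi (xi + y).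
Proof.
rewrite /rho hx_heis_point hy_heis_point ht_heis_point; congr (expi _ * _).
by rewrite dot_rV_cons dotZr !dotDr; field.
Qed.

Lemma Phi_decay_y f : csch f -> exists2 C : R, 0 <= C &
  forall z y, normc (Phi f z y) <= C * cauchy_weight y.
Proof.
move=> cf; have [C C0 h] := csch_heis_decay cf.
exists (2 * fine (\int[lebesgue_rV R n.+1]_v (C * cauchy_weight v)%:E)).
  rewrite mulr_ge0// fine_ge0//; apply: integral_ge0 => v _.
  by rewrite lee_fin mulr_ge0// cauchy_weight_ge0.
move=> z y; have mcw := @measurable_cauchy_weight R n.+1.
have E : (\int[lebesgue_rV R n.+1]_v (C * cauchy_weight v * cauchy_weight y)%:E =
    (fine (\int[lebesgue_rV R n.+1]_v (C * cauchy_weight v)%:E) * cauchy_weight y)%:E)%E.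
  under eq_integral do rewrite EFinM.
  rewrite ge0_integralZr ?lee_fin ?cauchy_weight_ge0//.
  - rewrite EFinM fineK// ge0_fin_numE ?integral_cauchy_weight_lty//.
    by apply: integral_ge0 => v _; rewrite lee_fin mulr_ge0// cauchy_weight_ge0.
  - by apply/measurable_EFinP; exact: measurable_funM.
  - by move=> v _; rewrite lee_fin mulr_ge0// cauchy_weight_ge0.
apply: le_trans (normc_cintegral_le (u := fun v => C * cauchy_weight v * cauchy_weight y) _ _ _ _) _.
- exact/cmeasurable_continuous/ccontinuous_Phi_integrand.
- by apply: measurable_funM => //; exact: measurable_funM.
- by move=> v; rewrite normcM' normc_expi mulr1.
- by rewrite E ltry.
- by rewrite E /= mulrA.
Qed.

Lemma csch_integral_lty f : csch f ->
  (\int[lebesgue_rV R (n + n + 1)]_p (normc (f p))%:E < +oo)%E.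
Proof.
move=> cf; have [C C0 h] := csch_decay cf.
apply: le_lt_trans (integral_cauchy_weight_lty (n + n + 1) C0).
apply: ge0_le_integral => //.
- by move=> p _; rewrite lee_fin normc_ge0.
- apply/measurable_EFinP/measurable_normc/cmeasurable_continuous.
  exact: csch_continuous.
- by apply/measurable_EFinP; apply: measurable_funM => //; exact: measurable_cauchy_weight.
- by move=> p _; rewrite lee_fin.
Qed.

Lemma lebesgue_heisenberg_swap (A : set (heisenberg R n)) : measurable A ->
  lebesgue_rV R (n + n + 1) A = (leb \x lebesgue_rV R n.+1)%E
    ((fun p : 'rV[R]_n * 'rV[R]_n.+1 => heis_point p.2 p.1) @^-1` A).
Proof.
move=> mA; have mk : measurable_fun setT
    (fun p : 'rV[R]_n * 'rV[R]_n.+1 => heis_point p.2 p.1).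
  exact: measurable_heis_point.
have mkA : measurable ((fun p : 'rV[R]_n * 'rV[R]_n.+1 => heis_point p.2 p.1) @^-1` A).
  by rewrite -[X in measurable X]setTI; exact: mk.
rewrite -[in LHS](setIT A) -[in RHS](setIT (_ @^-1` A)) -!integral_indic//.
rewrite ge0_integral_heisenberg//; last exact/measurable_EFinP.
rewrite (fubini_tonelli1 (fun p : 'rV[R]_n * 'rV[R]_n.+1 =>
  (\1_((fun p : 'rV[R]_n * 'rV[R]_n.+1 => heis_point p.2 p.1) @^-1` A) p)%:E))//.
by apply/measurable_EFinP; exact: measurable_indic.
Qed.

Section kernel_form.
Variables (lambda : R) (f : heisenberg R n -> R[i]) (phi psi : vect).
Hypotheses (cf : csch f) (lphi : L2 phi) (lpsi : L2 psi).

Let mf : cmeasurable f := cmeasurable_continuous (csch_continuous cf).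
Let mphi : cmeasurable phi := L2_measurable lphi.
Let mpsi : cmeasurable psi := L2_measurable lpsi.

Let u (y xi : 'rV[R]_n) : R := normc (phi (xi + y)) ^+ 2 + normc (psi xi) ^+ 2.

Let u0 y xi : 0 <= u y xi. Proof. by rewrite addr_ge0// sqr_ge0. Qed.

Let mu d (T : measurableType d) (y xi : T -> 'rV[R]_n) : measurable_fun setT y ->
  measurable_fun setT xi -> measurable_fun setT (fun w => u (y w) (xi w)).
Proof.
move=> my mxi; apply: measurable_funD; apply: measurable_funX; apply: measurable_normc.
  by apply: (cmeasurable_comp mphi); exact: measurable_fun_rVD.
exact: cmeasurable_comp mpsi mxi.
Qed.

Let int_u y : (\int[leb]_xi (u y xi)%:E = (sqnorm phi + sqnorm psi)%:E)%E.
Proof.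
have m1 := measurable_sqr_normc mphi.
rewrite EFinD !sqnormK// [X in (X + _)%E](ge0_integral_rV_shift y)//; last first.
  by move=> x; rewrite lee_fin sqr_ge0.
rewrite -ge0_integralD//.
- by move=> x _; rewrite lee_fin sqr_ge0.
- apply/measurable_EFinP; apply: measurable_funX; apply: measurable_normc.
  by apply: (cmeasurable_comp mphi); exact: measurable_fun_rVD.
- by move=> x _; rewrite lee_fin sqr_ge0.
- exact: measurable_sqr_normc.
Qed.

Let pair_le y xi : normc (phi (xi + y) * conjc (psi xi)) <= u y xi.
Proof. by rewrite normcM' normc_conj mulr_le_sqrD ?normc_ge0. Qed.

Lemma K_phi_integrable xi : cintegrable leb setT (fun eta => K lambda f xi eta * phi eta).
Proof.
have [C C0 hC] := Phi_decay_y cf.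
have mK : cmeasurable (fun eta => K lambda f xi eta) by exact: cmeasurable_K.
have mcw : measurable_fun setT (fun eta : 'rV[R]_n => C * cauchy_weight (eta - xi)).
  apply: measurable_funM => //.
  by apply: (measurableT_comp (@measurable_cauchy_weight R n)); exact: measurable_fun_rVB.
have LK : L2 (fun eta => K lambda f xi eta).
  apply: (L2_le mK mcw); first by move=> eta; exact: hC.
  have CC : 0 <= C ^+ 2 by exact: sqr_ge0.
  apply: le_lt_trans (integral_cauchy_weight_lty n CC).
  rewrite [leRHS](ge0_integral_rV_shift (- xi)); last 2 first.
  - by apply/measurable_EFinP/measurable_funM => //; exact: measurable_cauchy_weight.
  - by move=> x; rewrite lee_fin mulr_ge0// cauchy_weight_ge0.
  apply: ge0_le_integral => //.
  - by move=> x _; rewrite lee_fin sqr_ge0.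
  - by apply/measurable_EFinP/measurable_funX.
  - apply/measurable_EFinP; apply: measurable_funM => //.
    by apply: (measurableT_comp (@measurable_cauchy_weight R n)); exact: measurable_fun_rVD.
  - move=> x _; rewrite lee_fin exprMn ler_wpM2l// expr2.
    by rewrite ler_piMr ?cauchy_weight_ge0 ?cauchy_weight_le1.
have := L2_cintegrable LK (L2_conj lphi).
by under eq_fun do rewrite conjcK.
Qed.

(** Fubini, first in [v] for fixed [(y, xi)], which produces [Phi], then in [y]
    for fixed [xi], where [eta = xi + y]. *)
Lemma fourier_kernel_form :
  inner (fourier f lambda phi) psi = cintegral leb setT (fun xi =>
    cintegral leb setT (fun eta => K lambda f xi eta * phi eta) * conjc (psi xi)).
Proof.
have [_ /(_ _ lpsi) [_ ->]] := fourier_spec lambda mf (csch_integral_lty cf) lphi.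
pose pr xi y := phi (xi + y) * conjc (psi xi).
pose F p := inner (fun xi => f p * rho lambda p phi xi) psi.
have mpr d (T : measurableType d) (y xi : T -> 'rV[R]_n) : measurable_fun setT y ->
    measurable_fun setT xi -> cmeasurable (fun w => pr (xi w) (y w)).
  move=> my mxi; apply: cmeasurableM.
    by apply: (cmeasurable_comp mphi); exact: measurable_fun_rVD.
  by apply: cmeasurable_conj; exact: cmeasurable_comp mpsi mxi.
pose G y (p : 'rV[R]_n.+1 * 'rV[R]_n) := f (heis_point p.1 y) *
   expi (dot p.1 (frequency lambda p.2 (p.2 + y))) * pr p.2 y.
have FG v y : F (heis_point v y) = cintegral leb setT (fun xi => G y (v, xi)).
  apply: eq_cintegral => xi _; rewrite rho_heis_point /G /pr /= !mulrA //.
have mF : cmeasurable F.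
  apply: (cmeasurable_cintegral leb (g := fun p : heisenberg R n * 'rV[R]_n =>
    f p.1 * rho lambda p.1 phi p.2 * conjc (psi p.2))).
  apply: cmeasurableM; last by apply: cmeasurable_conj; exact: cmeasurable_comp mpsi _.
  by apply: cmeasurableM; [exact: cmeasurable_comp mf _|exact: cmeasurable_rho].
have mheis : measurable_fun setT (fun p : 'rV[R]_n * 'rV[R]_n.+1 => heis_point p.2 p.1).
  exact: measurable_heis_point.
have [C C0 hC] := csch_heis_decay cf.
have sq0 : 0 <= sqnorm phi + sqnorm psi by rewrite addr_ge0// sqnorm_ge0.
have iF : cintegrable (leb \x lebesgue_rV R n.+1)%E setT
      (fun p : 'rV[R]_n * 'rV[R]_n.+1 => F (heis_point p.2 p.1)).
  apply: (cintegrable_fibered (a := fun y => cauchy_weight y)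
    (u := fun p : 'rV[R]_n * 'rV[R]_n.+1 => C * cauchy_weight p.2 * (sqnorm phi + sqnorm psi))
    (C := fine (\int[lebesgue_rV R n.+1]_v (C * (sqnorm phi + sqnorm psi) * cauchy_weight v)%:E))).
  - exact: cmeasurable_comp mF mheis.
  - exact: measurable_cauchy_weight.
  - apply: measurable_funM => //; apply: measurable_funM => //.
    exact: (measurableT_comp (@measurable_cauchy_weight R n.+1)).
  - by move=> y; exact: cauchy_weight_ge0.
  - by move=> p; rewrite mulr_ge0// mulr_ge0// cauchy_weight_ge0.
  - move=> y v /=; rewrite /F innerZl//; last exact: L2_rho.
    rewrite normcM' (_ : _ * (_ * _) = C * cauchy_weight v * cauchy_weight y *
      (sqnorm phi + sqnorm psi)); last by ring.
    apply: ler_pM; rewrite ?normc_ge0//.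
    have := normc_inner_le ltr01 (L2_rho lambda (heis_point v y) lphi) lpsi.
    by rewrite mul1r invr1 mul1r /sqnorm energy_rho.
  - move=> y; rewrite fineK.
      by under eq_integral do rewrite /= mulrAC.
    rewrite ge0_fin_numE ?integral_cauchy_weight_lty ?mulr_ge0//.
    by apply: integral_ge0 => v _; rewrite lee_fin !mulr_ge0 ?cauchy_weight_ge0// mulr_ge0.
  - have := @integral_cauchy_weight_lty R n 1 ler01.
    by under eq_integral do rewrite mul1r.
rewrite (cintegral_image mheis lebesgue_heisenberg_swap mF) -(cfubini iF).2 /=.
pose H (p : 'rV[R]_n * 'rV[R]_n) := Phi f (frequency lambda p.2 (p.2 + p.1)) p.1 * pr p.2 p.1.
have mH : cmeasurable H.
  apply: cmeasurableM; last exact: mpr.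
  apply: cmeasurable_Phi => //; apply: measurable_fun_rV_cons => //.
  by apply: measurable_fun_rVZ => //; do 2 apply: measurable_fun_rVD => //.
transitivity (cintegral leb setT (fun y => cintegral leb setT (fun xi => H (y, xi)))).
  apply: eq_cintegral => y _; under eq_cintegral do rewrite FG.
  have iG : cintegrable (lebesgue_rV R n.+1 \x leb)%E setT (G y).
    apply: (cintegrable_fibered (a := fun v : 'rV[R]_n.+1 => C * cauchy_weight v)
      (u := fun p : 'rV[R]_n.+1 * 'rV[R]_n => u y p.2)
      (C := sqnorm phi + sqnorm psi)).
    - apply: cmeasurableM; last exact: mpr.
      apply: cmeasurableM.
        by apply: (cmeasurable_comp mf); exact: measurable_heis_point.
      apply: cmeasurable_expi; apply: measurable_fun_dot => //.
      apply: measurable_fun_rV_cons => //; apply: measurable_fun_rVZ => //.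
      by do 2 apply: measurable_fun_rVD => //.
    - by apply: measurable_funM => //; exact: measurable_cauchy_weight.
    - exact: mu.
    - by move=> v; rewrite mulr_ge0// cauchy_weight_ge0.
    - by move=> p; exact: u0.
    - move=> v xi /=; rewrite /G /= !normcM' normc_expi mulr1 -normcM'.
      apply: ler_pM; rewrite ?normc_ge0//.
        by rewrite (le_trans (hC v y))// ler_piMr ?cauchy_weight_le1// mulr_ge0// cauchy_weight_ge0.
    - by move=> v; rewrite int_u.
    - exact: integral_cauchy_weight_lty.
  rewrite (cfubini_swap iG); apply: eq_cintegral => xi _.
  rewrite /G /H /= mulrC -cintegralZ; last exact: Phi_integrable.
  by apply: eq_cintegral => v _; rewrite mulrC.
have [C' C'0 hC'] := Phi_decay_y cf.
have iH : cintegrable (leb \x leb)%E setT H.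
  apply: (cintegrable_fibered (a := fun y : 'rV[R]_n => C' * cauchy_weight y)
      (u := fun p : 'rV[R]_n * 'rV[R]_n => u p.1 p.2)
      (C := sqnorm phi + sqnorm psi)) => //.
  - by apply: measurable_funM => //; exact: measurable_cauchy_weight.
  - exact: mu.
  - by move=> y; rewrite mulr_ge0// cauchy_weight_ge0.
  - by move=> y xi; rewrite /H /= normcM'; apply: ler_pM; rewrite ?normc_ge0//; exact: pair_le.
  - by move=> y; rewrite int_u.
  - exact: integral_cauchy_weight_lty.
rewrite (cfubini_swap iH); apply: eq_cintegral => xi _.
rewrite (cintegral_rV_shift (- xi)); last first.
  exact: (cmeasurable_comp mH (pair2_measurable xi)).
have iK : cintegrable leb setT (fun eta => K lambda f xi eta * phi eta).
  exact: K_phi_integrable.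
rewrite mulrC -cintegralZ//; apply: eq_cintegral => eta _.
by rewrite /H /pr /= [xi + _]addrC subrK mulrA mulrC.
Qed.

End kernel_form.

End fourier_kernel.

(** * Superposition of rank-one operators *)

Section rank_one_superposition.
Variables (R : realType) (n : nat) (lambda : R).
Local Notation vect := ('rV[R]_n -> R[i]).
Local Notation leb := (lebesgue_rV R n).
Implicit Types (phi psi : vect) (p : heisenberg R n) (s xi eta : 'rV[R]_n).
Variables f h : heisenberg R n -> R[i].
Hypotheses (l0 : lambda != 0) (cf : csch f) (ch : csch h).
Hypothesis Kfh : forall xi eta, K lambda f xi eta =
  cintegral leb setT (fun s => real_complex R (green (xi - s)) * K lambda h s eta).

Local Notation cw x := (cauchy_weight (lambda *: x)).

(** The two functionals of the rank-one operator of index [s]: [psi] is tested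
    against a translate of [green], and [phi] against a row of the kernel. *)
Definition row_coef phi s := cintegral leb setT (fun eta => K lambda h s eta * phi eta).
Definition column_coef psi s :=
  cintegral leb setT (fun xi => real_complex R (green (xi - s)) * conjc (psi xi)).

Let measurable_cw d (T : measurableType d) (x : T -> 'rV[R]_n) :
  measurable_fun setT x -> measurable_fun setT (fun w => cw (x w)).
Proof.
move=> mx; apply: (measurableT_comp (@measurable_cauchy_weight R n)).
exact: measurable_fun_rVZ.
Qed.

Let measurable_sqrn d (T : measurableType d) phi (x : T -> 'rV[R]_n) :
  cmeasurable phi -> measurable_fun setT x ->
  measurable_fun setT (fun w => normc (phi (x w)) ^+ 2).
Proof.
by move=> mphi mx; apply/measurable_funX/measurable_normc; exact: cmeasurable_comp mphi mx.
Qed.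

Let measurable_greenB d (T : measurableType d) (x y : T -> 'rV[R]_n) :
  measurable_fun setT x -> measurable_fun setT y ->
  measurable_fun setT (fun w => green (x w - y w)).
Proof.
move=> mx my; apply: (measurableT_comp (@measurable_green R n)).
exact: measurable_fun_rVB.
Qed.

Let W := fine (\int[leb]_x (cw x)%:E).
Let WE : (W%:E = \int[leb]_x (cw x)%:E)%E.
Proof.
rewrite fineK// ge0_fin_numE; first exact: integral_scaled_cauchy_weight_lty.
by apply: integral_ge0 => x _; rewrite lee_fin cauchy_weight_ge0.
Qed.
Let W0 : 0 <= W.
Proof. by rewrite -lee_fin WE; apply: integral_ge0 => x _; rewrite lee_fin cauchy_weight_ge0. Qed.

Let G := fine (\int[leb]_x (green x ^+ 2)%:E).
Let GE s : (\int[leb]_x (green (x - s) ^+ 2)%:E = G%:E)%E.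
Proof.
rewrite -(ge0_integral_rV_shift (- s) (u := fun x => (green x ^+ 2)%:E)).
- rewrite /G fineK// ge0_fin_numE; first exact: integral_sqr_green_lty.
  by apply: integral_ge0 => x _; rewrite lee_fin sqr_ge0.
- by apply/measurable_EFinP; apply: measurable_funX; exact: measurable_green.
- by move=> x; rewrite lee_fin sqr_ge0.
Qed.
Let G0 : 0 <= G.
Proof. by rewrite -lee_fin -(GE 0); apply: integral_ge0 => x _; rewrite lee_fin sqr_ge0. Qed.

Let row_bound phi eta : R := cw eta + normc (phi eta) ^+ 2.

Let int_row_bound phi : L2 phi ->
  (\int[leb]_eta (row_bound phi eta)%:E = (W + sqnorm phi)%:E)%E.
Proof.
move=> lphi; have mphi := L2_measurable lphi; rewrite EFinD WE sqnormK//.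
rewrite -ge0_integralD//.
- by move=> x _; rewrite lee_fin cauchy_weight_ge0.
- by apply/measurable_EFinP; exact: measurable_cw.
- by move=> x _; rewrite lee_fin sqr_ge0.
- exact: measurable_sqr_normc.
Qed.

Let column_bound psi s xi : R := green (xi - s) ^+ 2 + normc (psi xi) ^+ 2.

Let int_column_bound psi s : L2 psi ->
  (\int[leb]_xi (column_bound psi s xi)%:E = (G + sqnorm psi)%:E)%E.
Proof.
move=> lpsi; have mpsi := L2_measurable lpsi; rewrite EFinD -(GE s) sqnormK//.
rewrite -ge0_integralD//.
- by move=> x _; rewrite lee_fin sqr_ge0.
- by apply/measurable_EFinP; apply: measurable_funX; exact: measurable_greenB.
- by move=> x _; rewrite lee_fin sqr_ge0.
- exact: measurable_sqr_normc.
Qed.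

Let row_le phi : exists2 C, 0 <= C & forall s eta,
  normc (K lambda h s eta * phi eta) <= C * cw s * row_bound phi eta.
Proof.
have [C C0 hC] := K_decay lambda ch; exists C => // s eta.
rewrite normcM'; apply: le_trans (ler_wpM2r (normc_ge0 _) (hC s eta)) _.
rewrite -(mulrA (C * cw s)); apply: ler_wpM2l; first by rewrite mulr_ge0// cauchy_weight_ge0.
apply: le_trans (mulr_le_sqrD _ _) _; rewrite ?cauchy_weight_ge0 ?normc_ge0//.
by rewrite lerD2r expr2 ler_piMr ?cauchy_weight_ge0 ?cauchy_weight_le1.
Qed.

Let column_le psi s xi :
  normc (real_complex R (green (xi - s)) * conjc (psi xi)) <= column_bound psi s xi.
Proof.
rewrite normcM' normc_real normc_conj ger0_norm ?green_ge0//.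
by rewrite mulr_le_sqrD ?green_ge0 ?normc_ge0.
Qed.

Let cmeasurable_column psi d (T : measurableType d) (s xi : T -> 'rV[R]_n) :
  cmeasurable psi -> measurable_fun setT s -> measurable_fun setT xi ->
  cmeasurable (fun w => real_complex R (green (xi w - s w)) * conjc (psi (xi w))).
Proof.
move=> mpsi ms mxi; apply: cmeasurableM.
  by apply: cmeasurable_real; exact: measurable_greenB.
by apply: cmeasurable_conj; exact: cmeasurable_comp mpsi mxi.
Qed.

Let cmeasurable_row phi d (T : measurableType d) (s eta : T -> 'rV[R]_n) :
  cmeasurable phi -> measurable_fun setT s -> measurable_fun setT eta ->
  cmeasurable (fun w => K lambda h (s w) (eta w) * phi (eta w)).
Proof.
move=> mphi ms me; apply: cmeasurableM; first exact: cmeasurable_K.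
exact: cmeasurable_comp mphi me.
Qed.

Lemma cmeasurable_row_coef phi : cmeasurable phi -> cmeasurable (row_coef phi).
Proof.
move=> mphi; apply: (cmeasurable_cintegral leb
  (g := fun w : 'rV[R]_n * 'rV[R]_n => K lambda h w.1 w.2 * phi w.2)).
exact: cmeasurable_row.
Qed.

Lemma row_coef_le phi : L2 phi -> exists2 C, 0 <= C & forall s,
  normc (row_coef phi s) <= C * cw s.
Proof.
move=> lphi; have mphi := L2_measurable lphi; have [C C0 hC] := row_le phi.
exists (2 * (C * (W + sqnorm phi))) => [|s].
  by rewrite !mulr_ge0// addr_ge0// sqnorm_ge0.
have mb : measurable_fun setT (row_bound phi).
  by apply: measurable_funD; [exact: measurable_cw|exact: measurable_sqrn].
have E : (\int[leb]_eta (C * cw s * row_bound phi eta)%:E =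
    (C * cw s * (W + sqnorm phi))%:E)%E.
  rewrite [in RHS]EFinM -int_row_bound// -ge0_integralZl ?lee_fin//.
  - exact/measurable_EFinP.
  - by move=> x _; rewrite lee_fin addr_ge0 ?sqr_ge0 ?cauchy_weight_ge0.
  - by rewrite mulr_ge0// cauchy_weight_ge0.
apply: le_trans (normc_cintegral_le (u := fun eta => C * cw s * row_bound phi eta) _ _ _ _) _.
- exact: cmeasurable_row.
- exact: measurable_funM.
- by move=> eta; exact: hC.
- by rewrite E ltry.
- by rewrite E /= -!mulrA [cw s * _]mulrC.
Qed.

Lemma column_coef_le psi s : L2 psi -> normc (column_coef psi s) <= 2 * (G + sqnorm psi).
Proof.
move=> lpsi; have mpsi := L2_measurable lpsi.
apply: le_trans (normc_cintegral_le (u := column_bound psi s) _ _ _ _) _.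
- exact: cmeasurable_column.
- apply: measurable_funD; last exact: measurable_sqrn.
  by apply: measurable_funX; exact: measurable_greenB.
- by move=> xi; exact: column_le.
- by rewrite int_column_bound// ltry.
- by rewrite int_column_bound.
Qed.

Let integral_cw_lty (C : R) : 0 <= C -> (\int[leb]_s (C * cw s)%:E < +oo)%E.
Proof.
move=> C0; apply: ge0_integral_scale_lty => //; first exact: measurable_cw.
  by move=> s; exact: cauchy_weight_ge0.
exact: integral_scaled_cauchy_weight_lty.
Qed.

Lemma row_integrable phi s : L2 phi ->
  cintegrable leb setT (fun eta => K lambda h s eta * phi eta).
Proof.
move=> lphi; have mphi := L2_measurable lphi; have [C C0 hC] := row_le phi.
apply: (cintegrable_le (u := fun eta => C * row_bound phi eta)).
- exact: cmeasurable_row.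
- apply: measurable_funM => //.
  by apply: measurable_funD; [exact: measurable_cw|exact: measurable_sqrn].
- move=> eta; apply: le_trans (hC s eta) _; rewrite ler_wpM2r//.
    by rewrite addr_ge0 ?sqr_ge0 ?cauchy_weight_ge0.
  by rewrite ler_piMr ?cauchy_weight_le1.
- under eq_integral do rewrite EFinM.
  rewrite ge0_integralZl ?lee_fin//.
  + by rewrite int_row_bound// -EFinM ltry.
  + apply/measurable_EFinP.
    by apply: measurable_funD; [exact: measurable_cw|exact: measurable_sqrn].
  + by move=> eta _; rewrite lee_fin addr_ge0 ?sqr_ge0 ?cauchy_weight_ge0.
Qed.

Let column_integrable psi s : L2 psi ->
  cintegrable leb setT (fun xi => real_complex R (green (xi - s)) * conjc (psi xi)).
Proof.
move=> lpsi; have mpsi := L2_measurable lpsi.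
apply: (cintegrable_le (u := column_bound psi s)).
- exact: cmeasurable_column.
- apply: measurable_funD; last exact: measurable_sqrn.
  by apply: measurable_funX; exact: measurable_greenB.
- by move=> xi; exact: column_le.
- by rewrite int_column_bound// ltry.
Qed.

Let green_integrable xi (g : 'rV[R]_n -> R[i]) (C : R) : 0 <= C -> cmeasurable g ->
  (forall s, normc (g s) <= C * cw s) ->
  cintegrable leb setT (fun s => real_complex R (green (xi - s)) * g s).
Proof.
move=> C0 mg gC; apply: (cintegrable_le (u := fun s => C * cw s)).
- by apply: cmeasurableM => //; apply: cmeasurable_real; exact: measurable_greenB.
- by apply: measurable_funM => //; exact: measurable_cw.
- move=> s; apply: le_trans (gC s).
  by rewrite normcM' normc_real ger0_norm ?green_ge0// ler_piMl ?normc_ge0 ?green_le1.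
- exact: integral_cw_lty.
Qed.

(** Inserting [K_green] into the kernel form and integrating in [s] last. *)
Lemma fourier_rank_one phi psi : L2 phi -> L2 psi ->
  inner (fourier f lambda phi) psi =
  cintegral leb setT (fun s => row_coef phi s * column_coef psi s).
Proof.
move=> lphi lpsi; have mphi := L2_measurable lphi; have mpsi := L2_measurable lpsi.
rewrite fourier_kernel_form//.
have [C C0 hC] := row_le phi; have [C' C'0 hC'] := row_coef_le lphi.
have mrow := cmeasurable_row_coef mphi.
pose g1 xi (w : 'rV[R]_n * 'rV[R]_n) :=
  real_complex R (green (xi - w.1)) * (K lambda h w.1 w.2 * phi w.2).
have ig1 xi : cintegrable (leb \x leb)%E setT (g1 xi).
  apply: (cintegrable_fibered (a := fun s : 'rV[R]_n => C * cw s)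
    (u := fun w : 'rV[R]_n * 'rV[R]_n => row_bound phi w.2) (C := W + sqnorm phi)).
  - apply: cmeasurableM; last exact: cmeasurable_row.
    by apply: cmeasurable_real; exact: measurable_greenB.
  - by apply: measurable_funM => //; exact: measurable_cw.
  - by apply: measurable_funD; [exact: measurable_cw|exact: measurable_sqrn].
  - by move=> s; rewrite mulr_ge0// cauchy_weight_ge0.
  - by move=> w; rewrite addr_ge0 ?sqr_ge0 ?cauchy_weight_ge0.
  - move=> s eta; rewrite /g1 /= normcM' normc_real ger0_norm ?green_ge0//.
    apply: le_trans (hC s eta); rewrite ler_piMl ?normc_ge0 ?green_le1//.
  - by move=> s; rewrite int_row_bound.
  - exact: integral_cw_lty.
have rowE xi : cintegral leb setT (fun eta => K lambda f xi eta * phi eta) =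
    cintegral leb setT (fun s => real_complex R (green (xi - s)) * row_coef phi s).
  transitivity (cintegral leb setT (fun eta => cintegral leb setT (fun s => g1 xi (s, eta)))).
    apply: eq_cintegral => eta _; rewrite Kfh mulrC -cintegralZ; last first.
      have [D D0 hD] := K_decay lambda ch; apply: (green_integrable _ D0).
        exact: cmeasurable_K.
      move=> s; apply: le_trans (hD s eta) _.
      by rewrite ler_piMr ?cauchy_weight_le1// mulr_ge0// cauchy_weight_ge0.
    by apply: eq_cintegral => s _; rewrite /g1 /=; ring.
    rewrite -(cfubini_swap (ig1 xi)); apply: eq_cintegral => s _.
  by rewrite /row_coef -cintegralZ//; exact: row_integrable.
pose g2 (w : 'rV[R]_n * 'rV[R]_n) :=
  row_coef phi w.1 * (real_complex R (green (w.2 - w.1)) * conjc (psi w.2)).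
have ig2 : cintegrable (leb \x leb)%E setT g2.
  apply: (cintegrable_fibered (a := fun s : 'rV[R]_n => C' * cw s)
    (u := fun w : 'rV[R]_n * 'rV[R]_n => column_bound psi w.1 w.2) (C := G + sqnorm psi)).
  - by apply: cmeasurableM; [exact: cmeasurable_comp mrow _|exact: cmeasurable_column].
  - by apply: measurable_funM => //; exact: measurable_cw.
  - apply: measurable_funD; last exact: measurable_sqrn.
    by apply: measurable_funX; exact: measurable_greenB.
  - by move=> s; rewrite mulr_ge0// cauchy_weight_ge0.
  - by move=> w; rewrite addr_ge0 ?sqr_ge0.
  - by move=> s xi; rewrite /g2 /= normcM'; apply: ler_pM; rewrite ?normc_ge0//; exact: column_le.
  - by move=> s; rewrite int_column_bound.
  - exact: integral_cw_lty.
transitivity (cintegral leb setT (fun xi => cintegral leb setT (fun s => g2 (s, xi)))).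
  apply: eq_cintegral => xi _; rewrite rowE mulrC -cintegralZ; last first.
    exact: (green_integrable _ C'0).
  by apply: eq_cintegral => s _; rewrite /g2 /=; ring.
rewrite -(cfubini_swap ig2); apply: eq_cintegral => s _.
by rewrite /column_coef -cintegralZ//; exact: column_integrable.
Qed.

End rank_one_superposition.

(** * The trace formula *)

Section trace_formula.
Variables (R : realType) (n : nat) (lambda : R).
Local Notation vect := ('rV[R]_n -> R[i]).
Local Notation leb := (lebesgue_rV R n).
Implicit Types (phi psi : vect) (p : heisenberg R n) (s xi eta : 'rV[R]_n).
Variables f h : heisenberg R n -> R[i].
Hypotheses (l0 : lambda != 0) (cf : csch f) (ch : csch h).
Hypothesis Kfh : forall xi eta, K lambda f xi eta =
  cintegral leb setT (fun s => real_complex R (green (xi - s)) * K lambda h s eta).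
Variable mu : {finite_measure set (heisenberg R n) -> \bar R}.

Local Notation cw x := (cauchy_weight (lambda *: x)).
Local Notation nu := (mu \x leb)%E.

(* The decay of [K lambda h s] in [s] is shared equally between the two factors:
   the energies of [U] and of [V] are then both of the order of
   [cauchy_weight (lambda *: s)], which is integrable. *)
Let rt s : R := Num.sqrt (cw s).
Let rt_gt0 s : 0 < rt s. Proof. by rewrite sqrtr_gt0 cauchy_weight_gt0. Qed.
Let sqr_rt s : rt s ^+ 2 = cw s. Proof. by rewrite sqr_sqrtr// cauchy_weight_ge0. Qed.
Let rtK s : real_complex R (rt s) * real_complex R (rt s)^-1 = 1.
Proof. by rewrite -rmorphM mulfV ?gt_eqF// rmorph1. Qed.

Let measurable_cw d (T : measurableType d) (x : T -> 'rV[R]_n) :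
  measurable_fun setT x -> measurable_fun setT (fun w => cw (x w)).
Proof.
move=> mx; apply: (measurableT_comp (@measurable_cauchy_weight R n)).
exact: measurable_fun_rVZ.
Qed.

Let measurable_rt d (T : measurableType d) (x : T -> 'rV[R]_n) :
  measurable_fun setT x -> measurable_fun setT (fun w => rt (x w)).
Proof.
by move=> mx; apply: (measurableT_comp (continuous_measurable_fun (@sqrt_continuous R))); exact: measurable_cw.
Qed.

Let greens s xi : R[i] := real_complex R (green (xi - s)).
Let cmeasurable_greens d (T : measurableType d) (s xi : T -> 'rV[R]_n) :
  measurable_fun setT s -> measurable_fun setT xi ->
  cmeasurable (fun w => greens (s w) (xi w)).
Proof.
move=> ms mxi; apply: cmeasurable_real.
by apply: (measurableT_comp (@measurable_green R n)); exact: measurable_fun_rVB.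
Qed.

Let G : \bar R := (\int[leb]_x (green x ^+ 2)%:E)%E.
Let energy_greens s : energy (greens s) = G.
Proof.
rewrite /G (ge0_integral_rV_shift (- s)).
- by apply: eq_integral => x _; rewrite normc_real ger0_norm ?green_ge0.
- by apply/measurable_EFinP; apply: measurable_funX; exact: measurable_green.
- by move=> x; rewrite lee_fin sqr_ge0.
Qed.
Let L2_greens s : L2 (greens s).
Proof.
apply/L2P; split; first exact: cmeasurable_greens.
by rewrite energy_greens; exact: integral_sqr_green_lty.
Qed.

Let U (w : (heisenberg R n * 'rV[R]_n) * 'rV[R]_n) : R[i] :=
  real_complex R (rt w.1.2)^-1 * conjc (K lambda h w.1.2 w.2).
Let Vs s xi : R[i] := real_complex R (rt s) * greens s xi.
Let V (w : (heisenberg R n * 'rV[R]_n) * 'rV[R]_n) : R[i] :=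
  rho lambda (- w.1.1) (Vs w.1.2) w.2.

Let cmeasurable_Vs d (T : measurableType d) (s xi : T -> 'rV[R]_n) :
  measurable_fun setT s -> measurable_fun setT xi -> cmeasurable (fun w => Vs (s w) (xi w)).
Proof.
move=> ms mxi; apply: cmeasurableM; last exact: cmeasurable_greens.
by apply: cmeasurable_real; exact: measurable_rt.
Qed.

Let mU : cmeasurable U.
Proof.
have ms : measurable_fun setT (fun w : heisenberg R n * 'rV[R]_n * 'rV[R]_n => w.1.2).
  exact: measurableT_comp measurable_snd measurable_fst.
apply: cmeasurableM; last by apply: cmeasurable_conj; exact: cmeasurable_K.
apply: cmeasurable_real; under eq_fun do rewrite -powR_inv1 ?ltW//.
by apply: (measurableT_comp (measurable_powR (R := R) (-1))); exact: measurable_rt.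
Qed.

Let mV : cmeasurable V.
Proof.
have mN : measurable_fun setT (fun w : heisenberg R n * 'rV[R]_n * 'rV[R]_n => - w.1.1).
  by apply: measurable_fun_rVN; exact: measurableT_comp measurable_fst measurable_fst.
have ms : measurable_fun setT (fun w : heisenberg R n * 'rV[R]_n * 'rV[R]_n => w.1.2).
  exact: measurableT_comp measurable_snd measurable_fst.
have mc : cmeasurable (fun _ : 'rV[R]_n => 1 : R[i]) by exact: cmeasurable_cst.
have mr := cmeasurable_rho lambda mc mN measurable_snd.
have mv : cmeasurable (fun w : heisenberg R n * 'rV[R]_n * 'rV[R]_n =>
    Vs w.1.2 (w.2 + hy (- w.1.1))).
  by apply: cmeasurable_Vs => //; apply: measurable_fun_rVD => //; exact: measurable_hy.
have := cmeasurableM mr mv.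
by rewrite /V /rho; under eq_fun do rewrite mulr1.
Qed.

Let W := (\int[leb]_x (cw x)%:E)%E.
Let W_lty : (W < +oo)%E. Proof. exact: integral_scaled_cauchy_weight_lty. Qed.
Let W_ge0 : (0 <= W)%E.
Proof. by apply: integral_ge0 => x _; rewrite lee_fin cauchy_weight_ge0. Qed.

Let integral_cw_lty (C : R) : 0 <= C -> (\int[leb]_s (C * cw s)%:E < +oo)%E.
Proof.
move=> C0; apply: ge0_integral_scale_lty => //; first exact: measurable_cw.
by move=> s; exact: cauchy_weight_ge0.
Qed.

Let energy_U : exists2 C : R, 0 <= C & forall p s,
  (energy (fun eta => U ((p, s), eta)) <= (C * cw s)%:E)%E.
Proof.
have [C C0 hC] := K_decay lambda ch.
have CW : 0 <= C ^+ 2 * fine W by rewrite mulr_ge0 ?sqr_ge0// fine_ge0.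
exists (C ^+ 2 * fine W) => // p s.
have c2 : 0 <= C ^+ 2 * cw s by rewrite mulr_ge0 ?sqr_ge0 ?cauchy_weight_ge0.
rewrite mulrAC [leRHS]EFinM fineK ?ge0_fin_numE//.
rewrite -ge0_integralZl ?lee_fin//; last 2 first.
- by apply/measurable_EFinP; exact: measurable_cw.
- by move=> x _; rewrite lee_fin cauchy_weight_ge0.
apply: ge0_le_integral => //.
- by move=> x _; rewrite lee_fin sqr_ge0.
- apply: measurable_sqr_normc.
  exact: (cmeasurable_comp mU (pair1_measurable (p, s))).
- by apply/measurable_EFinP; apply: measurable_funM => //; exact: measurable_cw.
- move=> eta _; rewrite -EFinM lee_fin /U normcM' normc_conj normc_real /= exprMn.
  rewrite ger0_norm ?invr_ge0 ?(ltW (rt_gt0 s))// exprVn sqr_rt ler_pdivrMl ?cauchy_weight_gt0//.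
  apply: (@le_trans _ _ ((C * cw s * cw eta) ^+ 2)).
    by rewrite ler_sqr ?nnegrE ?normc_ge0 ?mulr_ge0 ?cauchy_weight_ge0.
  rewrite (_ : (C * cw s * cw eta) ^+ 2 = (cw s * (C ^+ 2 * cw s * cw eta)) * cw eta);
    last by ring.
  by rewrite ler_piMr ?cauchy_weight_le1 ?mulr_ge0 ?cauchy_weight_ge0 ?sqr_ge0.
Qed.

Let L2_U w : L2 (fun eta => U (w, eta)).
Proof.
have [C _ hC] := energy_U; apply/L2P; split.
  exact: (cmeasurable_comp mU (pair1_measurable w)).
by case: w => p s; apply: le_lt_trans (hC p s) _; rewrite ltry.
Qed.

Let L2_Vs s : L2 (Vs s). Proof. exact: L2Z. Qed.

Let L2_V w : L2 (fun xi => V (w, xi)).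
Proof. exact: (@L2_rho _ _ lambda (- w.1) (Vs w.2) (L2_Vs _)). Qed.

Let energy_V p s : energy (fun xi => V ((p, s), xi)) = ((fine G * cw s)%:E)%E.
Proof.
rewrite /V /= energy_rho; last exact: L2_measurable.
rewrite energyZ ?energy_greens; last exact/L2_measurable.
rewrite normc_real ger0_norm ?(ltW (rt_gt0 s))// sqr_rt mulrC EFinM fineK// ge0_fin_numE.
  exact: integral_sqr_green_lty.
by apply: integral_ge0 => x _; rewrite lee_fin sqr_ge0.
Qed.

Let integral_snd_lty (u : 'rV[R]_n -> R) : measurable_fun setT u -> (forall s, 0 <= u s) ->
  (\int[leb]_s (u s)%:E < +oo)%E -> (\int[nu]_w (u w.2)%:E < +oo)%E.
Proof.
move=> mu' u0 ul; rewrite (fubini_tonelli1 (fun w => (u w.2)%:E)).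
- rewrite /fubini_F /= integral_cst//; apply: lte_mul_pinfty => //.
  + by apply: integral_ge0 => s _; rewrite lee_fin.
  + by rewrite ge0_fin_numE// integral_ge0// => s _; rewrite lee_fin.
  + by rewrite -ge0_fin_numE//; exact: fin_num_measure.
- by apply/measurable_EFinP; exact: measurableT_comp mu' _.
- by move=> w; rewrite lee_fin.
Qed.

Let integral_energy (F : (heisenberg R n * 'rV[R]_n) * 'rV[R]_n -> R[i]) (C : R) :
  0 <= C -> cmeasurable F ->
  (forall p s, (energy (fun xi => F ((p, s), xi)) <= (C * cw s)%:E)%E) ->
  (\int[nu]_w energy (fun xi => F (w, xi)) < +oo)%E.
Proof.
move=> C0 mF FC; apply: (@le_lt_trans _ _ (\int[nu]_w (C * cw w.2)%:E)%E).
  apply: ge0_le_integral => //.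
  - by move=> w _; exact: energy_ge0.
  - apply: (measurable_fun_fubini_tonelli_F (m2 := leb)
      (fun w => (normc (F w) ^+ 2)%:E)); first exact: measurable_sqr_normc.
    by move=> w; rewrite lee_fin sqr_ge0.
  - by apply/measurable_EFinP; apply: measurable_funM => //; exact: measurable_cw.
  - by move=> [p s] _; exact: FC.
apply: (@integral_snd_lty (fun s => C * cw s)) => //.
- by apply: measurable_funM => //; exact: measurable_cw.
- by move=> s; rewrite mulr_ge0// cauchy_weight_ge0.
- exact: integral_cw_lty.
Qed.

Let EU : (\int[nu]_w energy (fun xi => U (w, xi)) < +oo)%E.
Proof. by have [C C0 hC] := energy_U; exact: integral_energy hC. Qed.

Let EV : (\int[nu]_w energy (fun xi => V (w, xi)) < +oo)%E.
Proof.
apply: (@integral_energy V (fine G)) => //; last by move=> p s; rewrite energy_V.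
by rewrite fine_ge0//; apply: integral_ge0 => x _; rewrite lee_fin sqr_ge0.
Qed.

Let inner_U p s phi : L2 phi -> inner phi (fun eta => U ((p, s), eta)) =
  real_complex R (rt s)^-1 * row_coef lambda h phi s.
Proof.
move=> lphi; rewrite /row_coef -cintegralZ; last exact: row_integrable.
apply: eq_cintegral => eta _; rewrite /U conjcM conjcK conjc_real.
by rewrite mulrCA [phi _ * _]mulrC.
Qed.

Let inner_V p s phi : L2 phi -> inner (fun xi => V ((p, s), xi)) phi =
  real_complex R (rt s) * column_coef (rho lambda p phi) s.
Proof.
move=> lphi; rewrite /V /= inner_rho// opprK innerZl//; exact: L2_rho.
Qed.

Let superposition phi : L2 phi ->
  inner ((adjoint (fourier_measure mu lambda) \o fourier f lambda) phi) phi =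
  cintegral nu setT (fun w =>
    inner phi (fun xi => U (w, xi)) * inner (fun xi => V (w, xi)) phi).
Proof.
move=> lphi; have mphi := L2_measurable lphi.
rewrite inner_adjoint_fourier//; last 2 first.
- exact/cmeasurable_continuous/csch_continuous.
- exact: csch_integral_lty.
pose g (w : heisenberg R n * 'rV[R]_n) :=
  row_coef lambda h phi w.2 * column_coef (rho lambda w.1 phi) w.2.
have [C C0 hC] := row_coef_le l0 ch lphi.
have ig : cintegrable nu setT g.
  apply: (cintegrable_fibered (a := fun _ : heisenberg R n => 2 * (fine G + sqnorm phi))
    (u := fun w : heisenberg R n * 'rV[R]_n => C * cw w.2)
    (C := fine (\int[leb]_s (C * cw s)%:E))) => //.
  - apply: cmeasurableM; first exact: (cmeasurable_comp (cmeasurable_row_coef lambda ch mphi) measurable_snd).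
    apply: (cmeasurable_cintegral leb (g := fun w : (heisenberg R n * 'rV[R]_n) * 'rV[R]_n =>
      greens w.1.2 w.2 * conjc (rho lambda w.1.1 phi w.2))).
    have ms : measurable_fun setT (fun w : heisenberg R n * 'rV[R]_n * 'rV[R]_n => w.1.2).
      exact: measurableT_comp measurable_snd measurable_fst.
    apply: cmeasurableM; first exact: cmeasurable_greens.
    apply: cmeasurable_conj; apply: cmeasurable_rho => //.
    exact: measurableT_comp measurable_fst measurable_fst.
  - by apply: measurable_funM => //; exact: measurable_cw.
  - move=> p; rewrite mulr_ge0// addr_ge0 ?sqnorm_ge0// fine_ge0//.
    by apply: integral_ge0 => x _; rewrite lee_fin sqr_ge0.
  - by move=> w; rewrite mulr_ge0// cauchy_weight_ge0.
  - move=> p s; rewrite /g /= normcM' mulrC; apply: ler_pM; rewrite ?normc_ge0//.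
    apply: le_trans (column_coef_le s (L2_rho lambda p lphi)) _.
    by rewrite /sqnorm energy_rho.
  - move=> p; rewrite fineK// ge0_fin_numE ?integral_cw_lty//.
    by apply: integral_ge0 => s _; rewrite lee_fin mulr_ge0// cauchy_weight_ge0.
  - rewrite integral_cst//; apply: lte_mul_pinfty => //.
      rewrite lee_fin mulr_ge0// addr_ge0 ?sqnorm_ge0// fine_ge0//.
      by apply: integral_ge0 => x _; rewrite lee_fin sqr_ge0.
    by rewrite -ge0_fin_numE//; exact: fin_num_measure.
transitivity (cintegral nu setT g).
  rewrite -(cfubini ig).2; apply: eq_cintegral => p _.
  by rewrite (fourier_rank_one l0 cf ch Kfh)//; exact: L2_rho.
apply: eq_cintegral => -[p s] _; rewrite inner_U// inner_V// mulrACA -[_ * real_complex R (rt s)]mulrC.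
by rewrite rtK mul1r.
Qed.

Let has_trace_rank_one :
  has_trace (adjoint (fourier_measure mu lambda) \o fourier f lambda)
    (cintegral nu setT (fun w => inner (fun xi => V (w, xi)) (fun xi => U (w, xi)))).
Proof.
exact: (has_trace_superposition (nu := nu) mU mV L2_U L2_V EU EV superposition).
Qed.

Let phase p xi : R[i] :=
  expi (lambda * (ht (- p) + dot (hx (- p)) xi + dot (hx (- p)) (hy (- p)) / 2)).

Let cmeasurable_phase p : cmeasurable (phase p).
Proof.
apply: cmeasurable_expi; apply: measurable_funM => //; apply: measurable_funD => //.
by apply: measurable_funD => //; exact: measurable_fun_dot.
Qed.

Let inner_VU p s : inner (fun xi => V ((p, s), xi)) (fun xi => U ((p, s), xi)) =
  cintegral leb setT (fun xi =>
    phase p xi * (real_complex R (green (xi - hy p - s)) * K lambda h s xi)).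
Proof.
apply: eq_cintegral => xi _; rewrite /V /U /rho -/(phase p xi) conjcM conjcK conjc_real.
rewrite hyN /Vs /greens /=.
rewrite (_ : _ * _ * _ = real_complex R (rt s) * real_complex R (rt s)^-1 *
  (phase p xi * (real_complex R (green (xi - hy p - s)) * K lambda h s xi))); last by ring.
by rewrite rtK mul1r.
Qed.

Let integrable_VU : cintegrable nu setT
  (fun w => inner (fun xi => V (w, xi)) (fun xi => U (w, xi))).
Proof.
have [C C0 hC] := energy_U.
have G0 : 0 <= fine G.
  by rewrite fine_ge0//; apply: integral_ge0 => x _; rewrite lee_fin sqr_ge0.
apply: (cintegrable_fibered (a := fun _ : heisenberg R n => 1)
  (u := fun w : heisenberg R n * 'rV[R]_n => (fine G + C) * cw w.2)
  (C := fine (\int[leb]_s ((fine G + C) * cw s)%:E))) => //.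
- apply: (cmeasurable_cintegral leb (g := fun w => V w * conjc (U w))).
  by apply: cmeasurableM => //; exact: cmeasurable_conj.
- by apply: measurable_funM => //; exact: measurable_cw.
- by move=> w; rewrite mulr_ge0 ?cauchy_weight_ge0// addr_ge0.
- move=> p s; rewrite mul1r mulrDl.
  apply: le_trans (normc_inner_le ltr01 (L2_V (p, s)) (L2_U (p, s))) _.
  rewrite invr1 !mul1r; apply: lerD.
    by rewrite /sqnorm energy_V.
  by rewrite -lee_fin sqnormK//; exact: hC.
- move=> p; rewrite fineK// ge0_fin_numE ?integral_cw_lty ?addr_ge0//.
  by apply: integral_ge0 => s _; rewrite lee_fin mulr_ge0 ?cauchy_weight_ge0// addr_ge0.
- rewrite integral_cst// mul1e -ge0_fin_numE//; exact: fin_num_measure.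
Qed.

(** Integrating in [s] first undoes the factorisation of the kernel. *)
Let fibre_trace p :
  cintegral leb setT (fun s => inner (fun xi => V ((p, s), xi)) (fun xi => U ((p, s), xi))) =
  cintegral leb setT (fun xi => phase p xi * K lambda f (xi - hy p) xi).
Proof.
have [C C0 hC] := K_decay lambda ch.
have bound s xi (c : R) : 0 <= c -> c <= 1 -> c * normc (K lambda h s xi) <= C * cw s * cw xi.
  move=> c0 c1; apply: le_trans (hC s xi).
  by rewrite ler_piMl ?normc_ge0.
pose g (w : 'rV[R]_n * 'rV[R]_n) :=
  phase p w.2 * (real_complex R (green (w.2 - hy p - w.1)) * K lambda h w.1 w.2).
have ig : cintegrable (leb \x leb)%E setT g.
  apply: (cintegrable_fibered (a := fun s : 'rV[R]_n => C * cw s)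
    (u := fun w : 'rV[R]_n * 'rV[R]_n => cw w.2) (C := fine W)).
  - apply: cmeasurableM; first exact: cmeasurable_comp (cmeasurable_phase p) _.
    apply: cmeasurableM; last exact: cmeasurable_K.
    by apply: cmeasurable_greens => //; exact: measurable_fun_rVB.
  - by apply: measurable_funM => //; exact: measurable_cw.
  - exact: measurable_cw.
  - by move=> s; rewrite mulr_ge0// cauchy_weight_ge0.
  - by move=> w; rewrite cauchy_weight_ge0.
  - move=> s xi; rewrite /g /= normcM' normc_expi mul1r normcM' normc_real ger0_norm ?green_ge0//.
    by apply: bound; rewrite ?green_ge0 ?green_le1.
  - by move=> s; rewrite fineK ?ge0_fin_numE.
  - exact: integral_cw_lty.
under eq_cintegral do rewrite inner_VU.
rewrite (cfubini_swap ig); apply: eq_cintegral => xi _.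
rewrite Kfh -cintegralZ//.
apply: (cintegrable_le (u := fun s => C * cw s)).
- by apply: cmeasurableM; [exact: cmeasurable_greens|exact: cmeasurable_K].
- by apply: measurable_funM => //; exact: measurable_cw.
- move=> s; rewrite normcM' normc_real ger0_norm ?green_ge0//.
  apply: le_trans (bound s xi _ (green_ge0 _) (green_le1 _)) _.
  by rewrite ler_piMr ?cauchy_weight_le1// mulr_ge0// cauchy_weight_ge0.
- exact: integral_cw_lty.
Qed.

Let fibre_trace_Phi p :
  cintegral leb setT (fun xi => phase p xi * K lambda f (xi - hy p) xi) =
  cintegral leb setT (fun zeta => Phi f (rV_cons (lambda, zeta)) (hy p) *
    expi (- dot (rV_cons (ht p, hx p)) (rV_cons (lambda, zeta))) *
    real_complex R (`|lambda^-1| ^+ n)).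
Proof.
rewrite (cintegral_rV_affine (2^-1 *: hy p) (invr_neq0 l0)); last first.
  apply: cmeasurableM; first exact: cmeasurable_phase.
  by apply: cmeasurable_K => //; exact: measurable_fun_rVB.
apply: eq_cintegral => zeta _; congr (_ * _); rewrite mulrC; congr (_ * expi _).
- rewrite /K /frequency; congr (Phi _ (rV_cons (_, _)) _).
    by apply: rV_eqP => j; rewrite !mxE; field.
  by apply: rV_eqP => j; rewrite !mxE; ring.
- rewrite hxN hyN htN dot_rV_cons rV_head_cons rV_tail_cons !dotNl dotNr dotDr !dotZr /=.
  by field.
Qed.

(** The trace of the superposition is the integral of [<V, U>], that is, of the
    kernel along the translated diagonal. *)
Lemma has_trace_fourier :
  has_trace (adjoint (fourier_measure mu lambda) \o fourier f lambda)
    (cintegral mu setT (fun p => cintegral leb setT (fun zeta =>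
       Phi f (rV_cons (lambda, zeta)) (hy p) *
       expi (- dot (rV_cons (ht p, hx p)) (rV_cons (lambda, zeta))) *
       real_complex R (`|lambda^-1| ^+ n)))).
Proof.
rewrite (_ : cintegral mu setT _ = cintegral nu setT
  (fun w => inner (fun xi => V (w, xi)) (fun xi => U (w, xi)))); first exact: has_trace_rank_one.
rewrite -(cfubini integrable_VU).2; apply: eq_cintegral => p _.
by rewrite fibre_trace fibre_trace_Phi.
Qed.

End trace_formula.

(** * Euclidean Fourier inversion *)

Section abel_regulariser.
Variables (R : realType) (m : nat).
Local Notation leb := (lebesgue_rV R m).
Implicit Types (v w z : 'rV[R]_m).

(** A summability kernel whose Fourier transform [cintegral_abel] is a positive
    multiple of [cauchy_weight]. *)
Definition abel z : R := expR (- \sum_i `|z 0 i|).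

Lemma abel_ge0 z : 0 <= abel z. Proof. exact: expR_ge0. Qed.

Lemma abel_le1 z : abel z <= 1.
Proof. by rewrite -expR0 ler_expR oppr_le0 sumr_ge0. Qed.

Lemma abel_prod z : abel z = \prod_i expR (- `|z 0 i|).
Proof. by rewrite /abel -sumrN expR_sum. Qed.

Lemma measurable_abel : measurable_fun setT abel.
Proof.
rewrite (_ : abel = fun z => \prod_i expR (- `|z 0 i|)); last first.
  by apply/funext => z; exact: abel_prod.
apply: (measurable_prod_coord (F := fun _ x => expR (- `|x|))) => i.
by apply: (measurableT_comp (@measurable_expR R)); apply: measurable_funN; exact: normr_measurable.
Qed.

Lemma expi_sum (I : Type) (r : seq I) (a : I -> R) :
  expi (\sum_(i <- r) a i) = \prod_(i <- r) expi (a i).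
Proof.
elim: r => [|i r ih]; first by rewrite !big_nil expi0.
by rewrite !big_cons expiD ih.
Qed.

Let abel_kernelE w z : real_complex R (abel z) * expi (dot w z) =
  \prod_i (real_complex R (expR (- `|z 0 i|)) * expi (w 0 i * z 0 i)).
Proof. by rewrite big_split /= -rmorph_prod -expi_sum abel_prod. Qed.

Lemma cintegrable_abel w :
  cintegrable leb setT (fun z => real_complex R (abel z) * expi (dot w z)).
Proof.
under eq_fun do rewrite abel_kernelE.
exact: (cintegral_prod_rV (F := fun (i : 'I_m) x => real_complex R (expR (- `|x|)) *
  expi (w 0 i * x)) (fun i => cintegrable_poisson_kernel (w 0 i))).1.
Qed.

Lemma cintegral_abel w :
  cintegral leb setT (fun z => real_complex R (abel z) * expi (dot w z)) =
  real_complex R (2 ^+ m * cauchy_weight w).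
Proof.
under eq_cintegral do rewrite abel_kernelE.
have [_ ->] := cintegral_prod_rV (F := fun (i : 'I_m) x => real_complex R (expR (- `|x|)) *
  expi (w 0 i * x)) (fun i => cintegrable_poisson_kernel (w 0 i)).
under eq_bigr do rewrite poisson_kernel.
by rewrite -rmorph_prod big_split /= prodr_const card_ord.
Qed.

Lemma integral_abel_lty : (\int[leb]_z (abel z)%:E < +oo)%E.
Proof.
have /cintegrable_normc_lty := (cintegral_prod_rV (F := fun (i : 'I_m) x => real_complex R (expR (- `|x|)) *
  expi (0 * x)) (fun i => cintegrable_poisson_kernel 0)).1.
congr (_ < _)%E; apply: eq_integral => z _; rewrite normc_prod abel_prod; congr (_%:E).
by apply: eq_bigr => i _; rewrite normcM' normc_expi mulr1 normc_real ger0_norm ?expR_ge0.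
Qed.

Lemma abel_scaled_cvg z : (fun k => abel (harmonic k *: z)) @ \oo --> (1 : R).
Proof.
have E k : abel (harmonic k *: z) = expR (- (harmonic k * \sum_i `|z 0 i|)).
  congr (expR (- _)); rewrite mulr_sumr; apply: eq_bigr => i _.
  by rewrite mxE normrM ger0_norm// invr_ge0.
under eq_fun do rewrite E.
rewrite -expR0; apply: continuous_cvg; first exact: continuous_expR.
have H : harmonic k * (\sum_i `|z 0 i|) @[k --> \oo] --> (0 : R).
  by rewrite -[X in _ --> X](mul0r (\sum_i `|z 0 i|)); apply: cvgMr_tmp; exact: cvg_harmonic.
by have := cvgN H; rewrite oppr0; exact.
Qed.

End abel_regulariser.

Section fourier_inversion.
Variables (R : realType) (m : nat).
Local Notation leb := (lebesgue_rV R m).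
Variables (u hat : 'rV[R]_m -> R[i]) (C C' : R).
Hypotheses (cu : ccontinuous u) (C0 : 0 <= C) (C'0 : 0 <= C').
Hypothesis uC : forall v, normc (u v) <= C * cauchy_weight v.
Hypothesis mhat : cmeasurable hat.
Hypothesis hatE : forall z, hat z = cintegral leb setT (fun v => u v * expi (dot v z)).
Hypothesis hatC : forall z, normc (hat z) <= C' * cauchy_weight z.

Let mu : cmeasurable u := cmeasurable_continuous cu.

Lemma ccvg_unique (a : nat -> R[i]) (c d : R[i]) : ccvg a c -> ccvg a d -> c = d.
Proof.
move=> [c1 c2] [d1 d2]; apply: complexP.
  exact: (cvg_unique _ c1 d1).
exact: (cvg_unique _ c2 d2).
Qed.

Lemma ccvg_realM (a : nat -> R[i]) (b : nat -> R) (c : R[i]) (d : R) :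
  ccvg a c -> b @ \oo --> d -> ccvg (fun k => a k * real_complex R (b k)) (c * real_complex R d).
Proof.
move=> [a1 a2] bd; split.
  by under eq_fun do rewrite !cE mulr0 subr0; rewrite !cE mulr0 subr0; exact: cvgM.
by under eq_fun do rewrite !cE mulr0 add0r; rewrite !cE mulr0 add0r; exact: cvgM.
Qed.

Lemma ccvg_cst (c : R[i]) : ccvg (fun=> c) c.
Proof. by split; exact: cvg_cst. Qed.

Let e_gt0 k : 0 < harmonic k :> R. Proof. by rewrite /harmonic invr_gt0. Qed.

(** The regularised inverse transform is an average of [u] around [v] at the scale
    [harmonic k], after two changes of variables and Fubini. *)
Lemma abel_mean v k :
  cintegral leb setT (fun z => hat z * expi (- dot v z) * real_complex R (abel (harmonic k *: z))) =
  cintegral leb setT (fun x => u (v + harmonic k *: x) * real_complex R (2 ^+ m * cauchy_weight x)).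
Proof.
set e := harmonic k; have e0 : e != 0 by rewrite gt_eqF// e_gt0.
pose g (w : 'rV[R]_m * 'rV[R]_m) := u w.1 * (real_complex R (abel w.2) * expi (dot (e^-1 *: (w.1 - v)) w.2)).
have ig : cintegrable (leb \x leb)%E setT g.
  apply: (cintegrable_fibered (a := fun w : 'rV[R]_m => C * cauchy_weight w)
    (u := fun w : 'rV[R]_m * 'rV[R]_m => abel w.2) (C := fine (\int[leb]_z (abel z)%:E))).
  - apply: cmeasurableM; first exact: cmeasurable_comp mu _.
    apply: cmeasurableM.
      by apply: cmeasurable_real; exact: (measurableT_comp (@measurable_abel R m)).
    apply: cmeasurable_expi; apply: measurable_fun_dot => //.
    by apply: measurable_fun_rVZ => //; exact: measurable_fun_rVB.
  - by apply: measurable_funM => //; exact: measurable_cauchy_weight.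
  - exact: (measurableT_comp (@measurable_abel R m)).
  - by move=> w; rewrite mulr_ge0// cauchy_weight_ge0.
  - by move=> w; exact: abel_ge0.
  - move=> w z; rewrite /g /= !normcM' normc_expi mulr1 normc_real ger0_norm ?abel_ge0//.
    by rewrite ler_wpM2r// abel_ge0.
  - move=> w; rewrite fineK// ge0_fin_numE; first exact: integral_abel_lty.
    by apply: integral_ge0 => z _; rewrite lee_fin abel_ge0.
  - exact: integral_cauchy_weight_lty.
(* the scale [e] moves from the kernel to the phase *)
rewrite (cintegral_rV_affine 0 (invr_neq0 e0)); last first.
  apply: cmeasurableM.
    by apply: cmeasurableM => //; apply: cmeasurable_expi; apply: measurable_funN; exact: measurable_fun_dot.
  apply: cmeasurable_real; apply: (measurableT_comp (@measurable_abel R m)).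
  exact: measurable_fun_rVZ.
transitivity (cintegral leb setT (fun z => cintegral leb setT (fun w => g (w, z)) *
    real_complex R (`|e^-1| ^+ m))).
  apply: eq_cintegral => z _; congr (_ * _).
  rewrite add0r scalerA mulfV// scale1r hatE -mulrA mulrC -cintegralZ; last first.
    apply: (cintegrable_le (u := fun v => C * cauchy_weight v)).
    - by apply: cmeasurableM => //; apply: cmeasurable_expi; exact: measurable_fun_dot.
    - by apply: measurable_funM => //; exact: measurable_cauchy_weight.
    - by move=> w; rewrite normcM' normc_expi mulr1.
    - exact: integral_cauchy_weight_lty.
  apply: eq_cintegral => w _; rewrite /g /=.
  rewrite (_ : dot (e^-1 *: (w - v)) z = - dot v (e^-1 *: z) + dot w (e^-1 *: z)).
    by rewrite expiD; ring.
  by rewrite [LHS]dotC !dotZr dotBr !(dotC z); ring.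
rewrite (_ : (fun z => _) = fun z => real_complex R (`|e^-1| ^+ m) *
    cintegral leb setT (fun w => g (w, z))); last by apply/funext => z; rewrite mulrC.
rewrite cintegralZ; last exact: (cfubini (cintegrable_swap ig)).1.
rewrite -(cfubini_swap ig).
have -> : (fun w => cintegral leb setT (fun z => g (w, z))) =
    fun w => u w * real_complex R (2 ^+ m * cauchy_weight (e^-1 *: (w - v))).
  apply/funext => w; rewrite -cintegral_abel -cintegralZ//.
  exact: cintegrable_abel.
have mean_integrable : cintegrable leb setT
    (fun x => u (v + e *: x) * real_complex R (2 ^+ m * cauchy_weight x)).
  have bound w : normc (u w) <= C.
    by apply: le_trans (uC w) _; rewrite ler_piMr ?cauchy_weight_le1.
  apply: (cintegrable_le (u := fun x => C * 2 ^+ m * cauchy_weight x)).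
  - apply: cmeasurableM.
      by apply: (cmeasurable_comp mu); apply: measurable_fun_rVD => //; exact: measurable_fun_rVZ.
    by apply: cmeasurable_real; apply: measurable_funM => //; exact: measurable_cauchy_weight.
  - by apply: measurable_funM => //; exact: measurable_cauchy_weight.
  - move=> x; rewrite normcM' normc_real ger0_norm ?mulr_ge0 ?cauchy_weight_ge0//.
    by rewrite mulrA ler_wpM2r ?cauchy_weight_ge0// ler_wpM2r.
  - by apply: integral_cauchy_weight_lty; rewrite mulr_ge0.
rewrite [in LHS](cintegral_rV_affine v e0); last first.
  apply: cmeasurableM; first exact: mu.
  apply: cmeasurable_real; apply: measurable_funM => //.
  apply: (measurableT_comp (@measurable_cauchy_weight R m)).
  by apply: measurable_fun_rVZ => //; exact: measurable_fun_rVB.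
rewrite (_ : (fun x => _) = fun x => real_complex R (`|e| ^+ m) *
    (u (v + e *: x) * real_complex R (2 ^+ m * cauchy_weight x))); last first.
  apply/funext => x; rewrite [v + _]addrC addrK scalerA mulVf// scale1r mulrC.
  by rewrite [_ + v]addrC.
rewrite cintegralZ// mulrA -rmorphM -exprMn -normrM mulVf// normr1 expr1n.
by rewrite rmorph1 mul1r.
Qed.

(** As the regularisation is removed, one side of [abel_mean] tends to the inverse
    transform by dominated convergence, the other to [u v] times the integral of
    the kernel by continuity. *)
Lemma fourier_inversion v :
  cintegral leb setT (fun z => hat z * expi (- dot v z)) = real_complex R ((2 * pi) ^+ m) * u v.
Proof.
have bound w : normc (u w) <= C.
  by apply: le_trans (uC w) _; rewrite ler_piMr ?cauchy_weight_le1.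
pose A k := cintegral leb setT (fun z => hat z * expi (- dot v z) *
  real_complex R (abel (harmonic k *: z))).
apply: (@ccvg_unique A).
  apply: (cdominated_convergence (u := fun z => C' * cauchy_weight z)).
  - move=> k; apply: cmeasurableM.
      by apply: cmeasurableM => //; apply: cmeasurable_expi; apply: measurable_funN; exact: measurable_fun_dot.
    apply: cmeasurable_real; apply: (measurableT_comp (@measurable_abel R m)).
    exact: measurable_fun_rVZ.
  - by apply: cmeasurableM => //; apply: cmeasurable_expi; apply: measurable_funN; exact: measurable_fun_dot.
  - move=> z; rewrite -[X in ccvg _ X]mulr1 -(rmorph1 (real_complex R)).
    by apply: ccvg_realM; [exact: ccvg_cst|exact: abel_scaled_cvg].
  - by apply: measurable_funM => //; exact: measurable_cauchy_weight.
  - move=> k z; rewrite !normcM' normc_expi mulr1 normc_real ger0_norm ?abel_ge0//.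
    by apply: le_trans (hatC z); rewrite ler_piMr ?normc_ge0 ?abel_le1.
  - exact: integral_cauchy_weight_lty.
rewrite (_ : A = fun k => cintegral leb setT (fun x => u (v + harmonic k *: x) *
  real_complex R (2 ^+ m * cauchy_weight x))); last by apply/funext => k; exact: abel_mean.
rewrite (_ : _ * u v = cintegral leb setT (fun x => u v * real_complex R (2 ^+ m * cauchy_weight x))).
  apply: (cdominated_convergence (u := fun x => C * 2 ^+ m * cauchy_weight x)).
  - move=> k; apply: cmeasurableM.
      apply: (cmeasurable_comp mu); apply: measurable_fun_rVD => //; exact: measurable_fun_rVZ.
    apply: cmeasurable_real; apply: measurable_funM => //; exact: measurable_cauchy_weight.
  - apply: cmeasurableM; first exact: cmeasurable_cst.
    by apply: cmeasurable_real; apply: measurable_funM => //; exact: measurable_cauchy_weight.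
  - move=> x; apply: ccvg_realM; last exact: cvg_cst.
    have vx : (v + harmonic k *: x) @[k --> \oo] --> v.
      rewrite -[X in _ --> X]addr0; apply: cvgD; first exact: cvg_cst.
      by rewrite -[X in _ --> X](scale0r x); apply: cvgZr_tmp; exact: cvg_harmonic.
    split; first exact: (cvg_comp _ _ vx (cu.1 v)).
    exact: (cvg_comp _ _ vx (cu.2 v)).
  - by apply: measurable_funM => //; exact: measurable_cauchy_weight.
  - move=> k x; rewrite normcM' normc_real ger0_norm ?mulr_ge0 ?cauchy_weight_ge0//.
    by rewrite mulrA ler_wpM2r ?cauchy_weight_ge0// ler_wpM2r.
  - by apply: integral_cauchy_weight_lty; rewrite mulr_ge0.
rewrite cintegralZ; last first.
  apply: (cintegrable_le (u := fun x => 2 ^+ m * cauchy_weight x)).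
  - by apply: cmeasurable_real; apply: measurable_funM => //; exact: measurable_cauchy_weight.
  - by apply: measurable_funM => //; exact: measurable_cauchy_weight.
  - by move=> x; rewrite normc_real ger0_norm// mulr_ge0 ?cauchy_weight_ge0.
  - exact: integral_cauchy_weight_lty.
rewrite mulrC; congr (_ * _); apply: complexP; rewrite ?cRe_int ?cIm_int !cE.
  rewrite /Rintegral; under eq_integral do rewrite cE EFinM.
  rewrite ge0_integralZl ?lee_fin//; last 2 first.
  - by apply/measurable_EFinP; exact: measurable_cauchy_weight.
  - by move=> x _; rewrite lee_fin cauchy_weight_ge0.
  by rewrite integral_cauchy_weight -EFinM /= prodr_const card_ord exprMn.
by rewrite -[LHS](mul0r (fine (leb setT))) -Rintegral_cst.
Qed.

End fourier_inversion.

(** * Integration over the central frequency *)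

Section central_variable.
Variables (R : realType) (n : nat) (f : heisenberg R n -> R[i]).
Variable mu : {finite_measure set (heisenberg R n) -> \bar R}.
Hypothesis cf : csch f.
Local Notation leb1 := (@lebesgue_measure R).
Local Notation leb := (lebesgue_rV R n).
Implicit Types (p : heisenberg R n).

(** The integrand of the inverse transform of [Phi f _ (hy p)] at the remaining
    coordinates [(t, x)] of [p]. *)
Definition spectrum p (z : 'rV[R]_n.+1) : R[i] :=
  Phi f z (hy p) * expi (- dot (rV_cons (ht p, hx p)) z).

Definition fibre_integral p (lambda : R) : R[i] :=
  cintegral leb setT (fun zeta => spectrum p (rV_cons (lambda, zeta))).

Lemma cmeasurable_spectrum d (T : measurableType d) (p : T -> heisenberg R n)
    (z : T -> 'rV[R]_n.+1) : measurable_fun setT p -> measurable_fun setT z ->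
  cmeasurable (fun w => spectrum (p w) (z w)).
Proof.
move=> mp mz; apply: cmeasurableM.
  by apply: cmeasurable_Phi => //; exact: measurable_hy.
apply: cmeasurable_expi; apply: measurable_funN; apply: measurable_fun_dot => //.
by apply: measurable_fun_rV_cons; [exact: measurable_ht|exact: measurable_hx].
Qed.

Lemma spectrum_decay : exists2 C : R, 0 <= C &
  forall p z, normc (spectrum p z) <= C * cauchy_weight z.
Proof.
have [C C0 hC] := Phi_decay cf; exists C => // p z.
by rewrite normcM' normc_expi mulr1.
Qed.

Lemma cauchy_weight_cons (lambda : R) (zeta : 'rV[R]_n) :
  cauchy_weight (rV_cons (lambda, zeta)) = (1 + lambda ^+ 2)^-1 * cauchy_weight zeta.
Proof.
rewrite /cauchy_weight big_ord_recl rV_cons0; congr (_ * _).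
by apply: eq_bigr => i _; rewrite rV_consS.
Qed.

Let cauchy_gt0 (x : R) : 0 < (1 + x ^+ 2)^-1.
Proof. by rewrite invr_gt0 ltr_pwDl// sqr_ge0. Qed.

Let measurable_cauchy : measurable_fun setT (fun x : measurableTypeR R => (1 + x ^+ 2)^-1).
Proof. by apply: continuous_measurable_fun; exact: continuous_oneDsqrV. Qed.

Let integral_cauchy_lty (C : R) : 0 <= C ->
  (\int[leb1]_x (C * (1 + x ^+ 2)^-1)%:E < +oo)%E.
Proof.
move=> C0; apply: ge0_integral_scale_lty => //.
  by move=> x; exact: ltW.
by rewrite integral_cauchy ltry.
Qed.

Lemma fibre_integral_decay : exists2 C : R, 0 <= C &
  forall p lambda, normc (fibre_integral p lambda) <= C * (1 + lambda ^+ 2)^-1.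
Proof.
have [C C0 hC] := spectrum_decay; have mcw := @measurable_cauchy_weight R n.
exists (2 * (C * \prod_(i < n) pi)).
  by rewrite !mulr_ge0// prodr_ge0// => i _; exact: pi_ge0.
move=> p lambda.
have E : (\int[leb]_zeta (C * (1 + lambda ^+ 2)^-1 * cauchy_weight zeta)%:E =
    (C * (1 + lambda ^+ 2)^-1 * \prod_(i < n) pi)%:E)%E.
  under eq_integral do rewrite EFinM.
  rewrite ge0_integralZl ?lee_fin//.
  - by rewrite integral_cauchy_weight.
  - exact/measurable_EFinP.
  - by move=> x _; rewrite lee_fin cauchy_weight_ge0.
  - by rewrite mulr_ge0// ltW.
apply: le_trans (normc_cintegral_le
  (u := fun zeta => C * (1 + lambda ^+ 2)^-1 * cauchy_weight zeta) _ _ _ _) _.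
- by apply: cmeasurable_spectrum => //; exact: measurable_fun_rV_cons.
- exact: measurable_funM.
- by move=> zeta; rewrite -mulrA -cauchy_weight_cons.
- by rewrite E ltry.
- by rewrite E /= -!mulrA [\prod_(i < n) _ * _]mulrC.
Qed.

(** The fibre integral supplies all the frequencies but the central one. *)
Lemma spectrum_inversion p :
  cintegral leb1 setT (fibre_integral p) = real_complex R ((2 * pi) ^+ n.+1) * f p.
Proof.
have [C C0 hC] := spectrum_decay.
have ms : cmeasurable (spectrum p) by exact: cmeasurable_spectrum.
have mcons : measurable_fun setT (@rV_cons R n) := @rV_cons_measurable R n.
have ic : cintegrable (leb1 \x leb)%E setT (fun w => spectrum p (rV_cons w)).
  apply: (cintegrable_fibered (a := fun x : measurableTypeR R => C * (1 + x ^+ 2)^-1)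
    (u := fun w : measurableTypeR R * 'rV[R]_n => cauchy_weight w.2)
    (C := \prod_(i < n) pi)).
  - exact: cmeasurable_comp ms mcons.
  - exact: measurable_funM.
  - exact: (measurableT_comp (@measurable_cauchy_weight R n)).
  - by move=> x; rewrite mulr_ge0// ltW.
  - by move=> w; rewrite cauchy_weight_ge0.
  - by move=> x zeta; rewrite -mulrA -cauchy_weight_cons.
  - by move=> x; rewrite integral_cauchy_weight.
  - exact: integral_cauchy_lty.
rewrite (cfubini ic).2 -(cintegral_image mcons (@lebesgue_rV_consE R n) ms).
rewrite -[in RHS](heis_pointK p).
have [C1 C10 hC1] := csch_heis_decay_v cf; have [C2 C20 hC2] := Phi_decay cf.
apply: (fourier_inversion (u := fun v => f (heis_point v (hy p)))
  (hat := fun z => Phi f z (hy p)) _ C10 C20) => //.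
- exact: ccontinuous_heis.
- exact: cmeasurable_Phi.
Qed.

Let mfi : cmeasurable (fun w : measurableTypeR R * heisenberg R n => fibre_integral w.2 w.1).
Proof.
apply: (cmeasurable_cintegral leb
  (g := fun w : (measurableTypeR R * heisenberg R n) * 'rV[R]_n =>
     spectrum w.1.2 (rV_cons (w.1.1, w.2)))).
apply: cmeasurable_spectrum.
  exact: measurableT_comp measurable_snd measurable_fst.
apply: measurable_fun_rV_cons => //.
exact: measurableT_comp measurable_fst measurable_fst.
Qed.

Let fi_integrable : cintegrable (leb1 \x mu)%E setT
  (fun w : measurableTypeR R * heisenberg R n => fibre_integral w.2 w.1).
Proof.
have [C C0 hC] := fibre_integral_decay.
apply: (cintegrable_fibered (a := fun x : measurableTypeR R => C * (1 + x ^+ 2)^-1)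
  (u := fun w : measurableTypeR R * heisenberg R n => 1)
  (C := fine (mu setT))) => //.
- exact: measurable_funM.
- by move=> x; rewrite mulr_ge0// ltW.
- by move=> x p; rewrite mulr1.
- by move=> x; rewrite integral_cst// mul1e fineK//; exact: fin_num_measure.
- exact: integral_cauchy_lty.
Qed.

Definition total_fibre (lambda : R) := cintegral mu setT (fun p => fibre_integral p lambda).

Lemma cintegrable_total_fibre : cintegrable leb1 setT total_fibre.
Proof. exact: (cfubini fi_integrable).1. Qed.

Lemma cintegral_total_fibre :
  cintegral leb1 setT total_fibre = real_complex R ((2 * pi) ^+ n.+1) * cintegral mu setT f.
Proof.
rewrite (cfubini_swap fi_integrable).
under eq_cintegral do rewrite spectrum_inversion.
rewrite cintegralZ//; have [C C0 hC] := csch_decay cf.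
apply: (cintegrable_le (u := fun=> C)) => //.
- exact/cmeasurable_continuous/csch_continuous.
- by move=> p; apply: le_trans (hC p) _; rewrite ler_piMr ?cauchy_weight_le1.
- rewrite integral_cst//; apply: lte_mul_pinfty => //.
  by rewrite -ge0_fin_numE//; exact: fin_num_measure.
Qed.

End central_variable.

(** * The inversion formula *)

Section plancherel_measure.
Variables (R : realType) (n : nat).
Local Notation leb1 := (@lebesgue_measure R).
Local Notation density := (@plancherel_density R n).
Local Notation punctured := [set lambda : R | lambda != 0].

Lemma plancherel_density_gt0 (lambda : R) : lambda != 0 -> 0 < density lambda.
Proof.
by move=> l0; rewrite divr_gt0 ?exprn_gt0 ?normr_gt0// mulr_gt0// pi_gt0.
Qed.

Let density_ge0 (lambda : R) : 0 <= density lambda.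
Proof. by rewrite /plancherel_density divr_ge0 ?exprn_ge0// mulr_ge0// pi_ge0. Qed.

Let measurable_density : measurable_fun setT (density : measurableTypeR R -> R).
Proof.
apply: measurable_funM; last exact: measurable_cst.
by apply: measurable_funX; exact: normr_measurable.
Qed.

Let measurable_punctured : measurable (punctured : set (measurableTypeR R)).
Proof.
rewrite (_ : punctured = ~` [set 0]); first exact: measurableC.
by apply/seteqP; split => x /= /eqP.
Qed.

(** The point [0] is negligible, so that a function on the punctured line may be
    extended to the line by [0]. *)
Lemma plancherel_integral (tau G : R -> R[i]) :
  cintegrable leb1 setT G ->
  (forall lambda, lambda != 0 -> tau lambda * real_complex R (density lambda) = G lambda) ->
  cintegrable (plancherel n) punctured tau /\
  cintegral (plancherel n) punctured tau = cintegral leb1 setT G.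
Proof.
move=> iG tauG; have mG := cintegrable_measurable iG.
(* equal to [tau] off [0], but visibly measurable *)
pose tau0 (lambda : measurableTypeR R) :=
  G lambda * real_complex R (\1_punctured lambda * (density lambda)^-1).
have mtau0 : cmeasurable tau0.
  apply: cmeasurableM => //; apply: cmeasurable_real; apply: measurable_funM.
    exact: measurable_indic.
  under eq_fun do rewrite -powR_inv1//.
  by apply: (measurableT_comp (measurable_powR (R := R) (-1))).
have tau0E lambda : lambda != 0 -> tau0 lambda = tau lambda.
  move=> l0; rewrite /tau0 indicE mem_set// mul1r -tauG// -mulrA -rmorphM.
  by rewrite mulfV ?rmorph1 ?mulr1// gt_eqF// plancherel_density_gt0.
have tau00 lambda : lambda = 0 -> tau0 lambda = 0.
  by move=> ->; rewrite /tau0 indicE memNset ?mul0r ?mulr0//= eqxx.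
have tau0G lambda : lambda != 0 -> tau0 lambda * real_complex R (density lambda) = G lambda.
  by move=> l0; rewrite tau0E// tauG.
have tau_patch (part : R[i] -> R) : part 0 = 0 ->
    (fun lambda => part (tau lambda)) \_ punctured = (fun lambda => part (tau0 lambda)).
  move=> part0; apply/funext => lambda; rewrite patchE.
  case: ifPn => [/set_mem /= l0|]; first by rewrite tau0E.
  by move=> /negP; rewrite inE /= => /negP; rewrite negbK => /eqP ->; rewrite tau00.
have mid : measurable_fun setT (id : measurableTypeR R -> measurableTypeR R) by [].
have mtau0d : cmeasurable (fun x : measurableTypeR R => tau0 x * real_complex R (density x)).
  by apply: cmeasurableM => //; exact: cmeasurable_real.
have nuE A : measurable A ->
    plancherel n A = (\int[leb1]_(x in id @^-1` A) (density x)%:E)%E by [].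
split; last first.
  transitivity (cintegral (plancherel n) setT tau0).
    by apply: complexP; rewrite ?cRe_int ?cIm_int Rintegral_mkcond tau_patch.
  rewrite (cintegral_weighted_image mid measurable_density density_ge0 nuE)//.
  by apply: cintegral_lebesgue_ae0.
have itau0 : cintegrable (plancherel n) setT tau0.
  apply: (cintegrable_weighted_image mid measurable_density density_ge0 nuE) => //.
  apply: (cintegrable_le (u := fun x : measurableTypeR R => normc (G x))) => //.
  - exact: measurable_normc.
  - move=> x; have [->|x0] := eqVneq x 0; last by rewrite tau0G.
    by rewrite tau00// mul0r normc0' normc_ge0.
  - exact: cintegrable_normc_lty.
have patchE' (part : R[i] -> R) : part 0 = 0 ->
    (fun lambda => (part (tau lambda))%:E) \_ punctured = (fun lambda => (part (tau0 lambda))%:E).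
  move=> part0; apply/funext => lambda.
  have /(congr1 (fun r => r lambda)) /= := tau_patch _ part0.
  by rewrite !patchE => <-; case: ifP.
by case: itau0 => i1 i2; split; apply/integrable_mkcond => //; rewrite patchE'.
Qed.

End plancherel_measure.

Section trace_formula_on_the_line.
Variables (R : realType) (n : nat) (f : heisenberg R n -> R[i]).
Variable mu : {finite_measure set (heisenberg R n) -> \bar R}.
Hypothesis cf : csch f.
Local Notation leb := (lebesgue_rV R n).
Local Notation T lambda := (adjoint (fourier_measure mu lambda) \o fourier f lambda).

Lemma has_trace_total_fibre (lambda : R) : lambda != 0 ->
  has_trace (T lambda) (total_fibre f mu lambda * real_complex R (`|lambda^-1| ^+ n)).
Proof.
move=> l0; have [h ch hE] := K_green lambda cf.
have := has_trace_fourier l0 cf ch hE mu.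
congr (has_trace _ _); rewrite [RHS]mulrC /total_fibre -cintegralZ; last first.
  have [C C0 hC] := fibre_integral_decay cf.
  apply: (cintegrable_le (u := fun=> C * (1 + lambda ^+ 2)^-1)) => //.
  - apply: (cmeasurable_cintegral leb (g := fun w => spectrum f w.1 (rV_cons (lambda, w.2)))).
    by apply: cmeasurable_spectrum => //; exact: measurable_fun_rV_cons.
  - rewrite integral_cst//; apply: lte_mul_pinfty => //.
      by rewrite lee_fin mulr_ge0// invr_ge0 addr_ge0 ?sqr_ge0.
    by rewrite -ge0_fin_numE//; exact: fin_num_measure.
apply: eq_cintegral => p _; rewrite /fibre_integral -cintegralZ; last first.
  have [C C0 hC] := spectrum_decay cf.
  apply: (cintegrable_le (u := fun zeta => C * (1 + lambda ^+ 2)^-1 * cauchy_weight zeta)).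
  - by apply: cmeasurable_spectrum => //; exact: measurable_fun_rV_cons.
  - by apply: measurable_funM => //; exact: measurable_cauchy_weight.
  - by move=> zeta; rewrite -mulrA -cauchy_weight_cons.
  - by apply: integral_cauchy_weight_lty; rewrite mulr_ge0// invr_ge0 addr_ge0 ?sqr_ge0.
by apply: eq_cintegral => zeta _; rewrite mulrC.
Qed.

End trace_formula_on_the_line.

Theorem theorem1p3 (R : realType) (n : nat)
    (f : heisenberg R n -> R[i])
    (mu : {finite_measure set (heisenberg R n) -> \bar R})
    (hf : schwartz f) (hmu : radon_measure mu)
    (hmuc : compactly_supported mu) :
  let T := fun lambda : R =>
    adjoint (fourier_measure mu lambda) \o fourier f lambda in
  (forall lambda : R, lambda != 0 -> exists c : R[i], has_trace (T lambda) c) /\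
  cintegrable (plancherel n) [set lambda : R | lambda != 0]
    (fun lambda => trace (T lambda)) /\
  cintegral mu [set: heisenberg R n] f =
  cintegral (plancherel n) [set lambda : R | lambda != 0]
    (fun lambda => trace (T lambda)).
Proof.
move=> T; have cf := csch_schwartz hf.
have hT := has_trace_total_fibre mu cf.
split; first by move=> lambda l0; eexists; exact: hT.
pose c : R[i] := real_complex R ((2 * pi) ^+ n.+1)^-1.
have iG := cintegrableZ c (cintegrable_total_fibre mu cf).
have pi0 : (2 * pi) ^+ n.+1 != 0 :> R by rewrite expf_neq0// gt_eqF// mulr_gt0// pi_gt0.
have [|itau ->] := plancherel_integral (n := n) (tau := fun lambda => trace (T lambda)) iG.
  move=> lambda l0; rewrite (trace_unique (hT lambda l0)) -mulrA -rmorphM mulrC.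
  congr (_ * _); congr (real_complex R _); rewrite /plancherel_density mulrA -exprMn -normrM.
  by rewrite mulVf// normr1 expr1n mul1r.
split; first exact: itau.
rewrite cintegralZ; last exact: cintegrable_total_fibre.
rewrite cintegral_total_fibre// mulrA /c -rmorphM mulVf//.
by rewrite rmorph1 mul1r.
Qed.
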